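(* Let $\bar\sigma$ be a conformal unit defining density for a hypersurface $\Sigma$ in a conformal manifold $(M,\boldsymbol c)$ of dimension $d\ge3$. Then the ASC obstruction density $\mathcal B$ is given by the holographic formula $$\mathcal B=\frac2{d!\,(d-1)!}\,\bar D_A\Big[\Sigma^A_B\Big(\mathsf P_{d-1}N^B+(-1)^{d-2}\big[(\bar I\cdot D)^{d-2}(X^BK_{\rm ext})\big]\Big)\Big|_\Sigma\Big],$$ where $K_{\rm ext}:=P_{AB}P^{AB}$, $P^{AB}:=\widehat D^A\bar I^B$, $\bar I:=I_{\bar\sigma}$, and $N^B$ is any extension of the normal tractor off $\Sigma$.
   Context: $(M,\boldsymbol c)$ is a smooth oriented $d$-manifold with a conformal class of Riemannian metrics. $\mathcal E[w]$ is the bundle of conformal densities of weight $w$ (oriented $\frac w{2d}$-th root of $(\Lambda^dTM)^2$); $\boldsymbol g$ is the conformal metric. Tractors: the standard tractor bundle $\mathcal T=\mathcal TM$ is the rank $d+2$ bundle identified by each $g\in\boldsymbol c$ with $\mathcal E[1]\oplus T^*M[1]\oplus\mathcal E[-1]$, the identifications for $g$ and $e^{2\Upsilon}g$ being related by $(\sigma,\mu_b,\rho)\mapsto(\sigma,\mu_b+\sigma\Upsilon_b,\rho-\Upsilon^c\mu_c-\frac12\sigma\Upsilon^c\Upsilon_c)$, $\Upsilon_b=\nabla_b\Upsilon$. Tractor connection: $\nabla_a(\sigma,\mu_b,\rho)=(\nabla_a\sigma-\mu_a,\nabla_a\mu_b+\boldsymbol g_{ab}\rho+\mathrm P_{ab}\sigma,\nabla_a\rho-\mathrm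 P_{ac}\mu^c)$, with $\mathrm P$ the Schouten tensor ($\mathrm{Ric}=(d-2)\mathrm P+\mathrm Jg$, $\mathrm J=\mathrm P^a{}_a$). Tractor metric $h$: $U\cdot V=\sigma\kappa+\boldsymbol g^{ab}\mu_a\nu_b+\rho\tau$ for $U=(\sigma,\mu_a,\rho)$, $V=(\tau,\nu_a,\kappa)$; it raises and lowers tractor indices. $X^A=(0,0,1)\in\Gamma(\mathcal T^A[1])$ is the canonical tractor. Thomas D-operator on weight $w$ tractors in a scale: $D^A=\big((d+2w-2)w,(d+2w-2)\nabla_a,-(\Delta+\mathrm Jw)\big)$ with $\nabla$ the Levi-Civita-coupled tractor connection, $\Delta=\boldsymbol g^{ab}\nabla_a\nabla_b$; $\widehat D^A=\frac1{d+2w-2}D^A$ for $w\neq1-\frac d2$. For $\sigma\in\Gamma(\mathcal E[1])$, $I^A_\sigma=\widehat D^A\sigma$, $I_\sigma^2=I_\sigma\cdot I_\sigma$. A defining density for a smoothly embedded codimension-1 submanifold $\Sigma$ is a $\sigma\in\Gamma(\mathcal E[1])$ with zero locus $\Sigma$ and $\nabla\sigma\ne0$ on $\Sigma$; it is conformal unit if $I_\sigma^2=1+\sigma^dB_\sigma$ with $B_\sigma$ smooth. The ASC obstruction density is $\mathcal B=B_{\bar\sigma}|_\Sigma\in\Gamma(\mathcal E\Sigma[-d])$, for any such $\bar\sigma$. $\mathsf P_{d-1}:\Gamma(\mathcal T^\Phi M[0])|_\Sigma\to\Gamma(\mathcal T^\Phi M[1-d])|_\Sigma$ is the operator along $\Sigma$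 determined by the tangential operator $\big(-\frac1{\bar I^2}\bar I\cdot D\big)^{d-1}$ (for arbitrary tractor bundles $\mathcal T^\Phi M$). The normal tractor is, along $\Sigma$ in a scale, $N^A=(0,\hat n_a,-H)$, with $\hat n_a$ the unit conormal (weight 1, oriented as $\nabla\bar\sigma$), $H=\frac1{d-1}\nabla^{\top a}\hat n_a$ the mean curvature. $\Sigma^A_B:=\delta^A_B-N^AN_B$ is the projection to $N^\perp\subset\mathcal TM|_\Sigma$. $N^\perp$ is identified with the intrinsic standard tractor bundle $\mathcal T\Sigma$ of the induced conformal structure $(\Sigma,\bar{\boldsymbol c})$ by $(v^+,v_a,v^-)\mapsto(v^+,v_a-\hat n_aHv^+,v^-+\frac12H^2v^+)$. $\bar D_A$ is the intrinsic Thomas D-operator of $(\Sigma,\bar{\boldsymbol c})$ (dimension $d-1$; in dimension two $\bar{\mathrm J}=\frac12\overline{\mathrm{Sc}}$), here contracted with a weight $1-d$ section of $\mathcal T\Sigma$. *)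

(* Defs.v *)
From HB Require Import structures.
From mathcomp Require Import all_boot all_order all_algebra.
From mathcomp Require Import all_classical all_reals all_analysis.

Set Implicit Arguments.
Unset Strict Implicit.
Unset Printing Implicit Defensive.

Import Order.TTheory GRing.Theory Num.Theory.
Import numFieldNormedType.Exports.

Local Open Scope classical_set_scope.
Local Open Scope ring_scope.

(* Covectors and vectors are rows of components.  [jacobian f x] is the
   library's: its entry (a, i) is the a-th partial derivative of the i-th
   component of f, so pulling a covector row u back along f is
   [u *m (jacobian f x)^T]. *)

Section PartialDerivatives.
Variables (R : realType) (n : nat).

Definition pd (f : 'rV[R]_n -> R) (a : 'I_n) (x : 'rV[R]_n) : R :=
  'D_(delta_mx 0 a) f x.

Definition iterated_pd (s : seq 'I_n) (f : 'rV[R]_n -> R) : 'rV[R]_n -> R :=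
  foldr (fun a h => pd h a) f s.

(* C^infinity: every iterated partial derivative exists and is continuous. *)
Definition smooth_on (U : set 'rV[R]_n) (f : 'rV[R]_n -> R) : Prop :=
  forall (s : seq 'I_n) (x : 'rV[R]_n), U x ->
    {for x, continuous (iterated_pd s f)} /\
    forall a : 'I_n, derivable (iterated_pd s f) x (delta_mx 0 a).

Definition pdv k (V : 'rV[R]_n -> 'rV[R]_k) (a : 'I_n) (x : 'rV[R]_n) :
  'rV[R]_k := \row_j pd (fun y => V y 0 j) a x.

End PartialDerivatives.

Section Manifolds.
Variable R : realType.

Record chart (T : topologicalType) (n : nat) := Chart {
  cdom : set T;
  ccod : set 'rV[R]_n;
  cmap : T -> 'rV[R]_n;
  cinv : 'rV[R]_n -> T;
  open_cdom : open cdom;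
  open_ccod : open ccod;
  cmap_cod : forall p, cdom p -> ccod (cmap p);
  cinv_dom : forall x, ccod x -> cdom (cinv x);
  cmapK : forall p, cdom p -> cinv (cmap p) = p;
  cinvK : forall x, ccod x -> cmap (cinv x) = x;
  cmap_continuous : forall p, cdom p -> {for p, continuous cmap};
  cinv_continuous : forall x, ccod x -> {for x, continuous cinv}
}.

Definition overlap T n (A B : chart T n) : set 'rV[R]_n :=
  [set x | ccod A x /\ cdom B (cinv A x)].

Definition transition T n (A B : chart T n) (x : 'rV[R]_n) : 'rV[R]_n :=
  cmap B (cinv A x).

Record manifold (n : nat) := Manifold {
  mcar :> topologicalType;
  mhausdorff : hausdorff_space mcar;
  msecond_countable : @second_countable mcar;
  midx : Type;
  atlas : midx -> chart mcar n;
  atlas_cover : forall p : mcar, exists i, cdom (atlas i) p;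
  atlas_smooth : forall (i j : midx) (k : 'I_n),
    smooth_on (overlap (atlas i) (atlas j))
              (fun x => transition (atlas i) (atlas j) x 0 k)
}.

(* The given atlas is an oriented one. *)
Definition oriented n (M : manifold n) : Prop :=
  forall (i j : midx M) x, overlap (atlas i) (atlas j) x ->
    0 < \det (jacobian (transition (atlas i) (atlas j)) x).

Definition smooth_function n (M : manifold n) (f : M -> R) : Prop :=
  forall i : midx M, smooth_on (ccod (atlas i)) (fun x => f (cinv (atlas i) x)).

Section Maps.
Variables (m n : nat) (S : manifold m) (M : manifold n) (f : S -> M).

Definition local_map (j : midx S) (i : midx M) (y : 'rV[R]_m) : 'rV[R]_n :=
  cmap (atlas i) (f (cinv (atlas j) y)).

Definition local_dom (j : midx S) (i : midx M) : set 'rV[R]_m :=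
  [set y | ccod (atlas j) y /\ cdom (atlas i) (f (cinv (atlas j) y))].

Definition smooth_map : Prop :=
  continuous f /\
  forall j i (k : 'I_n),
    smooth_on (local_dom j i) (fun y => local_map j i y 0 k).

Definition immersion : Prop :=
  smooth_map /\
  forall j i y, local_dom j i y -> row_free (jacobian (local_map j i) y).

Definition smooth_embedding : Prop :=
  [/\ immersion, injective f &
      forall V : set S, open V -> exists2 W : set M, open W & V = f @^-1` W].

End Maps.

(* Values of component functions outside the chart images are irrelevant,
   here and in all the structures below. *)
Record metric n (M : manifold n) := Metric {
  gmat : midx M -> 'rV[R]_n -> 'M[R]_n;
  gmat_smooth : forall i a b,
    smooth_on (ccod (atlas i)) (fun x => gmat i x a b);
  gmat_sym : forall i x, ccod (atlas i) x -> (gmat i x)^T = gmat i x;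
  gmat_pos : forall i x, ccod (atlas i) x ->
    forall v : 'rV[R]_n, v != 0 -> 0 < (v *m gmat i x *m v^T) 0 0;
  gmat_change : forall i j x, overlap (atlas i) (atlas j) x ->
    let J := jacobian (transition (atlas i) (atlas j)) x in
    gmat i x = J *m gmat j (transition (atlas i) (atlas j) x) *m J^T
}.

(* g' = e^{2 Y} g *)
Definition rescaled n (M : manifold n) (Y : M -> R) (g g' : metric M) : Prop :=
  forall i x, ccod (atlas i) x ->
    gmat g' i x = expR (2 * Y (cinv (atlas i) x)) *: gmat g i x.

Record conformal_class n (M : manifold n) := ConformalClass {
  cc :> metric M -> Prop;
  cc_nonempty : exists g, cc g;
  cc_rescaled : forall g, cc g -> forall g',
    cc g' <-> exists2 Y : M -> R, smooth_function Y & rescaled Y g g'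
}.

(* Sections of the (w / 2n)-th root of (Lambda^n TM)^2: under a change of
   coordinates x -> x', the component of a section of (Lambda^n TM)^2 is
   multiplied by det(dx'/dx)^2. *)
Record density n (M : manifold n) (w : R) := Density {
  dens : midx M -> 'rV[R]_n -> R;
  dens_smooth : forall i, smooth_on (ccod (atlas i)) (dens i);
  dens_change : forall i j x, overlap (atlas i) (atlas j) x ->
    dens j (transition (atlas i) (atlas j) x) =
      `| \det (jacobian (transition (atlas i) (atlas j)) x) | `^ (w / n%:R)
      * dens i x
}.

(* The scale g trivializes the weight w density bundle by the parallel
   section (det g)^{- w / 2n}; under g -> e^{2 Y} g the resulting function is
   multiplied by e^{w Y}. *)
Definition in_scale n (M : manifold n) w (g : metric M) (f : density M w)
    (i : midx M) (x : 'rV[R]_n) : R :=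
  dens f i x * (\det (gmat g i x)) `^ (w / (2 * n%:R)).

End Manifolds.

Arguments midx {R n} _.
Arguments atlas {R n} _ _.

(* Elements (s, mu, r) of the standard tractor bundle, split by a scale g
   into E[1] + T*M[1] + E[-1], the densities being trivialized by g. *)
Section Slots.
Variables (R : realType) (n : nat).

Definition mktr (s : R) (mu : 'rV[R]_n) (r : R) : 'rV[R]_(1 + n + 1) :=
  row_mx (row_mx s%:M mu) r%:M.

Definition ttop (V : 'rV[R]_(1 + n + 1)) : R := (lsubmx (lsubmx V)) 0 0.
Definition tmid (V : 'rV[R]_(1 + n + 1)) : 'rV[R]_n := rsubmx (lsubmx V).
Definition tbot (V : 'rV[R]_(1 + n + 1)) : R := (rsubmx V) 0 0.

End Slots.

(* Tensor and tractor calculus in a chart, in the scale of the metric g.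
   Weighted objects are represented by their trivializations in this scale, in
   which the Levi-Civita connection on weights is the flat one. *)
Section LocalCalculus.
Variables (R : realType) (n : nat) (g : 'rV[R]_n -> 'M[R]_n).

Definition ginv (x : 'rV[R]_n) : 'M[R]_n := invmx (g x).

(* Gamma^c_{ab} *)
Definition christoffel (c a b : 'I_n) (x : 'rV[R]_n) : R :=
  2^-1 * \sum_(l < n) ginv x c l *
    (pd (fun y => g y b l) a x + pd (fun y => g y a l) b x
     - pd (fun y => g y a b) l x).

(* Sign convention: positive on round spheres. *)
Definition ricci (x : 'rV[R]_n) (a b : 'I_n) : R :=
  \sum_(k < n) pd (christoffel k a b) k x
  - \sum_(k < n) pd (christoffel k a k) b x
  + \sum_(k < n) \sum_(l < n) christoffel k k l x * christoffel l a b x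
  - \sum_(k < n) \sum_(l < n) christoffel k b l x * christoffel l a k x.

Definition scalar_curvature (x : 'rV[R]_n) : R :=
  \sum_(a < n) \sum_(b < n) ginv x a b * ricci x a b.

(* The trace of Ric = (n - 2) P + J g with J = tr P; for n = 2 this is
   J = Sc / 2. *)
Definition schoutenJ (x : 'rV[R]_n) : R :=
  scalar_curvature x / (2 * (n%:R - 1)).

(* For n = 2 the equation Ric = (n - 2) P + J g does not determine P; the
   trace-free part chosen here (zero) cancels from the contraction D_A V^A,
   the only place where the case n = 2 occurs. *)
Definition schouten (x : 'rV[R]_n) (a b : 'I_n) : R :=
  if n == 2%N then schoutenJ x / 2 * g x a b
  else (ricci x a b - schoutenJ x * g x a b) / (n%:R - 2).

Definition connection (k : nat) : Type :=
  ('rV[R]_n -> 'rV[R]_k) -> 'I_n -> 'rV[R]_n -> 'rV[R]_k.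

Definition density_connection : connection 1 := fun f => pdv f.

Definition tractor_connection : connection (1 + n + 1) := fun V a x =>
  mktr
    (pd (fun y => ttop (V y)) a x - tmid (V x) 0 a)
    (\row_b (pd (fun y => tmid (V y) 0 b) a x
             - \sum_(c < n) christoffel c a b x * tmid (V x) 0 c
             + g x a b * tbot (V x) + schouten x a b * ttop (V x)))
    (pd (fun y => tbot (V y)) a x
     - \sum_(b < n) \sum_(c < n)
         schouten x a b * ginv x b c * tmid (V x) 0 c).

Definition tractor_metric (x : 'rV[R]_n) : 'M[R]_(1 + n + 1) :=
  block_mx (block_mx 0 0 0 (ginv x)) (col_mx 1%:M 0) (row_mx 1%:M 0) 0.

Definition tdot (x : 'rV[R]_n) (U V : 'rV[R]_(1 + n + 1)) : R :=
  (U *m tractor_metric x *m V^T) 0 0.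

(* The operators below act on weight w sections of a bundle of rank k with
   connection nab (k = 1 for densities, k = n + 2 for standard tractors). *)

Definition laplacian k (nab : connection k) (V : 'rV[R]_n -> 'rV[R]_k)
    (x : 'rV[R]_n) : 'rV[R]_k :=
  \sum_(a < n) \sum_(b < n) ginv x a b *:
    (nab (nab V b) a x - \sum_(c < n) christoffel c a b x *: nab V c x).

(* D^A V: the row index is the (upper) tractor index A. *)
Definition thomasD k (nab : connection k) (w : R) (V : 'rV[R]_n -> 'rV[R]_k)
    (x : 'rV[R]_n) : 'M[R]_(1 + n + 1, k) :=
  let c := n%:R + 2 * w - 2 in
  col_mx
    (col_mx ((c * w) *: V x) (\matrix_(a < n) (c *: nab V a x)))
    (- (laplacian nab V x + (schoutenJ x * w) *: V x)).

Definition hatD k (nab : connection k) (w : R) (V : 'rV[R]_n -> 'rV[R]_k)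
    (x : 'rV[R]_n) : 'M[R]_(1 + n + 1, k) :=
  (n%:R + 2 * w - 2)^-1 *: thomasD nab w V x.

Definition scale_tractor (sigma : 'rV[R]_n -> R) (x : 'rV[R]_n) :
    'rV[R]_(1 + n + 1) :=
  (hatD density_connection 1 (fun y => (sigma y)%:M) x)^T.

Definition IdotD (I : 'rV[R]_n -> 'rV[R]_(1 + n + 1)) k (nab : connection k)
    (w : R) (V : 'rV[R]_n -> 'rV[R]_k) (x : 'rV[R]_n) : 'rV[R]_k :=
  I x *m tractor_metric x *m thomasD nab w V x.

(* (I.D)^m on weight w sections; each application lowers the weight by one. *)
Fixpoint IdotD_pow (I : 'rV[R]_n -> 'rV[R]_(1 + n + 1)) k (nab : connection k)
    (w : R) (m : nat) (V : 'rV[R]_n -> 'rV[R]_k) : 'rV[R]_n -> 'rV[R]_k :=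
  if m is m'.+1
  then IdotD I nab (w - m'%:R) (IdotD_pow I nab w m' V)
  else V.

(* (- 1/I^2 I.D)^m on weight w sections. *)
Fixpoint tangential_pow (I : 'rV[R]_n -> 'rV[R]_(1 + n + 1)) k
    (nab : connection k) (w : R) (m : nat) (V : 'rV[R]_n -> 'rV[R]_k) :
    'rV[R]_n -> 'rV[R]_k :=
  if m is m'.+1
  then fun x => (- (tdot x (I x) (I x))^-1) *:
         IdotD I nab (w - m'%:R) (tangential_pow I nab w m' V) x
  else V.

(* D_A V^A *)
Definition thomasD_contraction (w : R) (V : 'rV[R]_n -> 'rV[R]_(1 + n + 1))
    (x : 'rV[R]_n) : R :=
  \sum_A \sum_B
    tractor_metric x A B * thomasD tractor_connection w V x A B.

Definition ambient_P (sigma : 'rV[R]_n -> R) (x : 'rV[R]_n) :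
    'M[R]_(1 + n + 1) :=
  hatD tractor_connection 0 (scale_tractor sigma) x.

Definition Kext (sigma : 'rV[R]_n -> R) (x : 'rV[R]_n) : R :=
  let P := ambient_P sigma x in
  let Plow := tractor_metric x *m P *m tractor_metric x in
  \sum_A \sum_B Plow A B * P A B.

Definition canonical_X : 'rV[R]_(1 + n + 1) := mktr 0 0 1.

Definition grad (f : 'rV[R]_n -> R) (x : 'rV[R]_n) : 'rV[R]_n :=
  \row_a pd f a x.

(* The unit conormals of the level sets of sigma, near its zero locus. *)
Definition unit_conormal (sigma : 'rV[R]_n -> R) (x : 'rV[R]_n) : 'rV[R]_n :=
  (Num.sqrt ((grad sigma x *m ginv x *m (grad sigma x)^T) 0 0))^-1
    *: grad sigma x.

Definition mean_curvature (sigma : 'rV[R]_n -> R) (x : 'rV[R]_n) : R :=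
  let nu := unit_conormal sigma x *m ginv x in
  (n%:R - 1)^-1 *
  \sum_(a < n) \sum_(b < n) (ginv x a b - nu 0 a * nu 0 b) *
    (pd (fun y => unit_conormal sigma y 0 b) a x
     - \sum_(c < n) christoffel c a b x * unit_conormal sigma x 0 c).

Definition normal_tractor (sigma : 'rV[R]_n -> R) (x : 'rV[R]_n) :
    'rV[R]_(1 + n + 1) :=
  mktr 0 (unit_conormal sigma x) (- mean_curvature sigma x).

(* Sigma^A_B V^B *)
Definition normal_projection (sigma : 'rV[R]_n -> R) (x : 'rV[R]_n)
    (V : 'rV[R]_(1 + n + 1)) : 'rV[R]_(1 + n + 1) :=
  V - tdot x (normal_tractor sigma x) V *: normal_tractor sigma x.

(* The section between the brackets of D-bar_A, on the coordinate domain of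
   the ambient manifold. *)
Definition holographic_section (sigma : 'rV[R]_n -> R)
    (N : 'rV[R]_n -> 'rV[R]_(1 + n + 1)) (x : 'rV[R]_n) :
    'rV[R]_(1 + n + 1) :=
  let I := scale_tractor sigma in
  normal_projection sigma x
    (tangential_pow I tractor_connection 0 n.-1 N x
     + (-1) ^+ (n - 2) *:
       IdotD_pow I tractor_connection (-1) (n - 2)
         (fun y => Kext sigma y *: canonical_X) x).

Section Hypersurface.
Variables (m : nat) (F : 'rV[R]_m -> 'rV[R]_n).

Definition pullback_metric (y : 'rV[R]_m) : 'M[R]_m :=
  jacobian F y *m g (F y) *m (jacobian F y)^T.

(* The isomorphism of N^perp with the intrinsic tractor bundle.  The covector
   v_a - n_a H v^+ annihilates the normal, and is regarded as a covector on
   the hypersurface by pulling it back. *)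
Definition to_intrinsic (sigma : 'rV[R]_n -> R)
    (V : 'rV[R]_n -> 'rV[R]_(1 + n + 1)) (y : 'rV[R]_m) :
    'rV[R]_(1 + m + 1) :=
  let x := F y in
  let H := mean_curvature sigma x in
  mktr
    (ttop (V x))
    ((tmid (V x) - (H * ttop (V x)) *: unit_conormal sigma x)
       *m (jacobian F y)^T)
    (tbot (V x) + H ^+ 2 / 2 * ttop (V x)).

End Hypersurface.

End LocalCalculus.

Section Geometry.
Variables (R : realType) (n : nat) (M : manifold R n).

(* Sections of weight w of the standard tractor bundle over the open set U,
   given in each scale g of c and each chart.  The exponential factors in
   the change of scale come from the trivializations of E[w + 1], T*M[w + 1]
   and E[w - 1]. *)
Record tractor_field (c : conformal_class M) (U : set M) (w : R) :=
    TractorField {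
  tcomp : metric M -> midx M -> 'rV[R]_n -> 'rV[R]_(1 + n + 1);
  tcomp_smooth : forall g i A, c g ->
    smooth_on [set x | ccod (atlas M i) x /\ U (cinv (atlas M i) x)]
              (fun x => tcomp g i x 0 A);
  tcomp_change : forall g i j x, c g ->
    overlap (atlas M i) (atlas M j) x -> U (cinv (atlas M i) x) ->
    let J := jacobian (transition (atlas M i) (atlas M j)) x in
    let V := tcomp g j (transition (atlas M i) (atlas M j) x) in
    tcomp g i x = mktr (ttop V) (tmid V *m J^T) (tbot V);
  tcomp_rescaled : forall g g' (Y : M -> R), c g -> c g' ->
    smooth_function Y -> rescaled Y g g' ->
    forall i x, ccod (atlas M i) x -> U (cinv (atlas M i) x) ->
    let Yi := fun y => Y (cinv (atlas M i) y) in
    let dY := grad Yi x in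
    let dYup := dY *m ginv (gmat g i) x in
    let V := tcomp g i x in
    tcomp g' i x =
      mktr (expR ((w + 1) * Yi x) * ttop V)
           (expR ((w + 1) * Yi x) *: (tmid V + ttop V *: dY))
           (expR ((w - 1) * Yi x) *
              (tbot V - (dYup *m (tmid V)^T) 0 0
               - 2^-1 * ttop V * (dYup *m dY^T) 0 0))
}.

Variables (m : nat) (S : manifold R m) (iota : S -> M).

(* Zero locus iota(S), and non-vanishing gradient along it. *)
Definition defining_density (c : conformal_class M) (sigma : density M 1) :
    Prop :=
  (forall i x, ccod (atlas M i) x ->
     (dens sigma i x = 0 <-> range iota (cinv (atlas M i) x))) /\
  (forall g i x, c g -> ccod (atlas M i) x ->
     range iota (cinv (atlas M i) x) -> grad (in_scale g sigma i) x != 0).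

(* I^2 = 1 + sigma^n B. *)
Definition conformal_unit (c : conformal_class M) (sigma : density M 1)
    (B : density M (- n%:R)) : Prop :=
  forall g i x, c g -> ccod (atlas M i) x ->
    let I := scale_tractor (gmat g i) (in_scale g sigma i) in
    tdot (gmat g i) x (I x) (I x) =
      1 + in_scale g sigma i x ^+ n * in_scale g B i x.

Definition extends_normal_tractor (c : conformal_class M) (sigma : density M 1)
    (U : set M) (N : tractor_field c U 0) : Prop :=
  forall g i x, c g -> ccod (atlas M i) x ->
    range iota (cinv (atlas M i) x) ->
    tcomp N g i x = normal_tractor (gmat g i) (in_scale g sigma i) x.

End Geometry.

(* Main.v *)
Require Import Defs.
From HB Require Import structures.
From mathcomp Require Import all_boot all_order all_algebra.
From mathcomp Require Import all_classical all_reals all_analysis.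
From mathcomp Require Import ring.

(** In a fixed scale and chart the smooth functions form a commutative ring with
    commuting derivations, so that tractor calculus becomes differential algebra
    over that ring.  The contracted Bianchi identity makes [P_AB = hatD_A I_B]
    symmetric, which gives [I.D I_A = K X_A + 1/2 D_A (I.I)].  For a conformal
    unit density [I.I = 1 + sigma^d B], and up to [O(sigma^(d-1))] the last term
    is a multiple of [sigma^(d-2) B X_A].  The relation
      [I.D (sigma V) = sigma I.D V + (d + 2w) (I.I) V],  [V] of weight [w],
    evaluates [(I.D)^(d-2)] on this term along [sigma = 0] and shows that
    [P_(d-1)] is tangential, so that [N] may be replaced by [I].  The bracket of
    the theorem is therefore [1/2 d! (d-2)! B X] along the hypersurface, and
    [D_A (X^A f) = (d-1) f] for the intrinsic Thomas operator and [f] of weight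
    [-d].

    The tangentiality argument needs no Taylor expansion in [sigma]: a function
    [f] vanishing on [sigma = 0] agrees to any prescribed order with a multiple
    of [sigma], built from [f] and its derivatives along [grad sigma]. *)
Set Implicit Arguments.
Unset Strict Implicit.
Unset Printing Implicit Defensive.

Import Order.TTheory GRing.Theory Num.Theory.
Import numFieldNormedType.Exports.

Local Open Scope classical_set_scope.
Local Open Scope ring_scope.

(** * Levi-Civita calculus over a differential ring *)

(** That [N] may be traded for [I] rests on the conformal unit condition: along [sigma = 0] the
    function [I.I] is 1 with zero first derivative, so the gradient of [sigma] has length 1 and its
    normal-normal Hessian is [- rho]. Hence [H = - rho], and the slots of [I] are those of the
    normal tractor. The orders of vanishing follow from one count: a factor [sigma] gains one order,
    and [I.D] loses only one although it is of second order, because its Laplacian carries a factor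
    [sigma]. The constant arises as follows. The bottom slot of [1/2 D_A (I.I)] has leading part
    [- d(d-1)/2 sigma^(d-2) B], and removing [sigma^(d-2)] by [d-2] applications of [I.D]
    contributes [(-1)^(d-2) ((d-2)!)^2]. The [K X_A] term cancels against the second term of the
    bracket. The functions of the statement are total functions with arbitrary values off the chart,
    and equality with elements of a ring makes sense only on an open set. This is why the algebra is
    done over abstract derivations and carried back by evaluation at points. *)

Record diff_ring (R : realFieldType) (n : nat) := DiffRing {
  dring :> comNzRingType;
  cst : {rmorphism R -> dring};
  der : 'I_n -> {additive dring -> dring};
  derM : forall a x y, der a (x * y) = der a x * y + x * der a y;
  derC : forall a b x, der a (der b x) = der b (der a x);
  der_cst : forall a c, der a (cst c) = 0
}.
Arguments cst {R n d}.
Arguments der {R n d}.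

Section MatrixEntries.
Variables (V : nmodType) (Z : zmodType) (p q : nat).
Lemma addmxE (X Y : 'M[V]_(p, q)) i j : (X + Y) i j = X i j + Y i j.
Proof. by rewrite mxE. Qed.
Lemma oppmxE (X : 'M[Z]_(p, q)) i j : (- X) i j = - X i j.
Proof. by rewrite mxE. Qed.
Lemma trmxD (X Y : 'M[V]_(p, q)) : (X + Y)^T = X^T + Y^T.
Proof. by apply/matrixP => i j; rewrite !mxE. Qed.
Lemma trmxN (X : 'M[Z]_(p, q)) : (- X)^T = - X^T.
Proof. by apply/matrixP => i j; rewrite !mxE. Qed.
End MatrixEntries.

Section Calculus.
Variables (R : realFieldType) (n : nat) (A : diff_ring R n).
Implicit Types (a b c e k l : 'I_n).

Definition dmx p q a (X : 'M[A]_(p, q)) : 'M[A]_(p, q) := map_mx (der a) X.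

Lemma dmxD p q a (X Y : 'M[A]_(p, q)) : dmx a (X + Y) = dmx a X + dmx a Y.
Proof. exact: map_mxD. Qed.

Lemma dmxN p q a (X : 'M[A]_(p, q)) : dmx a (- X) = - dmx a X.
Proof. exact: map_mxN. Qed.

Lemma dmxM p q r a (X : 'M[A]_(p, q)) (Y : 'M[A]_(q, r)) :
  dmx a (X *m Y) = dmx a X *m Y + X *m dmx a Y.
Proof.
apply/matrixP => i j; rewrite !mxE raddf_sum -big_split.
by apply: eq_bigr => k _; rewrite !mxE derM.
Qed.

Lemma dmxC p q a b (X : 'M[A]_(p, q)) : dmx a (dmx b X) = dmx b (dmx a X).
Proof. by apply/matrixP => i j; rewrite !mxE derC. Qed.

Lemma dmx_tr p q a (X : 'M[A]_(p, q)) : dmx a X^T = (dmx a X)^T.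
Proof. by apply/matrixP => i j; rewrite !mxE. Qed.

Lemma der1 a : der a (1 : A) = 0.
Proof. by rewrite -(rmorph1 cst) der_cst. Qed.

Lemma dmx1 p a : dmx a (1%:M : 'M[A]_p) = 0.
Proof.
by apply/matrixP => i j; rewrite !mxE; case: eqP => _; rewrite ?der1 ?raddf0.
Qed.

Lemma derX a (x : A) m : der a (x ^+ m.+1) = m.+1%:R * x ^+ m * der a x.
Proof.
elim: m => [|m IH]; first by rewrite expr1 expr0 !mul1r.
rewrite exprS derM IH [m.+2%:R]mulrSr !exprS; ring.
Qed.

Variables (g h : 'M[A]_n).
Hypotheses (g_sym : g^T = g) (hg : h *m g = 1%:M).

Let gh : g *m h = 1%:M. Proof. exact: mulmx1C. Qed.

Lemma h_sym : h^T = h.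
Proof.
have : (h^T *m g) *m h = h by rewrite -{1}g_sym -trmx_mul gh trmx1 mul1mx.
by rewrite -mulmxA gh mulmx1.
Qed.

Lemma gE a b : g a b = g b a. Proof. by rewrite -{1}g_sym mxE. Qed.
Lemma hE a b : h a b = h b a. Proof. by rewrite -{1}h_sym mxE. Qed.

(** The ring has no division, so the inverse metric [h] is a datum tied to [g] by [hg], and the
    factor 1/2 enters through [cst]. *)
Definition Chr c a b : A :=
  cst 2^-1 * \sum_l h c l * (der a (g b l) + der b (g a l) - der l (g a b)).

(** Connection matrix: on columns of vector components the Levi-Civita derivative is [dmx a] plus
    multiplication by [Gam a], which turns curvature identities into matrix identities. *)
Definition Gam a : 'M[A]_n := \matrix_(c, b) Chr c a b.

Lemma Chr_sym c a b : Chr c a b = Chr c b a.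
Proof.
rewrite /Chr; congr (_ * _); apply: eq_bigr => l _.
by rewrite (gE a b) [der a _ + _]addrC.
Qed.

Lemma lower_Chr e a b : \sum_c g e c * Chr c a b =
  cst 2^-1 * (der a (g b e) + der b (g a e) - der e (g a b)).
Proof.
under eq_bigr do rewrite /Chr mulrCA mulr_sumr.
rewrite -mulr_sumr exchange_big /=; congr (_ * _).
under eq_bigr => l _ do (under eq_bigr do rewrite mulrA; rewrite -mulr_suml).
have E l : \sum_i g e i * h i l = (e == l)%:R.
  by have /matrixP/(_ e l) := gh; rewrite !mxE.
rewrite (bigD1 e) //= E eqxx mul1r big1 ?addr0 // => l le.
by rewrite E eq_sym (negbTE le) mul0r.
Qed.

Lemma cst_half (x : A) : cst 2^-1 * x + cst 2^-1 * x = x.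
Proof.
rewrite -mulrDl -rmorphD; set t := _ + _; suff -> : t = 1 by rewrite rmorph1 mul1r.
by rewrite /t; field.
Qed.

Lemma dmx_g a : dmx a g = (Gam a)^T *m g + g *m Gam a.
Proof.
apply/matrixP => b e; rewrite !mxE.
have -> : \sum_j (Gam a)^T b j * g j e = \sum_c g e c * Chr c a b.
  by apply: eq_bigr => c _; rewrite !mxE mulrC gE.
have -> : \sum_j g b j * Gam a j e = \sum_c g b c * Chr c a e.
  by apply: eq_bigr => c _; rewrite !mxE.
rewrite !lower_Chr -[LHS]cst_half (gE e b) (gE a e) (gE a b) ; ring.
Qed.

Lemma dmx_h a : dmx a h = - (Gam a *m h) - h *m (Gam a)^T.
Proof.
have : dmx a (h *m g) = 0 by rewrite hg dmx1.
rewrite dmxM dmx_g => /(congr1 (mulmx^~ h)).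
rewrite mulmxDl -(mulmxA _ g) gh mulmx1 mul0mx mulmxDr mulmxDl.
rewrite -!mulmxA gh mulmx1 (mulmxA h g) hg mul1mx => E.
by rewrite -opprD [_ *m h + _]addrC; apply/eqP; rewrite -addr_eq0 E.
Qed.

Lemma der_h a b c :
  der a (h b c) = - (\sum_k Chr b a k * h k c) - \sum_k h b k * Chr c a k.
Proof.
have /matrixP/(_ b c) := dmx_h a; rewrite !mxE => ->.
by congr (- _ - _); apply: eq_bigr => k _; rewrite !mxE.
Qed.

(** The entry [Curv a b k c] is the curvature component $R_{ab}{}^k{}_c$. *)
Definition Curv a b : 'M[A]_n :=
  dmx a (Gam b) - dmx b (Gam a) + (Gam a *m Gam b - Gam b *m Gam a).

Lemma Curv_anti a b : Curv a b = - Curv b a.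
Proof. by rewrite /Curv opprD !opprB. Qed.

(** The second derivatives of [h] commute; expanding both orders by metric compatibility leaves the
    curvature acting trivially on the inverse metric. *)
Lemma Curv_h a b : Curv a b *m h = - (h *m (Curv a b)^T).
Proof.
have := dmxC a b h; rewrite [dmx b h]dmx_h [dmx a h]dmx_h.
rewrite !(dmxD, dmxN, dmxM, dmx_tr) !dmx_h /Curv.
rewrite !(trmxD, trmxN, trmx_mul).
rewrite !(mulmxDl, mulmxDr, mulmxN, mulNmx).
rewrite !mulmxA => E; apply/matrixP => i j; move/matrixP/(_ i j): E.
rewrite !(addmxE, oppmxE) => E.
apply/eqP; rewrite -subr_eq0; move/eqP: E; rewrite -subr_eq0 => /eqP E.
apply/eqP; rewrite -[RHS]oppr0 -[in RHS]E ; ring.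
Qed.

Lemma CurvhE a b k c : (Curv a b *m h) k c = - (Curv a b *m h) c k.
Proof.
rewrite {1}Curv_h oppmxE; congr (- _).
by rewrite -{1}h_sym -trmx_mul mxE.
Qed.

Lemma sum_anti (S T : 'I_n -> 'I_n -> A) :
  (forall i j, S i j = S j i) -> (forall i j, T i j = - T j i) ->
  \sum_i \sum_j S i j * T i j = 0.
Proof.
move=> Ss Ta; set t := LHS; have E : t = - t.
  rewrite {1}/t exchange_big /= -sumrN; apply: eq_bigr => i _.
  by rewrite -sumrN; apply: eq_bigr => j _; rewrite Ss Ta mulrN.
by rewrite -[t]cst_half {2}E mulrN subrr.
Qed.

Definition ric a b : A :=
  \sum_k der k (Chr k a b) - \sum_k der b (Chr k a k)
  + \sum_k \sum_l Chr k k l * Chr l a b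
  - \sum_k \sum_l Chr k b l * Chr l a k.

Lemma ricE a b : ric a b = \sum_k Curv k b k a.
Proof.
rewrite /ric -!sumrB -big_split -sumrB; apply: eq_bigr => k _ /=.
rewrite !mxE (Chr_sym k b a) -!addrA; congr (_ + (_ + _)); first by rewrite Chr_sym.
congr (_ - _); apply: eq_bigr => l _; rewrite !mxE; first by rewrite (Chr_sym l a).
by rewrite (Chr_sym l a).
Qed.

Lemma CurvE a b k c : Curv a b k c =
  der a (Chr k b c) - der b (Chr k a c)
  + \sum_l Chr k a l * Chr l b c - \sum_l Chr k b l * Chr l a c.
Proof.
rewrite !mxE -!addrA; congr (_ + (_ + (_ - _))); by apply: eq_bigr => l _; rewrite !mxE.
Qed.

Lemma Bianchi1 a b c k : Curv a b k c + Curv b c k a + Curv c a k b = 0.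
Proof.
pose S x y z := \sum_l Chr k x l * Chr l y z.
have S_sym x y z : S x y z = S x z y by apply: eq_bigr => l _; rewrite (Chr_sym l y).
have CE x y z : Curv x y k z =
  der x (Chr k y z) - der y (Chr k x z) + S x y z - S y x z by exact: CurvE.
rewrite !CE.
rewrite (S_sym a c b) (S_sym b c a) (S_sym c b a).
by rewrite (Chr_sym k c a) (Chr_sym k c b) (Chr_sym k b a); ring.
Qed.

Lemma tr_Curv a b : \sum_k Curv a b k k = 0.
Proof.
rewrite -[LHS](_ : \tr (Curv a b) = _) // -[Curv a b]mulmx1 -hg mulmxA.
rewrite -(sum_anti gE (CurvhE a b)) /mxtrace; apply: eq_bigr => i _; rewrite mxE.
by apply: eq_bigr => j _; rewrite mulrC gE.
Qed.

(** The first Bianchi identity, contracted, leaves the trace of the curvature, which is zero because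
    the symmetric [g] meets an antisymmetric tensor. *)
Lemma ric_sym a b : ric a b = ric b a.
Proof.
rewrite !ricE; apply/eqP; rewrite -subr_eq0 -sumrB; apply/eqP.
rewrite -[LHS]addr0 -[X in _ + X](tr_Curv b a) -big_split big1 //= => k _.
by rewrite (Curv_anti k a) oppmxE opprK -[RHS](Bianchi1 b a k k); ring.
Qed.

(* The second Bianchi identity, as the Jacobi identity for [d_a + Gam a]. *)
Definition dCurv e a b : 'M[A]_n :=
  dmx e (Curv a b) + (Gam e *m Curv a b - Curv a b *m Gam e).

Lemma Bianchi2 e a b : dCurv e a b + dCurv a b e + dCurv b e a = 0.
Proof.
rewrite /dCurv /Curv !(dmxD, dmxN, dmxM) !(mulmxDl, mulmxDr, mulmxN, mulNmx).
rewrite !mulmxA (dmxC b e) (dmxC b a) (dmxC a e).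
apply/matrixP => i j; rewrite !(addmxE, oppmxE) [RHS]mxE; ring.
Qed.

(* [S b k] stands for the component [S_b^k] of a (1,1) tensor. *)
Definition div (S : 'I_n -> 'I_n -> A) b : A :=
  \sum_k der k (S b k) + \sum_k \sum_l Chr k k l * S b l
  - \sum_k \sum_c Chr c k b * S c k.

Definition Ricup b k : A := \sum_d h k d * ric d b.
Definition Sc : A := \sum_a \sum_b h a b * ric a b.

Lemma tr_Ricup : \sum_k Ricup k k = Sc.
Proof. by apply: eq_bigr => k _; apply: eq_bigr => d _; rewrite ric_sym. Qed.

(** The two antisymmetries move the contracted index from first to second place in each pair, which
    is one of the forms met when the second Bianchi identity is contracted. *)
Lemma RicupE b k : Ricup b k = \sum_e (Curv b e *m h) k e.
Proof.
transitivity (\sum_e (Curv e b *m h) e k); last first.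
  by apply: eq_bigr => e _; rewrite Curv_anti mulNmx oppmxE -CurvhE.
rewrite /Ricup; under eq_bigr do rewrite ricE mulr_sumr.
rewrite exchange_big; apply: eq_bigr => e _; rewrite mxE.
by apply: eq_bigr => d _; rewrite mulrC hE.
Qed.

Lemma der_sum (I : finType) a (F : I -> A) :
  der a (\sum_i F i) = \sum_i der a (F i).
Proof. exact: raddf_sum. Qed.

Lemma dCurv_h e a b : dCurv e a b *m h =
  dmx e (Curv a b *m h) + Gam e *m (Curv a b *m h) + (Curv a b *m h) *m (Gam e)^T.
Proof.
rewrite /dCurv dmxM dmx_h !(mulmxDl, mulmxDr, mulmxN, mulNmx) !mulmxA.
by apply/matrixP => i j; rewrite !(addmxE, oppmxE); ring.
Qed.

(** The second Bianchi identity, contracted twice. In [dCurv] the Christoffel terms of the two form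
    indices are absent, since they cancel in the cyclic sum. The remaining ones either rebuild the
    divergence or pair a symmetric symbol with the antisymmetric [Q], which is [z0]. *)
Lemma div_Ricup b : 2 * div Ricup b = der b Sc.
Proof.
pose Q a c := Curv a c *m h.
have Qa a c k l : Q a c k l = - Q a c l k by exact: CurvhE.
have QA a c k l : Q a c k l = - Q c a k l.
  by rewrite /Q Curv_anti mulNmx oppmxE.
have r1 c k : \sum_e Q c e k e = Ricup c k by rewrite RicupE.
have r2 c e : \sum_k Q k c k e = Ricup c e.
  by rewrite -r1; apply: eq_bigr => k _; rewrite Qa QA opprK.
have r3 k l : \sum_e Q e k l e = - Ricup k l.
  by rewrite -r1 -sumrN; apply: eq_bigr => e _; rewrite QA.
have r4 e l : \sum_k Q e k k l = - Ricup e l.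
  by rewrite -r1 -sumrN; apply: eq_bigr => k _; rewrite Qa.
have z0 (S : 'I_n -> 'I_n -> A) a c : (forall i j, S i j = S j i) ->
    \sum_i \sum_j S i j * Q a c i j = 0.
  by move=> Ss; apply: sum_anti => // i j; rewrite -Qa.
have E : \sum_k \sum_e ((dCurv e k b *m h) k e + (dCurv k b e *m h) k e
    + (dCurv b e k *m h) k e) = 0.
  rewrite big1 // => k _; rewrite big1 // => e _.
  have := congr1 (fun X : 'M[A]_n => (X *m h) k e) (Bianchi2 e k b).
  by rewrite !mulmxDl !addmxE mul0mx [RHS]mxE.
(* Of the three cyclic terms, the first two each give the divergence without its last sum; the third
   gives minus the derivative of [Sc] together with both copies of that last sum. *)
have T1 : \sum_k \sum_e (dCurv e k b *m h) k e =
    \sum_e der e (Ricup b e) + \sum_e \sum_l Chr e e l * Ricup b l.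
  have -> : \sum_k \sum_e (dCurv e k b *m h) k e = \sum_e der e (\sum_k Q k b k e)
    + \sum_k \sum_l \sum_e Chr k l e * Q k b l e
    + \sum_e \sum_l Chr e e l * \sum_k Q k b k l.
    under [X in _ = X + _ + _]eq_bigr do rewrite der_sum.
    under [X in _ = _ + X]eq_bigr do under eq_bigr do rewrite mulr_sumr.
    rewrite [X in _ = X + _ + _]exchange_big /=.
    under [X in _ = _ + X]eq_bigr do rewrite exchange_big /=.
    rewrite [X in _ = _ + X]exchange_big /= -!big_split.
    apply: eq_bigr => k _ /=; rewrite [X in _ = _ + X + _]exchange_big -!big_split.
    apply: eq_bigr => e _ /=; rewrite dCurv_h !addmxE !mxE.
    by congr (_ + _ + _); apply: eq_bigr => l _; rewrite !mxE ?(Chr_sym k e) // mulrC.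
  rewrite [X in _ + X + _]big1 ?addr0; last by move=> k _; apply: z0 => i j; exact: Chr_sym.
  congr (_ + _); first by apply: eq_bigr => e _; rewrite r2.
  by apply: eq_bigr => e _; apply: eq_bigr => l _; rewrite r2.
have T2 : \sum_k \sum_e (dCurv k b e *m h) k e =
    \sum_e der e (Ricup b e) + \sum_e \sum_l Chr e e l * Ricup b l.
  have -> : \sum_k \sum_e (dCurv k b e *m h) k e = \sum_k der k (\sum_e Q b e k e)
    + \sum_e \sum_k \sum_l Chr e k l * Q b e k l
    + \sum_k \sum_l Chr k k l * \sum_e Q b e l e.
    under [X in _ = X + _ + _]eq_bigr do rewrite der_sum.
    under [X in _ = _ + X]eq_bigr do under eq_bigr do rewrite mulr_sumr.
    under [X in _ = _ + X]eq_bigr do rewrite exchange_big /=.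
    rewrite [X in _ = _ + X + _]exchange_big /= -!big_split.
    apply: eq_bigr => k _ /=; rewrite -!big_split.
    apply: eq_bigr => e _ /=; rewrite dCurv_h !addmxE !mxE addrAC.
    by congr (_ + _ + _); apply: eq_bigr => l _; rewrite !mxE // mulrC.
  rewrite [X in _ + X + _]big1 ?addr0; last by move=> k _; apply: z0 => i j; exact: Chr_sym.
  congr (_ + _); first by apply: eq_bigr => e _; rewrite r1.
  by apply: eq_bigr => e _; apply: eq_bigr => l _; rewrite r1.
have T3 : \sum_k \sum_e (dCurv b e k *m h) k e =
    - der b Sc - 2 * \sum_k \sum_c Chr c k b * Ricup c k.
  have -> : \sum_k \sum_e (dCurv b e k *m h) k e =
      der b (\sum_k \sum_e Q e k k e)
    + \sum_k \sum_l Chr k b l * \sum_e Q e k l e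
    + \sum_e \sum_l Chr e b l * \sum_k Q e k k l.
    rewrite der_sum.
    under [X in _ = X + _ + _]eq_bigr do rewrite der_sum.
    under [X in _ = _ + X]eq_bigr do under eq_bigr do rewrite mulr_sumr.
    under [X in _ = _ + X + _]eq_bigr do under eq_bigr do rewrite mulr_sumr.
    under [X in _ = _ + X]eq_bigr do rewrite exchange_big /=.
    rewrite [X in _ = _ + X]exchange_big /= -!big_split.
    apply: eq_bigr => k _ /=; rewrite [X in _ = _ + X + _]exchange_big -!big_split.
    apply: eq_bigr => e _ /=; rewrite dCurv_h !addmxE !mxE.
    by congr (_ + _ + _); apply: eq_bigr => l _; rewrite !mxE // mulrC.
  rewrite (eq_bigr (fun k => - Ricup k k)); last by move=> k _; rewrite r3.
  rewrite sumrN tr_Ricup raddfN.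
  have C : \sum_k \sum_l Chr k b l * Ricup k l = \sum_k \sum_c Chr c k b * Ricup c k.
    by rewrite exchange_big; apply: eq_bigr => l _; apply: eq_bigr => k _; rewrite Chr_sym.
  under [X in _ + X + _ = _]eq_bigr do under eq_bigr do rewrite r3 mulrN.
  under [X in _ + _ + X = _]eq_bigr do under eq_bigr do rewrite r4 mulrN.
  under [X in _ + _ + X = _]eq_bigr do rewrite sumrN.
  under [X in _ + X + _ = _]eq_bigr do rewrite sumrN.
  by rewrite !sumrN C; ring.
move: E; under eq_bigr do rewrite 2!big_split /=.
rewrite 2!big_split /= T1 T2 T3 /div => E.
by apply/eqP; rewrite -subr_eq0 -[X in _ == X]E; apply/eqP; ring.
Qed.

(** * The Hessian of a function and the Ricci identity *)

Section Hessian.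
Variable s : A.

Definition Hess a b : A := der a (der b s) - \sum_c Chr c a b * der c s.

Lemma Hess_sym a b : Hess a b = Hess b a.
Proof.
by rewrite /Hess derC; congr (_ - _); apply: eq_bigr => c _; rewrite Chr_sym.
Qed.

Definition up (T : 'I_n -> 'I_n -> A) b k : A := \sum_c h k c * T c b.

Definition gradup k : A := \sum_c h k c * der c s.

Let v : 'cV[A]_n := \col_k gradup k.
Let Dv b : 'cV[A]_n := dmx b v + Gam b *m v.

Let DvE b k : Dv b k 0 = up Hess b k.
Proof.
have E : v = h *m \col_c der c s.
  by apply/matrixP => i j; rewrite !mxE; apply: eq_bigr => c _; rewrite !mxE.
have -> : Dv b = h *m (dmx b (\col_c der c s) - (Gam b)^T *m \col_c der c s).
  rewrite /Dv E dmxM dmx_h mulmxBl mulNmx mulmxBr !mulmxA.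
  by apply/matrixP => i j; rewrite !(addmxE, oppmxE); ring.
rewrite mxE; apply: eq_bigr => c _; rewrite !mxE Hess_sym; congr (_ * (_ - _)).
by apply: eq_bigr => l _; rewrite !mxE.
Qed.

(** Commuting the two covariant derivatives of the gradient [v] produces [Curv k b] applied to [v],
    and the trace of this is the Ricci term. *)
Lemma div_Hess b :
  div (up Hess) b = der b (\sum_k up Hess k k) + \sum_l ric l b * gradup l.
Proof.
have E k : (dmx k (Dv b) + Gam k *m Dv b - (dmx b (Dv k) + Gam b *m Dv k)) k 0 =
    \sum_l Curv k b k l * gradup l.
  transitivity ((Curv k b *m v) k 0); last first.
    by rewrite mxE; apply: eq_bigr => l _; rewrite [v _ _]mxE.
  rewrite /Dv /Curv !(dmxD, dmxM) !(mulmxDl, mulmxDr, mulmxN, mulNmx) !mulmxA.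
  by rewrite (dmxC k b) !(addmxE, oppmxE); ring.
have -> : \sum_l ric l b * gradup l = \sum_k \sum_l Curv k b k l * gradup l.
  by rewrite exchange_big; apply: eq_bigr => l _; rewrite ricE mulr_suml.
rewrite -(eq_bigr _ (fun k _ => E k)) der_sum /div.
have -> : \sum_k \sum_c Chr c k b * up Hess c k =
    \sum_k \sum_l Chr k b l * up Hess k l.
  by rewrite exchange_big; apply: eq_bigr => c _; apply: eq_bigr => k _; rewrite Chr_sym.
rewrite -!big_split -sumrB /=; apply: eq_bigr => k _.
have GE a c : (Gam a *m Dv c) k 0 = \sum_l Chr k a l * up Hess c l.
  by rewrite mxE; apply: eq_bigr => l _; rewrite mxE DvE.
by rewrite !(addmxE, oppmxE) !GE ![dmx _ (Dv _) _ _]mxE !DvE; ring.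
Qed.

End Hessian.

(** By metric compatibility, raising an index commutes with covariant differentiation; both sides
    are $\nabla^a T_{ab}$. *)
Lemma div_up (T : 'I_n -> 'I_n -> A) b :
  \sum_a \sum_c h a c *
    (der a (T c b) - \sum_e Chr e a c * T e b - \sum_e Chr e a b * T c e) =
  div (up T) b.
Proof.
rewrite /div /up.
under [X in _ = X + _ - _]eq_bigr do rewrite der_sum.
have -> : \sum_k \sum_l Chr k k l * (\sum_c h l c * T c b) =
   \sum_k \sum_c (\sum_l Chr k k l * h l c) * T c b.
  apply: eq_bigr => k _; under eq_bigr do rewrite mulr_sumr.
  rewrite exchange_big; apply: eq_bigr => c _; rewrite mulr_suml.
  by apply: eq_bigr => l _; rewrite mulrA.
have -> : \sum_k \sum_c Chr c k b * (\sum_c0 h k c0 * T c0 c) =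
   \sum_k \sum_c h k c * \sum_e Chr e k b * T c e.
  apply: eq_bigr => k _; under eq_bigr do rewrite mulr_sumr.
  rewrite exchange_big; apply: eq_bigr => c _; rewrite mulr_sumr.
  by apply: eq_bigr => e _; ring.
rewrite -big_split -sumrB; apply: eq_bigr => k _ /=.
have -> : \sum_c h k c * (der k (T c b) - (\sum_e Chr e k c * T e b) -
      (\sum_e Chr e k b * T c e)) =
    \sum_c h k c * der k (T c b) - \sum_e (\sum_c h k c * Chr e k c) * T e b
    - \sum_c h k c * (\sum_e Chr e k b * T c e).
  have -> : \sum_e (\sum_c h k c * Chr e k c) * T e b =
      \sum_c h k c * \sum_e Chr e k c * T e b.
    under eq_bigr do rewrite mulr_suml.
    rewrite exchange_big; apply: eq_bigr => c _; rewrite mulr_sumr.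
    by apply: eq_bigr => e _; rewrite mulrA.
  by rewrite -!sumrB; apply: eq_bigr => c _; ring.
rewrite -!sumrB -big_split -sumrB; apply: eq_bigr => c _ /=.
by rewrite derM der_h; ring.
Qed.

End Calculus.

(** * Order of vanishing and the operator I.D *)

Section Vanishing.
Variables (R : realFieldType) (n : nat) (A : diff_ring R n).
Implicit Types (a b c : 'I_n) (f x y : A) (k j : nat).

Variable Z : A -> Prop.
Hypotheses (Z0 : Z 0) (ZD : forall x y, Z x -> Z y -> Z (x + y))
  (ZM : forall x y, Z y -> Z (x * y)).

(** [Z] is to be read as the ideal of functions that vanish on the hypersurface; order [k] asks that
    all derivatives of order less than [k] lie in it. *)
Fixpoint vanishing k f : Prop :=
  if k is k'.+1 then Z f /\ forall a, vanishing k' (der a f) else True.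

Lemma vanishing0 k : vanishing k 0.
Proof. by elim: k => //= k IH; split=> // a; rewrite raddf0. Qed.

Lemma vanishingD k x y : vanishing k x -> vanishing k y -> vanishing k (x + y).
Proof.
elim: k x y => //= k IH x y [zx dx] [zy dy]; split; first exact: ZD.
by move=> a; rewrite raddfD; apply: IH.
Qed.

Lemma vanishingS k x : vanishing k.+1 x -> vanishing k x.
Proof.
elim: k x => // k IH x [zx dx]; split=> // a; exact/IH/dx.
Qed.

Lemma vanishingM k x y : vanishing k y -> vanishing k (x * y).
Proof.
elim: k x y => // k IH x y vy; have [zy dy] := vy; split; first exact: ZM.
by move=> a; rewrite derM; apply: vanishingD; apply: IH; [exact: vanishingS|exact: dy].
Qed.

Lemma vanishingMl k x y : vanishing k y -> vanishing k (y * x).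
Proof. by rewrite mulrC; exact: vanishingM. Qed.

Lemma vanishingN k x : vanishing k x -> vanishing k (- x).
Proof. by rewrite -mulN1r; exact: vanishingM. Qed.

Lemma vanishingB k x y : vanishing k x -> vanishing k y -> vanishing k (x - y).
Proof. by move=> vx vy; apply/vanishingD/vanishingN. Qed.

Lemma vanishing_sum (I : finType) k (F : I -> A) :
  (forall i, vanishing k (F i)) -> vanishing k (\sum_i F i).
Proof.
by move=> H; apply: big_ind => // [|x y]; [exact: vanishing0|exact: vanishingD].
Qed.

Lemma vanishing_le k j x : (j <= k)%N -> vanishing k x -> vanishing j x.
Proof.
move/subnK <-; elim: (k - j)%N => // i IH; rewrite addSn => /vanishingS; exact: IH.
Qed.

Lemma vanishing_der k a x : vanishing k.+1 x -> vanishing k (der a x).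
Proof. by case=> _; apply. Qed.

Lemma vanishing1P x : vanishing 1 x <-> Z x.
Proof. by split=> [[]|]. Qed.

Variable sigma : A.
Hypothesis Zsigma : Z sigma.

Lemma vanishing_sigmaM k x : vanishing k x -> vanishing k.+1 (sigma * x).
Proof.
elim: k x => [|k IH] x vx; first by split=> //; rewrite mulrC; apply: ZM.
split=> [|a]; first by rewrite mulrC; apply: ZM.
by rewrite derM; apply: vanishingD; [exact: vanishingM|exact/IH/vanishing_der].
Qed.

Lemma vanishing_sigmaX k j x :
  vanishing j x -> vanishing (k + j)%N (sigma ^+ k * x).
Proof.
move=> vx; elim: k => [|k IH]; first by rewrite expr0 mul1r.
by rewrite exprS -mulrA addSn; apply: vanishing_sigmaM.
Qed.

(** * Division by [sigma] up to a prescribed order *)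

Section Division.
Variable nu : 'I_n -> A.
Definition dnu f := \sum_c nu c * der c f.
Variable sinv : A.
Hypothesis sinvK : sinv * dnu sigma = 1.
(* [dnu sigma] times the part of [der a] tangential to [sigma = 0] *)
Definition dtan a f := dnu sigma * der a f - der a sigma * dnu f.
Hypothesis Ztan : forall a f, Z f -> Z (dtan a f).

Lemma vanishing_dnu k f : vanishing k.+1 f -> vanishing k (dnu f).
Proof. by move=> vf; apply: vanishing_sum => c; apply/vanishingM/vanishing_der. Qed.

(** No order is lost: the commutator of [der b] with [dtan a] is again of first order, and in the
    induction it acts on a function one order better than required. *)
Lemma vanishing_dtan k a f : vanishing k f -> vanishing k (dtan a f).
Proof.
elim: k f => // k IH f vf; split=> [|b]; first by apply: Ztan; case: vf.
have -> : der b (dtan a f) = dtan a (der b f) + (der b (dnu sigma) * der a f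
    - der b (der a sigma) * dnu f - der a sigma * \sum_c der b (nu c) * der c f).
  rewrite /dtan raddfB 2!derM (derC b a f).
  have -> : der b (dnu f) = dnu (der b f) + \sum_c der b (nu c) * der c f.
    rewrite /dnu raddf_sum -big_split; apply: eq_bigr => c _ /=.
    by rewrite derM derC addrC.
  by ring.
apply: vanishingD; first by apply: IH; exact: vanishing_der.
do 2?apply: vanishingB; apply: vanishingM.
- exact: vanishing_der.
- exact: vanishing_dnu.
by apply: vanishing_sum => c; apply/vanishingM/vanishing_der.
Qed.

(** Euler's relation: the leading part of [f] is homogeneous of degree [k] in [sigma], and
    [sinv * dnu] acts as the derivative with respect to [sigma]. *)
Lemma vanishing_euler k f :
  vanishing k f -> vanishing k.+1 (k%:R * f - sigma * (sinv * dnu f)).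
Proof.
elim: k f => [|k IH] f vf.
  by rewrite mul0r sub0r; apply/vanishingN/vanishing_sigmaM.
have [zf df] := vf; pose u := sinv * dnu f.
have vu : vanishing k u by apply/vanishingM/vanishing_dnu.
have tan a x : der a x - der a sigma * (sinv * dnu x) = sinv * dtan a x.
  by rewrite /dtan -[der a x in LHS]mul1r -sinvK; ring.
split=> [|a].
  by apply: ZD; [exact: ZM|rewrite -mulNr mulrC; apply: ZM; rewrite -mulN1r; exact: ZM].
(* Every derivative splits into a tangential part, which costs no order, and [der a sigma] times the
   normal derivative [u], to which the induction hypothesis applies. *)
have -> : der a (k.+1%:R * f - sigma * u) = k.+1%:R * (sinv * dtan a f)
    + der a sigma * (k%:R * u - sigma * (sinv * dnu u))
    - sigma * (sinv * dtan a u).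
  rewrite -!tan raddfB !derM -/u.
  have -> : der a (k.+1%:R : A) = 0 by rewrite -(rmorph_nat cst) der_cst.
  by rewrite -[k.+1%:R]natr1; ring.
apply: vanishingB; last by apply/vanishing_sigmaM/vanishingM/vanishing_dtan.
apply: vanishingD; first by do 2!apply: vanishingM; exact: vanishing_dtan.
exact/vanishingM/IH.
Qed.

(** Successive correction: if the remainder [r] vanishes to order [k.+1], adding its normal
    derivative divided by [k.+1] to the quotient gains one order, by Euler's relation. *)
Lemma vanishing_div k f : Z f -> exists v, vanishing k (f - sigma * v).
Proof.
move=> zf; elim: k => [|k [v vk]]; first by exists 0.
(* At order 0 the correction would divide by zero; there the quotient 0 works because [f] itself
   lies in [Z]. *)
case: k vk => [|k] vk; first by exists 0; apply/vanishing1P; rewrite mulr0 subr0.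
pose r := f - sigma * v.
exists (v + cst k.+1%:R^-1 * (sinv * dnu r)).
have -> : f - sigma * (v + cst k.+1%:R^-1 * (sinv * dnu r)) =
    cst k.+1%:R^-1 * (k.+1%:R * r - sigma * (sinv * dnu r)).
  have E : cst k.+1%:R^-1 * k.+1%:R = 1 :> A.
    by rewrite -(rmorph_nat cst) -rmorphM mulVf ?rmorph1 ?pnatr_eq0.
  rewrite mulrBr [X in _ = X - _]mulrA E mul1r /r; ring.
exact/vanishingM/vanishing_euler.
Qed.

End Division.

(** * The operator [I.D] on sections of a bundle with connection *)

Section Bundle.
Variables (p : nat) (nab : 'I_n -> 'rV[A]_p -> 'rV[A]_p).
Implicit Types (U V : 'rV[A]_p) (w t : R).
Hypotheses (nabD : forall a U V, nab a (U + V) = nab a U + nab a V)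
  (nabZ : forall a f V, nab a (f *: V) = der a f *: V + f *: nab a V).

Definition vanishingV k V := forall i, vanishing k (V 0 i).
Hypothesis nabO : forall k a V, vanishingV k.+1 V -> vanishingV k (nab a V).

Lemma vanishingVD k U V : vanishingV k U -> vanishingV k V -> vanishingV k (U + V).
Proof. by move=> vU vV i; rewrite mxE; apply: vanishingD. Qed.
Lemma vanishingVZ k f V : vanishingV k V -> vanishingV k (f *: V).
Proof. by move=> vV i; rewrite mxE; apply: vanishingM. Qed.
Lemma vanishingVZl k f V : vanishing k f -> vanishingV k (f *: V).
Proof. by move=> vV i; rewrite mxE; apply: vanishingMl. Qed.
Lemma vanishingVN k V : vanishingV k V -> vanishingV k (- V).
Proof. by rewrite -scaleN1r; exact: vanishingVZ. Qed.
Lemma vanishingVB k U V : vanishingV k U -> vanishingV k V -> vanishingV k (U - V).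
Proof. by move=> vU vV; apply/vanishingVD/vanishingVN. Qed.
Lemma vanishingV_sum (I : finType) k (F : I -> 'rV[A]_p) :
  (forall i, vanishingV k (F i)) -> vanishingV k (\sum_i F i).
Proof. by move=> H i; rewrite summxE; apply: vanishing_sum => j; apply: H. Qed.
Lemma vanishingV_le k j V : (j <= k)%N -> vanishingV k V -> vanishingV j V.
Proof. by move=> jk vV i; apply: vanishing_le jk _. Qed.
Lemma vanishingV_sigmaZ k V : vanishingV k V -> vanishingV k.+1 (sigma *: V).
Proof. by move=> vV i; rewrite mxE; apply: vanishing_sigmaM. Qed.
(* [h] is the inverse metric, [C c a b] the Christoffel symbol, and
   [sigma, der sigma, rho] are the slots of the scale tractor. *)
Variables (h : 'I_n -> 'I_n -> A) (C : 'I_n -> 'I_n -> 'I_n -> A) (J rho : A).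
Hypothesis h_sym : forall a b, h a b = h b a.

Definition lapS f := \sum_a \sum_b h a b *
  (der a (der b f) - \sum_c C c a b * der c f).
Definition lapV V := \sum_a \sum_b h a b *:
  (nab a (nab b V) - \sum_c C c a b *: nab c V).
Definition gradV f V := \sum_a \sum_b (h a b * der a f) *: nab b V.

Lemma lapVZ f V : lapV (f *: V) = lapS f *: V + 2 *: gradV f V + f *: lapV V.
Proof.
have -> : 2 *: gradV f V = gradV f V +
    \sum_a \sum_b (h a b * der b f) *: nab a V.
  rewrite scaler_nat mulr2n; congr (_ + _); rewrite /gradV exchange_big.
  by apply: eq_bigr => a _; apply: eq_bigr => b _; rewrite h_sym.
rewrite /lapS /lapV /gradV scaler_suml scaler_sumr -!big_split.
apply: eq_bigr => a _ /=; rewrite scaler_suml scaler_sumr -!big_split.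
apply: eq_bigr => b _ /=; rewrite !nabZ nabD !nabZ.
have -> : \sum_c C c a b *: nab c (f *: V) =
    (\sum_c C c a b * der c f) *: V + f *: \sum_c C c a b *: nab c V.
  rewrite scaler_suml scaler_sumr -big_split; apply: eq_bigr => c _ /=.
  by rewrite nabZ scalerDr !scalerA (mulrC f).
apply/rowP => i; rewrite !mxE; ring.
Qed.

Lemma lapVD U V : lapV (U + V) = lapV U + lapV V.
Proof.
rewrite /lapV -big_split; apply: eq_bigr => a _ /=; rewrite -big_split.
apply: eq_bigr => b _ /=; rewrite !nabD -scalerDr; congr (_ *: _).
under eq_bigr do rewrite nabD scalerDr.
by rewrite big_split opprD addrACA.
Qed.

Lemma vanishing_lapV k V : vanishingV k.+2 V -> vanishingV k (lapV V).
Proof.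
move=> vV; apply: vanishingV_sum => a; apply: vanishingV_sum => b.
apply/vanishingVZ/vanishingVB; first by do 2!apply: nabO.
apply: vanishingV_sum => c; apply/vanishingVZ/nabO/vanishingV_le/vV; exact: leqnSn.
Qed.

Definition wt (w : R) : R := n%:R + 2 * w - 2.

(* [I.D] on sections of weight [w]. *)
Definition idd w V := (cst (wt w * w) * rho) *: V + cst (wt w) *: gradV sigma V
  - sigma *: (lapV V + (J * cst w) *: V).

Lemma iddD w U V : idd w (U + V) = idd w U + idd w V.
Proof.
have gD : gradV sigma (U + V) = gradV sigma U + gradV sigma V.
  rewrite /gradV -big_split; apply: eq_bigr => a _; rewrite -big_split.
  by apply: eq_bigr => b _; rewrite nabD scalerDr.
rewrite /idd gD lapVD; apply/rowP => i; rewrite !mxE; ring.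
Qed.

(** The Laplacian loses two orders, but its factor [sigma] gives one back. *)
Lemma vanishing_idd k w V : vanishingV k.+1 V -> vanishingV k (idd w V).
Proof.
move=> vV; have vk := vanishingV_le (leqnSn k) vV.
apply: vanishingVB; first apply: vanishingVD; first exact: vanishingVZ.
  apply/vanishingVZ/vanishingV_sum => a; apply: vanishingV_sum => b.
  exact/vanishingVZ/nabO.
rewrite scalerDr; apply: vanishingVD; last by do 2!apply: vanishingVZ.
by case: k vV {vk} => // k vV; apply/vanishingV_sigmaZ/vanishing_lapV.
Qed.

Definition Isq : A :=
  2 * sigma * rho + \sum_a \sum_b h a b * der a sigma * der b sigma.
Hypothesis rhoE : n%:R * rho = - (lapS sigma + J * sigma).

Lemma iddN w V : idd w (- V) = - idd w V.
Proof.
apply/eqP; rewrite -addr_eq0 -iddD addNr; apply/eqP.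
have n0 a : nab a 0 = 0 by rewrite -[0 in LHS](scale0r 0) nabZ raddf0 !scale0r addr0.
rewrite /idd /lapV /gradV big1 => [|a _]; last by rewrite big1 // => b _; rewrite n0 scaler0.
rewrite big1 => [|a _]; last first.
  by rewrite big1 // => b _; rewrite !n0 big1 ?subr0 ?scaler0 // => c _; rewrite n0 scaler0.
by rewrite !(scaler0, addr0, subr0).
Qed.

Lemma iddZcst w (t : R) V : idd w (cst t *: V) = cst t *: idd w V.
Proof.
have nt a U : nab a (cst t *: U) = cst t *: nab a U.
  by rewrite nabZ der_cst scale0r add0r.
have gZ : gradV sigma (cst t *: V) = cst t *: gradV sigma V.
  rewrite /gradV scaler_sumr; apply: eq_bigr => a _; rewrite scaler_sumr.
  by apply: eq_bigr => b _; rewrite nt !scalerA mulrC.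
have lS : lapS (cst t) = 0.
  rewrite /lapS big1 // => a _; rewrite big1 // => b _.
  rewrite der_cst raddf0 sub0r big1 ?oppr0 ?mulr0 // => c _.
  by rewrite der_cst mulr0.
have g0 : gradV (cst t) V = 0.
  by rewrite /gradV big1 // => a _; rewrite big1 // => b _; rewrite der_cst mulr0 scale0r.
rewrite /idd gZ lapVZ lS g0; apply/rowP => i; rewrite !mxE; ring.
Qed.

(** [rhoE] replaces the Laplacian of [sigma] by terms in [rho] and [J]. The mixed gradient terms and
    the terms in [J] then cancel, and those in [rho] join the squared gradient of [sigma] to form
    [Isq]. *)
Lemma idd_sigmaZ w V :
  idd (w + 1) (sigma *: V) = sigma *: idd w V + (cst (n%:R + 2 * w) * Isq) *: V.
Proof.
have gZ : gradV sigma (sigma *: V) =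
    (\sum_a \sum_b h a b * der a sigma * der b sigma) *: V + sigma *: gradV sigma V.
  rewrite /gradV scaler_suml scaler_sumr -big_split; apply: eq_bigr => a _ /=.
  rewrite scaler_suml scaler_sumr -big_split; apply: eq_bigr => b _ /=.
  by rewrite nabZ scalerDr !scalerA; congr (_ + _ *: _); ring.
have L : lapS sigma = - (n%:R * rho) - J * sigma by rewrite rhoE; ring.
rewrite /idd gZ lapVZ L /Isq /wt -(rmorph_nat cst n).
apply/rowP => i; rewrite !mxE.
rewrite !(rmorphB, rmorphD, rmorphM, rmorph1, rmorph_nat); ring.
Qed.

Fixpoint ipow w m V :=
  if m is m'.+1 then idd (w - m'%:R) (ipow w m' V) else V.

Lemma ipowD w m U V : ipow w m (U + V) = ipow w m U + ipow w m V.
Proof. by elim: m => //= m ->; rewrite iddD. Qed.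

Lemma ipowS w m V : ipow w m.+1 V = ipow (w - 1) m (idd w V).
Proof.
elim: m => [|m IH] /=; first by rewrite subr0.
by rewrite -IH /= -addrA -opprD addrC [m.+1%:R]mulrSr addrC [1 + _]addrC.
Qed.

Lemma vanishing_ipow k w m V : vanishingV (k + m) V -> vanishingV k (ipow w m V).
Proof.
elim: m k => [|m IH] k; first by rewrite addn0.
by rewrite addnS -addSn => /IH; exact: vanishing_idd.
Qed.

Variable Iinv : A.
Hypothesis IinvK : Iinv * Isq = 1.

Fixpoint tpow w m V :=
  if m is m'.+1 then (- Iinv) *: idd (w - m'%:R) (tpow w m' V) else V.

Lemma tpowD w m U V : tpow w m (U + V) = tpow w m U + tpow w m V.
Proof. by elim: m => //= m ->; rewrite iddD scalerDr. Qed.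

Lemma vanishing_tpow k w m V : vanishingV (k + m) V -> vanishingV k (tpow w m V).
Proof.
elim: m k => [|m IH] k; first by rewrite addn0.
by rewrite addnS -addSn => /IH vV; apply/vanishingVZ/vanishing_idd.
Qed.

(** The coefficient is the sum of [n + 2 (w - i)] over [i] from 0 to [m], one term for each operator
    that [sigma] passes; [Iinv] cancels [Isq] exactly, so no error term appears. It is zero for
    [w = -1] and [m = n - 2]. *)
Lemma tpow_sigmaZ w m V : tpow (w + 1) m.+1 (sigma *: V) = sigma *: tpow w m.+1 V
  - cst (m.+1%:R * (n%:R + 2 * w - m%:R)) *: tpow w m V.
Proof.
have Kw t : (- Iinv) * (cst t * Isq) = - cst t.
  by rewrite mulrCA mulNr IinvK mulrN1.
elim: m => [|m IH].
  rewrite /= !subr0 idd_sigmaZ scalerDr !scalerA.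
  rewrite mul1r; move: (idd w V) => T; apply/rowP => i; rewrite !mxE Kw.
  by move: (cst _) => t; ring.
have tS w' m' V' : tpow w' m'.+1 V' = (- Iinv) *: idd (w' - m'%:R) (tpow w' m' V').
  by [].
rewrite [LHS]tS IH iddD iddN iddZcst.
have -> : w + 1 - m.+1%:R = (w - m.+1%:R) + 1 by ring.
rewrite idd_sigmaZ.
have -> : w - m.+1%:R + 1 = w - m%:R by rewrite [m.+1%:R]mulrSr; ring.
rewrite [tpow w m.+2 V]tS.
have E := tS w m V.
set T := tpow w m.+1 V in E *.
rewrite scalerDr scalerN scalerDr !scalerA [(- Iinv) * cst _]mulrC -[in X in _ - X]scalerA -E.
apply/rowP => i; rewrite !mxE.
have -> : cst (m.+2%:R * (n%:R + 2 * w - m.+1%:R)) =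
    cst (n%:R + 2 * (w - m.+1%:R)) + cst (m.+1%:R * (n%:R + 2 * w - m%:R)) :> A.
  by rewrite -rmorphD; congr (cst _); rewrite [m.+2%:R]mulrSr [m.+1%:R]mulrSr; ring.
rewrite Kw; move: (cst (_ * _)) (cst _) => t u; ring.
Qed.

Lemma idd_sigmaXZ w k V : idd (w + k.+1%:R) (sigma ^+ k.+1 *: V) =
  sigma ^+ k.+1 *: idd w V
  + (cst (k.+1%:R * (n%:R + 2 * w + k%:R)) * Isq * sigma ^+ k) *: V.
Proof.
elim: k => [|k IH].
  by rewrite !expr1 expr0 mulr1 idd_sigmaZ mul1r addr0.
have -> : w + k.+2%:R = (w + k.+1%:R) + 1 by rewrite [k.+2%:R]mulrSr addrA.
rewrite exprS -scalerA idd_sigmaZ IH.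
have -> : cst (k.+2%:R * (n%:R + 2 * w + k.+1%:R)) =
    cst (k.+1%:R * (n%:R + 2 * w + k%:R)) + cst (n%:R + 2 * (w + k.+1%:R)) :> A.
  by rewrite -rmorphD; congr (cst _); rewrite [k.+2%:R]mulrSr [k.+1%:R]mulrSr; ring.
set t := cst (k.+1%:R * _); set u := cst (n%:R + _).
move: t u (idd w V) => t u T; apply/rowP => i; rewrite !mxE !exprS; ring.
Qed.

Lemma ipowZcst w m t V : ipow w m (cst t *: V) = cst t *: ipow w m V.
Proof. by elim: m => //= m ->; rewrite iddZcst. Qed.

(** Each application removes one factor [sigma] at the price of a weight factor. Replacing [Isq] by
    1 leaves an error with a factor [sigma ^+ m * (Isq - 1)], which is of order [m.+1] and so
    survives the [m] remaining applications. *)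
Lemma ipow_sigmaX w m V : Z (Isq - 1) ->
  vanishingV 1 (ipow (w + m%:R) m (sigma ^+ m *: V)
    - cst (\prod_(i < m) (i.+1%:R * (n%:R + 2 * w + i%:R))) *: V).
Proof.
move=> ZI; elim: m => [|m IH].
  by rewrite big_ord0 /= expr0 rmorph1 subrr => i; rewrite mxE; exact: vanishing0.
rewrite ipowS idd_sigmaXZ big_ord_recr /= [cst (\prod_(_ < _) _ * _)]rmorphM.
set t := cst (_ * _); set q := cst _.
have -> : (t * Isq * sigma ^+ m) *: V =
    t *: (sigma ^+ m *: V) + (sigma ^+ m * (t * (Isq - 1))) *: V.
  by apply/rowP => i; rewrite !mxE; ring.
have -> : w + m.+1%:R - 1 = w + m%:R by rewrite [m.+1%:R]mulrSr; ring.
rewrite !ipowD ipowZcst.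
have v1 : vanishingV 1 (ipow (w + m%:R) m (sigma ^+ m.+1 *: idd w V)).
  apply: vanishing_ipow => i; rewrite mxE -[(1 + m)%N]addn0; exact: vanishing_sigmaX.
have v2 : vanishingV 1
    (ipow (w + m%:R) m ((sigma ^+ m * (t * (Isq - 1))) *: V)).
  apply: vanishing_ipow; apply: vanishingVZl; rewrite addnC.
  by apply: vanishing_sigmaX; apply/vanishingM/vanishing1P.
have -> : (q * t) *: V = t *: (q *: V) by rewrite scalerA mulrC.
set a := ipow _ _ _ in v1 *; set c := ipow _ _ (_ *: V) in v2 *.
set b := ipow _ _ _ in IH *.
have E (a' b' c' W : 'rV[A]_p) (t' : A) :
    a' + (t' *: b' + c') - t' *: W = a' + c' + t' *: (b' - W).
  by apply/rowP => i; rewrite !mxE; ring.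
rewrite E.
by do 2?apply: vanishingVD => //; apply: vanishingVZ.
Qed.

(** Each operator costs one order, so an error of order [k + m] in [Iinv] is still of order [k]
    after all of them. *)
Lemma tpow_ipow w k m V : vanishing (k + m) (Iinv - 1) ->
  vanishingV k (tpow w m V - (-1) ^+ m *: ipow w m V).
Proof.
elim: m k => [|m IH] k vI.
  by rewrite expr0 scale1r subrr => i; rewrite mxE; exact: vanishing0.
have vm := IH k.+1; rewrite addSn -addnS in vm; have {}vm := vm vI.
have E : cst ((-1) ^+ m) = (-1) ^+ m :> A by rewrite rmorphXn rmorphN1.
rewrite [tpow _ _ _]/= [ipow _ _ _]/=; set T := tpow w m V in vm *; set P := ipow w m V in vm *.
have -> : (- Iinv) *: idd (w - m%:R) T - (-1) ^+ m.+1 *: idd (w - m%:R) P =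
    (- Iinv) *: idd (w - m%:R) (T - (-1) ^+ m *: P)
    - (Iinv - 1) *: idd (w - m%:R) ((-1) ^+ m *: P).
  rewrite -E iddD iddN iddZcst E; move: (idd _ T) (idd _ P) => X Y.
  by apply/rowP => i; rewrite !mxE exprS; ring.
apply: vanishingVB; first exact/vanishingVZ/vanishing_idd.
by apply/vanishingVZl/vanishing_le/vI; rewrite leq_addr.
Qed.

(** In this dimension and at weight -1 the coefficient of [tpow_sigmaZ] is zero, so a multiple of
    [sigma] is sent to a multiple of [sigma]; the remainder of order [m.+2] loses only [m.+1]
    orders. *)
Lemma tpow_tangential m U V : n = m.+2 ->
  (exists X, vanishingV m.+2 (U - V - sigma *: X)) ->
  vanishingV 1 (tpow 0 m.+1 U - tpow 0 m.+1 V).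
Proof.
move=> nE [X vX].
have -> : tpow 0 m.+1 U = tpow 0 m.+1 (U - V - sigma *: X)
    + tpow 0 m.+1 (sigma *: X) + tpow 0 m.+1 V.
  by rewrite -!tpowD; congr tpow; rewrite subrK subrK.
rewrite addrK; apply: vanishingVD; first exact: vanishing_tpow.
have -> : 0 = -1 + 1 :> R by rewrite addrC subrr.
rewrite tpow_sigmaZ [cst _](_ : _ = 0) ?scale0r ?subr0.
  by apply: vanishingV_sigmaZ => i.
by rewrite -(rmorph0 cst); congr (cst _); rewrite nE -[m.+2]addn2 natrD; ring.
Qed.

Lemma exists_division k (nu : 'I_n -> A) (sinv : A) U :
  sinv * dnu nu sigma = 1 -> (forall a f, Z f -> Z (dtan nu a f)) ->
  (forall i, Z (U 0 i)) -> exists X, vanishingV k (U - sigma *: X).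
Proof.
move=> sK Zt ZU; have [v vP] := fin_all_exists (fun i => vanishing_div sK Zt k (ZU i)).
by exists (\row_i v i) => i; rewrite !mxE.
Qed.

End Bundle.
End Vanishing.

(** * Tractor calculus *)

Section TractorSlots.
Variables (A : nzRingType) (n : nat).
Implicit Types U V : 'rV[A]_(1 + n + 1).

Definition tmk (s : A) (mu : 'rV[A]_n) (r : A) : 'rV[A]_(1 + n + 1) :=
  row_mx (row_mx s%:M mu) r%:M.
Definition ts V : A := lsubmx (lsubmx V) 0 0.
Definition tm V (b : 'I_n) : A := rsubmx (lsubmx V) 0 b.
Definition tb V : A := rsubmx V 0 0.

Lemma ts_mk s mu r : ts (tmk s mu r) = s.
Proof. by rewrite /ts /tmk row_mxKl row_mxKl mxE eqxx. Qed.
Lemma tm_mk s mu r b : tm (tmk s mu r) b = mu 0 b.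
Proof. by rewrite /tm /tmk row_mxKl row_mxKr. Qed.
Lemma tb_mk s mu r : tb (tmk s mu r) = r.
Proof. by rewrite /tb /tmk row_mxKr mxE eqxx. Qed.
Definition tslots := (ts_mk, tm_mk, tb_mk).

Lemma tractor_ind (P : 'I_(1 + n + 1) -> Prop) :
  P (lshift 1 (lshift n 0)) -> (forall b, P (lshift 1 (rshift 1 b))) ->
  P (rshift (1 + n) 0) -> forall i, P i.
Proof.
move=> Ps Pm Pb i; case: (split_ordP i) => j ->; last by rewrite (ord1 j).
by case: (split_ordP j) => k ->; [rewrite (ord1 k)|exact: Pm].
Qed.

Lemma tsE V : V 0 (lshift 1 (lshift n 0)) = ts V. Proof. by rewrite /ts !mxE. Qed.
Lemma tmE V b : V 0 (lshift 1 (rshift 1 b)) = tm V b. Proof. by rewrite /tm !mxE. Qed.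
Lemma tbE V : V 0 (rshift (1 + n) 0) = tb V. Proof. by rewrite /tb !mxE. Qed.

Lemma tractorP U V :
  ts U = ts V -> (forall b, tm U b = tm V b) -> tb U = tb V -> U = V.
Proof.
move=> Es Em Eb; apply/rowP; apply: tractor_ind => [|b|].
- by rewrite !tsE.
- by rewrite !tmE.
- by rewrite !tbE.
Qed.

Lemma tsD U V : ts (U + V) = ts U + ts V. Proof. by rewrite /ts !mxE. Qed.
Lemma tmD U V b : tm (U + V) b = tm U b + tm V b. Proof. by rewrite /tm !mxE. Qed.
Lemma tbD U V : tb (U + V) = tb U + tb V. Proof. by rewrite /tb !mxE. Qed.
Lemma tsN U : ts (- U) = - ts U. Proof. by rewrite /ts !mxE. Qed.
Lemma tmN U b : tm (- U) b = - tm U b. Proof. by rewrite /tm !mxE. Qed.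
Lemma tbN U : tb (- U) = - tb U. Proof. by rewrite /tb !mxE. Qed.
Lemma tsZ f U : ts (f *: U) = f * ts U. Proof. by rewrite /ts !mxE. Qed.
Lemma tmZ f U b : tm (f *: U) b = f * tm U b. Proof. by rewrite /tm !mxE. Qed.
Lemma tbZ f U : tb (f *: U) = f * tb U. Proof. by rewrite /tb !mxE. Qed.
Lemma ts_sum (I : finType) (F : I -> 'rV[A]_(1 + n + 1)) :
  ts (\sum_i F i) = \sum_i ts (F i).
Proof. by rewrite -tsE summxE; apply: eq_bigr => i _; rewrite tsE. Qed.
Lemma tm_sum (I : finType) (F : I -> 'rV[A]_(1 + n + 1)) b :
  tm (\sum_i F i) b = \sum_i tm (F i) b.
Proof. by rewrite -tmE summxE; apply: eq_bigr => i _; rewrite tmE. Qed.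
Lemma tb_sum (I : finType) (F : I -> 'rV[A]_(1 + n + 1)) :
  tb (\sum_i F i) = \sum_i tb (F i).
Proof. by rewrite -tbE summxE; apply: eq_bigr => i _; rewrite tbE. Qed.
Definition tlin := (tsD, tmD, tbD, tsN, tmN, tbN, tsZ, tmZ, tbZ).
End TractorSlots.

Section Tractors.
Variables (R : realFieldType) (n : nat) (A : diff_ring R n).
Variables (g h : 'M[A]_n).
Hypotheses (g_sym : g^T = g) (hg : h *m g = 1%:M) (n_gt2 : (2 < n)%N).
Implicit Types (a b c e : 'I_n) (U V : 'rV[A]_(1 + n + 1)).

Local Notation Chr := (Chr g h).
Local Notation hS := (hE g_sym hg).

Definition schJ : A := cst (2 * (n%:R - 1))^-1 * Sc g h.
Definition sch a b : A := cst (n%:R - 2)^-1 * (ric g h a b - schJ * g a b).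

Let n1_neq0 : n%:R - 1 != 0 :> R.
Proof. by rewrite subr_eq0 pnatr_eq1; case: n n_gt2 => [|[|]]. Qed.
Let n2_neq0 : n%:R - 2 != 0 :> R.
Proof. by rewrite subr_eq0 eqr_nat; case: n n_gt2 => [|[|[|]]]. Qed.

Lemma sch_sym a b : sch a b = sch b a.
Proof. by rewrite /sch (ric_sym g_sym hg) (gE g_sym). Qed.

Let cK (t : R) (x : A) : t != 0 -> cst t * (cst t^-1 * x) = x.
Proof. by move=> t0; rewrite mulrA -rmorphM mulfV // rmorph1 mul1r. Qed.

Let cI (t : R) (x y : A) : t != 0 -> cst t * x = cst t * y -> x = y.
Proof.
move=> t0 /(congr1 ( *%R (cst t^-1))).
by rewrite !mulrA -rmorphM mulVf // rmorph1 !mul1r.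
Qed.

Lemma Sc_schJ : Sc g h = 2 * cst (n%:R - 1) * schJ.
Proof.
have -> : 2 * cst (n%:R - 1) = cst (2 * (n%:R - 1)) :> A by rewrite rmorphM rmorph_nat.
by rewrite /schJ cK // mulf_neq0 // pnatr_eq0.
Qed.

Lemma ric_sch a b : ric g h a b = cst (n%:R - 2) * sch a b + schJ * g a b.
Proof. by rewrite /sch cK // subrK. Qed.

Lemma up_sch b k :
  cst (n%:R - 2) * up h sch b k = Ricup g h b k - schJ * (k == b)%:R.
Proof.
rewrite /up /Ricup mulr_sumr.
have -> : (k == b)%:R = \sum_c h k c * g c b by have /matrixP/(_ k b) := hg; rewrite !mxE.
rewrite mulr_sumr -sumrB; apply: eq_bigr => c _.
by rewrite ric_sch; ring.
Qed.

Lemma div_delta f b :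
  div g h (fun b k => f * (k == b)%:R) b = der b f.
Proof.
have D k : der k (f * (k == b)%:R) = (k == b)%:R * der k f.
  by case: eqP => _; rewrite ?mulr1 ?mul1r // mulr0 mul0r raddf0.
rewrite /div (bigD1 b) //= D eqxx mul1r big1 ?addr0; last first.
  by move=> k kb; rewrite D (negbTE kb) mul0r.
rewrite [X in _ + X - _](eq_bigr (fun k => Chr k k b * f)); last first.
  move=> k _; rewrite (bigD1 b) //= eqxx mulr1 big1 ?addr0 // => l lb.
  by rewrite (negbTE lb) !mulr0.
rewrite [X in _ + _ - X](eq_bigr (fun k => Chr k k b * f)) ?addrK // => k _.
rewrite (bigD1 k) //= eqxx mulr1 big1 ?addr0 // => l lb.
by rewrite eq_sym (negbTE lb) !mulr0.
Qed.

Lemma divZ f S b : div g h (fun b k => f * S b k) b =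
  f * div g h S b + \sum_k S b k * der k f.
Proof.
rewrite /div mulrBr mulrDr !mulr_sumr [RHS]addrAC.
rewrite [X in _ = X - _]addrAC -[in RHS]big_split /=; congr (_ + _ - _).
- by apply: eq_bigr => k _; rewrite derM; ring.
- by apply: eq_bigr => k _; rewrite mulr_sumr; apply: eq_bigr => l _; ring.
- by apply: eq_bigr => k _; rewrite mulr_sumr; apply: eq_bigr => l _; ring.
Qed.

Lemma divD S T b :
  div g h (fun b k => S b k + T b k) b = div g h S b + div g h T b.
Proof.
rewrite /div.
under [X in X + _ - _ = _]eq_bigr do rewrite raddfD.
under [X in _ + X - _ = _]eq_bigr do under eq_bigr do rewrite mulrDr.
under [X in _ - X = _]eq_bigr do under eq_bigr do rewrite mulrDr.
under [X in _ + X - _ = _]eq_bigr do rewrite big_split.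
under [X in _ - X = _]eq_bigr do rewrite big_split.
by rewrite !big_split /=; ring.
Qed.

Lemma eq_div S T b : (forall b k, S b k = T b k) -> div g h S b = div g h T b.
Proof.
move=> E; rewrite /div; congr (_ + _ - _).
- by apply: eq_bigr => k _; rewrite E.
- by apply: eq_bigr => k _; apply: eq_bigr => l _; rewrite E.
- by apply: eq_bigr => k _; apply: eq_bigr => l _; rewrite E.
Qed.

(** Since [Sc = 2 (n - 1) schJ], the contracted Bianchi identity makes the divergence of Ricci
    [n - 1] times the derivative of [schJ]; subtracting the divergence of [schJ] times the identity
    leaves the factor [n - 2]. *)
Lemma div_up_sch b : div g h (up h sch) b = der b schJ.
Proof.
apply: (cI n2_neq0).
have -> : cst (n%:R - 2) * div g h (up h sch) b =
    div g h (fun b k => cst (n%:R - 2) * up h sch b k) b.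
  rewrite [RHS]divZ [X in _ = _ + X]big1 ?addr0 // => k _; by rewrite der_cst mulr0.
rewrite (eq_div (T := fun b k => Ricup g h b k + (- schJ) * (k == b)%:R)); last first.
  by move=> c k; rewrite up_sch mulNr.
rewrite divD div_delta raddfN.
have : cst 2 * div g h (Ricup g h) b = cst 2 * (cst (n%:R - 1) * der b schJ).
  rewrite rmorph_nat (div_Ricup g_sym hg) Sc_schJ -mulrA !derM der_cst mul0r add0r.
  by rewrite (_ : der b 2 = 0) ?mul0r ?add0r // -(rmorph_nat cst) der_cst.
have n0 : 2 != 0 :> R by rewrite pnatr_eq0.
move/(cI n0) => ->.
by rewrite !rmorphB !rmorph_nat rmorph1; ring.
Qed.

Definition nabT a V : 'rV[A]_(1 + n + 1) :=
  tmk (der a (ts V) - tm V a)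
      (\row_b (der a (tm V b) - \sum_c Chr c a b * tm V c
               + g a b * tb V + sch a b * ts V))
      (der a (tb V) - \sum_b \sum_c sch a b * h b c * tm V c).

Lemma ts_nabT a V : ts (nabT a V) = der a (ts V) - tm V a.
Proof. by rewrite tslots. Qed.
Lemma tm_nabT a V b : tm (nabT a V) b = der a (tm V b) - \sum_c Chr c a b * tm V c
               + g a b * tb V + sch a b * ts V.
Proof. by rewrite tslots mxE. Qed.
Lemma tb_nabT a V : tb (nabT a V) =
  der a (tb V) - \sum_b \sum_c sch a b * h b c * tm V c.
Proof. by rewrite tslots. Qed.
Definition nabTE := (ts_nabT, tm_nabT, tb_nabT).

Lemma nabTD a U V : nabT a (U + V) = nabT a U + nabT a V.
Proof.
apply: tractorP => [|b|]; rewrite !(nabTE, tlin).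
- by rewrite raddfD; ring.
- rewrite raddfD; under eq_bigr do rewrite tmD mulrDr.
  by rewrite big_split /=; ring.
rewrite raddfD; under eq_bigr do under eq_bigr do rewrite tmD mulrDr.
under eq_bigr do rewrite big_split /=.
by rewrite big_split /=; ring.
Qed.

Lemma nabTZ a f V : nabT a (f *: V) = der a f *: V + f *: nabT a V.
Proof.
apply: tractorP => [|b|]; rewrite !(nabTE, tlin) derM.
- by ring.
- under eq_bigr do rewrite tmZ mulrCA.
  by rewrite -mulr_sumr; ring.
under eq_bigr do under eq_bigr do rewrite tmZ mulrCA.
under eq_bigr do rewrite -mulr_sumr.
by rewrite -mulr_sumr; ring.
Qed.

Definition dotT U V : A :=
  ts U * tb V + tb U * ts V + \sum_a \sum_b h a b * tm U a * tm V b.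

Lemma dotTC U V : dotT U V = dotT V U.
Proof.
rewrite /dotT exchange_big /= (addrC (ts U * _)) (mulrC (tb U)) (mulrC (ts U)).
congr (_ + _); apply: eq_bigr => b _; apply: eq_bigr => a _.
by rewrite (hS a b); ring.
Qed.

Lemma dotTDl U V W : dotT (U + V) W = dotT U W + dotT V W.
Proof.
rewrite /dotT !tlin addrACA; rewrite -big_split /=.
rewrite [X in _ + X = _](eq_bigr (fun i => \sum_b h i b * tm U i * tm W b +
   \sum_b h i b * tm V i * tm W b)); last first.
  by move=> i _; rewrite -big_split; apply: eq_bigr => j _; rewrite /= tmD; ring.
ring.
Qed.

Lemma dotTZl f U W : dotT (f *: U) W = f * dotT U W.
Proof.
rewrite /dotT !tlin mulrDr mulr_sumr; congr (_ + _); first by ring.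
by apply: eq_bigr => i _; rewrite mulr_sumr; apply: eq_bigr => j _; rewrite tmZ; ring.
Qed.

Lemma dotT_suml (I : finType) (F : I -> 'rV[A]_(1 + n + 1)) W :
  dotT (\sum_i F i) W = \sum_i dotT (F i) W.
Proof.
apply: (big_morph (fun U => dotT U W)) => [U V|]; first exact: dotTDl.
by rewrite -(scale0r 0) dotTZl mul0r.
Qed.

Lemma h_g_sum b a : \sum_c h a c * g c b = (a == b)%:R.
Proof. by have /matrixP/(_ a b) := hg; rewrite !mxE. Qed.

(** Besides metric compatibility, used in [D], the slot-mixing terms of the connection (those with
    [g] and with [sch]) cancel between the outer and the middle slots. *)
Lemma der_dotT a U V : der a (dotT U V) = dotT (nabT a U) V + dotT U (nabT a V).
Proof.
pose G U V := \sum_b \sum_c h b c * der a (tm U b) * tm V c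
  - \sum_b \sum_c h b c * (\sum_e Chr e a b * tm U e) * tm V c.
have E U' V' : \sum_b \sum_c h b c * tm (nabT a U') b * tm V' c =
    G U' V' + tb U' * tm V' a + (\sum_b \sum_c sch a b * h b c * tm V' c) * ts U'.
  have -> : tm V' a = \sum_b \sum_c h b c * g a b * tm V' c.
    rewrite exchange_big (bigD1 a) //= [X in _ + X]big1 ?addr0; last first.
      move=> c ca; rewrite -mulr_suml (eq_bigr (fun b => h c b * g b a)).
        by rewrite h_g_sum // (negbTE ca) mul0r.
      by move=> b _; rewrite hS (gE g_sym).
    rewrite -mulr_suml (eq_bigr (fun b => h a b * g b a)) ?h_g_sum // ?eqxx ?mul1r //.
    by move=> b _; rewrite hS (gE g_sym).
  rewrite /G mulr_sumr mulr_suml -sumrB -!big_split; apply: eq_bigr => b _ /=.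
  rewrite mulr_sumr mulr_suml -sumrB -!big_split; apply: eq_bigr => c _ /=.
  by rewrite tm_nabT; ring.
have D : der a (\sum_b \sum_c h b c * tm U b * tm V c) = G U V + G V U.
  have hG b c : der a (h b c * tm U b * tm V c) =
     h b c * der a (tm U b) * tm V c + h b c * der a (tm V c) * tm U b
     - (\sum_k Chr b a k * h k c) * tm U b * tm V c
     - (\sum_k h b k * Chr c a k) * tm U b * tm V c.
    by rewrite !derM (der_h g_sym hg); ring.
  rewrite der_sum; under eq_bigr do rewrite der_sum.
  under eq_bigr do under eq_bigr do rewrite hG.
  under eq_bigr do rewrite sumrB sumrB big_split /=.
  rewrite sumrB sumrB big_split /= /G.
  have -> : \sum_b \sum_c h b c * der a (tm V b) * tm U c =
     \sum_b \sum_c h b c * der a (tm V c) * tm U b.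
    by rewrite exchange_big; apply: eq_bigr => b _; apply: eq_bigr => c _; rewrite hS.
  have -> : \sum_b \sum_c h b c * (\sum_e Chr e a b * tm U e) * tm V c =
     \sum_b \sum_c (\sum_k Chr b a k * h k c) * tm U b * tm V c.
    rewrite exchange_big [RHS]exchange_big; apply: eq_bigr => c _ /=.
    under eq_bigr do rewrite mulr_sumr mulr_suml.
    rewrite exchange_big; apply: eq_bigr => e _ /=; rewrite !mulr_suml.
    by apply: eq_bigr => b _; ring.
  have -> : \sum_b \sum_c h b c * (\sum_e Chr e a b * tm V e) * tm U c =
     \sum_b \sum_c (\sum_k h b k * Chr c a k) * tm U b * tm V c.
    rewrite exchange_big; apply: eq_bigr => c _ /=.
    under eq_bigr do rewrite mulr_sumr mulr_suml.
    rewrite exchange_big; apply: eq_bigr => e _ /=; rewrite !mulr_suml.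
    by apply: eq_bigr => b _; rewrite hS; ring.
  by ring.
have E' : \sum_b \sum_c h b c * tm U b * tm (nabT a V) c =
    G V U + tb V * tm U a + (\sum_b \sum_c sch a b * h b c * tm U c) * ts V.
  rewrite -E exchange_big; apply: eq_bigr => b _; apply: eq_bigr => c _.
  by rewrite hS; ring.
rewrite /dotT !raddfD D !derM E E' !ts_nabT !tb_nabT; ring.
Qed.

Local Notation lapT := (lapV nabT h Chr).
Local Notation lapG := (lapS h Chr).

Lemma lapS_dotT U : lapG (dotT U U) =
  2 * dotT (lapT U) U + 2 * \sum_a \sum_b h a b * dotT (nabT a U) (nabT b U).
Proof.
have D a : der a (dotT U U) = 2 * dotT (nabT a U) U.
  by rewrite der_dotT (dotTC U); ring.
have d2 a : der a (2 : A) = 0 by rewrite -(rmorph_nat cst) der_cst.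
rewrite /lapS /lapV dotT_suml !mulr_sumr -big_split; apply: eq_bigr => a _ /=.
rewrite dotT_suml !mulr_sumr -big_split; apply: eq_bigr => b _ /=.
rewrite D derM d2 der_dotT dotTZl.
under eq_bigr do rewrite D mulrCA.
rewrite -mulr_sumr dotTDl -scaleN1r dotTZl dotT_suml.
under [X in _ = 2 * (_ * (_ + _ * X)) + _]eq_bigr do rewrite dotTZl.
by rewrite (dotTC (nabT b U) (nabT a U)); ring.
Qed.

(** * The scale tractor and the symmetry of its derivative *)

Section ScaleTractor.
Variables (sigma rho : A).
Hypothesis rhoE : n%:R * rho = - (lapG sigma + schJ * sigma).
Definition scaleT := tmk sigma (\row_a der a sigma) rho.

Let ts_I : ts scaleT = sigma. Proof. by rewrite tslots. Qed.
Let tm_I a : tm scaleT a = der a sigma. Proof. by rewrite tslots mxE. Qed.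
Let tb_I : tb scaleT = rho. Proof. by rewrite tslots. Qed.

(* The middle and bottom slots of [nabT a scaleT]; the former is trace-free. *)
Let S a b := Hess g h sigma a b + rho * g a b + sigma * sch a b.
Let beta a := der a rho - \sum_b \sum_c sch a b * h b c * der c sigma.

Let S_sym a b : S a b = S b a.
Proof. by rewrite /S (Hess_sym h g_sym) (gE g_sym) sch_sym. Qed.

Lemma ts_nabI a : ts (nabT a scaleT) = 0.
Proof. by rewrite ts_nabT ts_I tm_I subrr. Qed.

Let tm_nabI a b : tm (nabT a scaleT) b = S a b.
Proof.
rewrite tm_nabT tm_I tb_I ts_I /S /Hess.
under eq_bigr do rewrite tm_I.
by ring.
Qed.

Let tb_nabI a : tb (nabT a scaleT) = beta a.
Proof.
rewrite tb_nabT tb_I /beta; congr (_ - _).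
by apply: eq_bigr => b _; apply: eq_bigr => c _; rewrite tm_I.
Qed.

Let sum_hg : \sum_a \sum_b h a b * g a b = n%:R.
Proof.
transitivity (\sum_(a < n) (1 : A)); last by rewrite sumr_const card_ord.
apply: eq_bigr => a _; rewrite (eq_bigr (fun c => h a c * g c a)).
  by rewrite h_g_sum // eqxx.
by move=> b _; rewrite (gE g_sym).
Qed.

Let sum_hsch : \sum_a \sum_b h a b * sch a b = schJ.
Proof.
apply: (cI n2_neq0).
have -> : cst (n%:R - 2) * schJ = Sc g h - schJ * n%:R.
  by rewrite Sc_schJ !rmorphB rmorph1 !rmorph_nat; ring.
rewrite -sum_hg /Sc !mulr_sumr -sumrB; apply: eq_bigr => a _.
rewrite !mulr_sumr -sumrB; apply: eq_bigr => b _.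
by rewrite ric_sch; ring.
Qed.

(** The bottom slot [rho] is chosen for this: the trace is [lapG sigma + n rho + schJ sigma]. *)
Let trS : \sum_a \sum_b h a b * S a b = 0.
Proof.
have -> : \sum_a \sum_b h a b * S a b = lapG sigma
    + rho * (\sum_a \sum_b h a b * g a b) + sigma * \sum_a \sum_b h a b * sch a b.
  rewrite /lapS !mulr_sumr -!big_split; apply: eq_bigr => a _ /=.
  rewrite !mulr_sumr -!big_split; apply: eq_bigr => b _ /=.
  by rewrite /S /Hess; ring.
by rewrite sum_hg sum_hsch (mulrC rho) rhoE; ring.
Qed.

(** The Hessian contributes the derivative of [lapG sigma], which is [- n rho - schJ sigma], and a
    Ricci term, rewritten through [sch]. All terms in [schJ] then cancel, and [n - 1] copies of
    [der b rho] and of the contraction of [sch] with the gradient remain. *)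
Let divS b : div g h (up h S) b = - cst (n%:R - 1) * beta b.
Proof.
have E c k : up h S c k = up h (Hess g h sigma) c k + (rho * (k == c)%:R + sigma * up h sch c k).
  rewrite /up /S; under eq_bigr do rewrite 2!mulrDr.
  rewrite !big_split /= -addrA; congr (_ + (_ + _)).
    rewrite -(h_g_sum c k) mulr_sumr.
    by apply: eq_bigr => i _; ring.
  by rewrite mulr_sumr; apply: eq_bigr => i _; ring.
rewrite (eq_div _ E) divD divD div_delta divZ div_up_sch (div_Hess g_sym hg).
have -> : \sum_k up h (Hess g h sigma) k k = lapG sigma.
  by rewrite /up /lapS exchange_big; apply: eq_bigr => c _; apply: eq_bigr => k _; rewrite hS.
have -> : lapG sigma = - (n%:R * rho) - schJ * sigma by rewrite rhoE; ring.
set p := \sum_k up h sch b k * der k sigma.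
have -> : \sum_l ric g h l b * gradup h sigma l =
    cst (n%:R - 2) * p + schJ * der b sigma.
  transitivity (\sum_k Ricup g h b k * der k sigma).
    rewrite /gradup /Ricup; under eq_bigr do rewrite mulr_sumr.
    rewrite exchange_big; apply: eq_bigr => k _; rewrite mulr_suml.
    by apply: eq_bigr => l _; rewrite (hS l k); ring.
  rewrite (eq_bigr (fun k => cst (n%:R - 2) * (up h sch b k * der k sigma) +
     schJ * ((k == b)%:R * der k sigma))).
    rewrite big_split -!mulr_sumr /=; congr (_ + _ * _).
    rewrite (bigD1 b) //= eqxx mul1r big1 ?addr0 // => k kb.
    by rewrite (negbTE kb) mul0r.
  move=> k _; rewrite mulrA up_sch; ring.
have -> : beta b = der b rho - p.
  congr (_ - _); rewrite exchange_big; apply: eq_bigr => c _; rewrite mulr_suml.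
  by apply: eq_bigr => e _; rewrite (hS c e) (sch_sym b e); ring.
have dn : der b (n%:R : A) = 0 by rewrite -(rmorph_nat cst) der_cst.
rewrite raddfB raddfN !derM dn !rmorphB rmorph1 !rmorph_nat; ring.
Qed.

Let ts_lapI : ts (lapT scaleT) = 0.
Proof.
transitivity (- \sum_a \sum_b h a b * S a b); last by rewrite trS oppr0.
rewrite /lapV ts_sum -[in RHS]sumrN; apply: eq_bigr => a _.
rewrite ts_sum -[in RHS]sumrN; apply: eq_bigr => b _.
rewrite !tlin ts_nabT ts_nabI tm_nabI raddf0 ts_sum big1 ?subr0 ?sub0r ?mulrN ?(S_sym b) //.
by move=> c _; rewrite tsZ ts_nabI mulr0.
Qed.

(** At weight 0 the bottom row of [hatD] is the Laplacian divided by [- (n - 2)], so this is the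
    symmetry of [hatD_A I_B] in its mixed middle and bottom entries. The metric term of the
    connection adds one [beta] to the [- (n - 1)] of [divS]. *)
Lemma tm_lapI e : tm (lapT scaleT) e = - cst (n%:R - 2) * tb (nabT e scaleT).
Proof.
rewrite tb_nabI.
have -> : tm (lapT scaleT) e = div g h (up h S) e + beta e.
  rewrite -(div_up g_sym hg).
  have -> : beta e = \sum_a \sum_b h a b * g a e * beta b.
    rewrite exchange_big (bigD1 e) //= [X in _ + X]big1 ?addr0; last first.
      move=> c ce; rewrite -mulr_suml (eq_bigr (fun b => h c b * g b e)).
        by rewrite h_g_sum // (negbTE ce) mul0r.
      by move=> b _; rewrite hS.
    rewrite -mulr_suml (eq_bigr (fun b => h e b * g b e)) ?h_g_sum // ?eqxx ?mul1r //.
    by move=> b _; rewrite hS.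
  rewrite /lapV tm_sum -big_split; apply: eq_bigr => a _ /=.
  rewrite tm_sum -big_split; apply: eq_bigr => b _ /=.
  have E1 : \sum_c Chr c a e * tm (nabT b scaleT) c = \sum_c Chr c a e * S b c.
    by apply: eq_bigr => c _; rewrite tm_nabI.
  have E2 : tm (\sum_c Chr c a b *: nabT c scaleT) e = \sum_c Chr c a b * S c e.
    by rewrite tm_sum; apply: eq_bigr => c _; rewrite tmZ tm_nabI.
  rewrite tmZ tmD tmN tm_nabT E1 E2 tm_nabI tb_nabI ts_nabI.
  by move: (S b e) (\sum_c _) => ? ?; ring.
by rewrite divS !rmorphB rmorph1 !rmorph_nat; ring.
Qed.

(** This is [Kext]: at weight 0 the top row of [hatD_A I] is zero, and the contraction sees only the
    rows of covariant derivatives. *)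
Definition Knab := \sum_a \sum_b h a b * dotT (nabT a scaleT) (nabT b scaleT).
(** Half of [D_A] applied to [I.I], a function of weight 0. *)
Definition Isq_grad : 'rV[A]_(1 + n + 1) :=
  tmk 0 (\row_e (cst ((n%:R - 2) / 2) * der e (dotT scaleT scaleT)))
      (- (cst 2^-1 * lapG (dotT scaleT scaleT))).

Lemma Isq_dotT : Isq sigma h rho = dotT scaleT scaleT.
Proof.
rewrite /Isq /dotT ts_I tb_I; congr (_ + _); first by ring.
by apply: eq_bigr => a _; apply: eq_bigr => b _; rewrite !tm_I.
Qed.

(* [I.D I_A = K X_A + 1/2 D_A (I.I)]: the symmetry of [hatD_A I_B]. *)
Lemma idd_scaleT : idd sigma nabT h Chr schJ rho 0 scaleT =
  Knab *: tmk 0 0 1 + Isq_grad.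
Proof.
have w0 : wt n 0 = n%:R - 2 :> R by rewrite /wt mulr0 addr0.
have cst2 : cst 2^-1 * 2 = 1 :> A.
  by rewrite -(rmorph_nat cst) -rmorphM mulVf ?rmorph1 // pnatr_eq0.
rewrite /idd w0 mulr0 !rmorph0 mul0r scale0r add0r mulr0 scale0r addr0.
apply: tractorP => [|e|]; rewrite !(tlin, tslots).
- rewrite ts_lapI mulr0 subr0 mulr0 addr0 /gradV ts_sum big1 ?mulr0 // => a _.
  by rewrite ts_sum big1 // => b _; rewrite tsZ ts_nabI mulr0.
- rewrite tm_lapI !mxE mulr0 add0r der_dotT (dotTC scaleT) rmorphM.
  rewrite -mulrA [cst 2^-1 * _]mulrDr cst_half.
  rewrite /dotT ts_nabI tb_nabI ts_I tb_I mul0r add0r.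
  have -> : tm (gradV nabT h sigma scaleT) e =
      \sum_a \sum_b h a b * tm (nabT e scaleT) a * tm scaleT b.
    rewrite /gradV tm_sum exchange_big /=; apply: eq_bigr => a _.
    rewrite tm_sum; apply: eq_bigr => b _; rewrite tmZ !tm_nabI tm_I S_sym (hS a b).
    by ring.
  by ring.
(* Half the Laplacian of [I.I] is [Knab] plus the pairing of [lapT scaleT] with [scaleT]; the top
   slot of [lapT scaleT] is zero and its middle slot is given by [tm_lapI], so that the pairing
   reproduces the bottom slot of [I.D I]. *)
rewrite mulr1 lapS_dotT -/Knab mulrDr !mulrA cst2 !mul1r.
rewrite /dotT ts_lapI ts_I tb_I mul0r add0r.
under [X in - (_ + X + _)]eq_bigr do under eq_bigr do rewrite tm_lapI tm_I.
have -> : tb (gradV nabT h sigma scaleT) =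
    \sum_a \sum_b h a b * tb (nabT a scaleT) * der b sigma.
  rewrite /gradV tb_sum exchange_big /=; apply: eq_bigr => a _.
  rewrite tb_sum; apply: eq_bigr => b _; rewrite tbZ (hS a b); ring.
have -> : \sum_a \sum_b h a b * (- cst (n%:R - 2) * tb (nabT a scaleT)) * der b sigma =
    - cst (n%:R - 2) * \sum_a \sum_b h a b * tb (nabT a scaleT) * der b sigma.
  rewrite mulr_sumr; apply: eq_bigr => a _; rewrite mulr_sumr; apply: eq_bigr => b _.
  by ring.
by ring.
Qed.

(** Modulo [sigma], the normal derivative of [I.I] sees only the normal-normal Hessian and [rho];
    for a conformal unit density this expresses the former through the latter. *)
Lemma dnu_dotT (nu := fun c => \sum_b h b c * der b sigma) : exists y,
  dnu nu (dotT scaleT scaleT) =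
  2 * (\sum_a \sum_b nu a * nu b * Hess g h sigma a b + rho * dnu nu sigma) + sigma * y.
Proof.
exists (2 * \sum_a nu a * (tb (nabT a scaleT) + \sum_b nu b * sch a b)).
have D e : der e (dotT scaleT scaleT) = 2 * (tb (nabT e scaleT) * sigma
    + \sum_a nu a * (Hess g h sigma e a + rho * g e a + sigma * sch e a)).
  rewrite der_dotT (dotTC scaleT) (_ : forall t : A, t + t = 2 * t); last by move=> t; ring.
  congr (2 * _); rewrite /dotT ts_nabI mul0r add0r ts_I; congr (_ + _).
  apply: eq_bigr => a _; rewrite /nu mulr_suml; apply: eq_bigr => b _.
  by rewrite tm_nabI tm_I (hS b a) /S; ring.
have ng a : \sum_e nu e * g e a = der a sigma.
  rewrite /nu; under eq_bigr do rewrite mulr_suml.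
  rewrite exchange_big (bigD1 a) //= [X in _ + X]big1 ?addr0; last first.
    move=> c ca; under eq_bigr do rewrite mulrAC.
    by rewrite -mulr_suml h_g_sum (negbTE ca) mul0r.
  under eq_bigr do rewrite mulrAC.
  by rewrite -mulr_suml h_g_sum eqxx mul1r.
have -> : dnu nu sigma = \sum_e \sum_a nu e * (nu a * g e a).
  rewrite exchange_big; apply: eq_bigr => a _; rewrite -ng mulr_sumr.
  by apply: eq_bigr => e _; ring.
have -> : dnu nu (dotT scaleT scaleT) = \sum_e nu e * der e (dotT scaleT scaleT) by [].
rewrite !(mulrDr, mulr_sumr) -!big_split; apply: eq_bigr => e _ /=; rewrite D.
pose P := \sum_b nu b * Hess g h sigma e b.
pose Q := \sum_b nu b * g e b; pose T := \sum_b nu b * sch e b.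
have -> : \sum_a nu a * (Hess g h sigma e a + rho * g e a + sigma * sch e a) =
    P + rho * Q + sigma * T.
  rewrite /P /Q /T !mulr_sumr -!big_split; apply: eq_bigr => a _ /=; ring.
have -> : \sum_b nu e * nu b * Hess g h sigma e b = nu e * P.
  by rewrite mulr_sumr; apply: eq_bigr => b _; rewrite mulrA.
have -> : \sum_a nu e * (nu a * g e a) = nu e * Q by rewrite mulr_sumr.
by rewrite -/T; ring.
Qed.

(** * The bracket of the formula along the zero locus *)

Section Holographic.
Variable Z : A -> Prop.
Hypotheses (Z0 : Z 0) (ZD : forall x y, Z x -> Z y -> Z (x + y))
  (ZM : forall x y, Z y -> Z (x * y)).
Local Notation van := (vanishing Z).
Local Notation vanV := (vanishingV Z).

Lemma vanishingV_slots k V :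
  van k (ts V) -> (forall b, van k (tm V b)) -> van k (tb V) -> vanV k V.
Proof.
by move=> vs vm vb; apply: tractor_ind => [|b|]; rewrite ?tsE ?tmE ?tbE.
Qed.

Lemma vanishing_nabT k a V : vanV k.+1 V -> vanV k (nabT a V).
Proof.
move=> vV; have v0 := vanishingV_le (leqnSn k) vV.
have s0 : van k (ts V) by rewrite -tsE; apply: v0.
have m0 b : van k (tm V b) by rewrite -tmE; apply: v0.
have b0 : van k (tb V) by rewrite -tbE; apply: v0.
have s1 : van k.+1 (ts V) by rewrite -tsE; apply: vV.
have m1 b : van k.+1 (tm V b) by rewrite -tmE; apply: vV.
have b1 : van k.+1 (tb V) by rewrite -tbE; apply: vV.
apply: vanishingV_slots => [|b|]; rewrite nabTE.
- by apply: vanishingB => //; apply: vanishing_der.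
- apply: vanishingD => //; last exact: vanishingM.
  apply: vanishingD => //; last exact: vanishingM.
  apply: vanishingB => //; first exact: vanishing_der.
  by apply: vanishing_sum => // c; apply: vanishingM.
apply: vanishingB => //; first exact: vanishing_der.
by apply: vanishing_sum => // b; apply: vanishing_sum => // c; apply: vanishingM.
Qed.

Variables (m : nat) (B Iinv sinv : A) (N : 'rV[A]_(1 + n + 1)).
Hypotheses (nE : n = m.+2) (Zsigma : Z sigma)
  (Iunit : dotT scaleT scaleT = 1 + sigma ^+ n * B)
  (IinvK : Iinv * dotT scaleT scaleT = 1).
Let nu c := \sum_b h b c * der b sigma.
Hypotheses (sinvK : sinv * dnu nu sigma = 1)
  (Ztan : forall a f, Z f -> Z (dtan sigma nu a f))
  (NI : forall i, Z ((N - scaleT) 0 i)).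

Let vX k j x : van j x -> van (k + j)%N (sigma ^+ k * x).
Proof. exact: vanishing_sigmaX. Qed.

Let vX0 k x : van k (sigma ^+ k * x).
Proof. by rewrite -[X in van X _]addn0; apply: vX. Qed.

Let ddnu : dnu nu sigma = \sum_a \sum_b h a b * der a sigma * der b sigma.
Proof.
by rewrite exchange_big; apply: eq_bigr => b _; rewrite mulr_suml.
Qed.

Let sn : sigma ^+ n = sigma ^+ m.+2. Proof. by congr (_ ^+ _). Qed.

Let dnu1 : van 1 (dnu nu sigma - 1).
Proof.
rewrite ddnu; have -> : \sum_a \sum_b h a b * der a sigma * der b sigma =
    dotT scaleT scaleT - sigma * (2 * rho).
  by rewrite -Isq_dotT /Isq; ring.
have -> : dotT scaleT scaleT - sigma * (2 * rho) - 1 =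
    sigma ^+ 1 * (sigma ^+ m.+1 * B - 2 * rho).
  by rewrite Iunit sn expr1 exprS; ring.
exact: vX0.
Qed.

Lemma der_sigmaX a f : der a (sigma ^+ m.+2 * f) =
  sigma ^+ m.+1 * (m.+2%:R * der a sigma * f) + sigma ^+ m.+2 * der a f.
Proof. by rewrite derM derX; ring. Qed.

(** To leading order both derivatives fall on the power of [sigma], and the squared gradient of
    [sigma] is 1 up to order 1 by [dnu1]. *)
Lemma lapS_sigmaX : van m.+1 (lapG (sigma ^+ m.+2 * B)
  - (m.+2%:R * m.+1%:R) * (sigma ^+ m * B)).
Proof.
have d2 a b : exists y, der a (der b (sigma ^+ m.+2 * B)) =
    (m.+2%:R * m.+1%:R) * (sigma ^+ m * B) * (der a sigma * der b sigma)
    + sigma ^+ m.+1 * y.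
  exists (der a (m.+2%:R * der b sigma * B) + m.+2%:R * der a sigma * der b B
    + sigma * der a (der b B)).
  rewrite der_sigmaX raddfD [der a (_ ^+ m.+1 * _)]derM [der a (_ ^+ m.+1)]derX.
  by rewrite [der a (_ ^+ m.+2 * _)]derM [der a (_ ^+ m.+2)]derX !exprS; ring.
have -> : lapG (sigma ^+ m.+2 * B) - (m.+2%:R * m.+1%:R) * (sigma ^+ m * B) =
    (\sum_a \sum_b h a b * (der a (der b (sigma ^+ m.+2 * B))
       - \sum_c Chr c a b * der c (sigma ^+ m.+2 * B)
       - (m.+2%:R * m.+1%:R) * (sigma ^+ m * B) * (der a sigma * der b sigma)))
    + (sigma ^+ m * (dnu nu sigma - 1)) * (m.+2%:R * m.+1%:R * B).
  have -> : sigma ^+ m * (dnu nu sigma - 1) * (m.+2%:R * m.+1%:R * B) =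
      \sum_a \sum_b h a b * ((m.+2%:R * m.+1%:R) * (sigma ^+ m * B) *
         (der a sigma * der b sigma)) - (m.+2%:R * m.+1%:R) * (sigma ^+ m * B).
    have -> : \sum_a \sum_b h a b * ((m.+2%:R * m.+1%:R) * (sigma ^+ m * B) *
         (der a sigma * der b sigma)) = m.+2%:R * m.+1%:R * (sigma ^+ m * B) * dnu nu sigma.
      rewrite ddnu mulr_sumr; apply: eq_bigr => a _; rewrite mulr_sumr.
      by apply: eq_bigr => b _; ring.
    by move: (dnu nu sigma) => t; ring.
  rewrite addrA /lapS -big_split /=; congr (_ - _); apply: eq_bigr => a _.
  by rewrite -big_split /=; apply: eq_bigr => b _; rewrite -mulrDr subrK.
apply: vanishingD => //; last first.
  apply: vanishingMl => //; rewrite -addn1; apply: vX; exact: dnu1.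
apply: vanishing_sum => // a; apply: vanishing_sum => // b; apply: vanishingM => //.
have [y ->] := d2 a b.
set t := _ * (_ * _); set u := _ * y; set v := \sum_c _.
have -> : t + u - v - t = u - v by ring.
apply: vanishingB => //; first exact: vX0.
apply: vanishing_sum => // c; apply: vanishingM => //; rewrite der_sigmaX.
apply: vanishingD => //.
by apply: (vanishing_le (k := m.+2)) => //; exact: vX0.
Qed.

(** One derivative of [sigma ^+ n * B] still vanishes to order [m.+1], so that only the bottom slot,
    with its two derivatives, has a part of order [m]. *)
Lemma Isq_grad_leading :
  vanV m.+1 (Isq_grad + cst (n%:R * (n%:R - 1) / 2) *: (sigma ^+ m *: (B *: tmk 0 0 1))).
Proof.
have cE x : cst (n%:R * (n%:R - 1) / 2) * x = cst 2^-1 * ((m.+2%:R * m.+1%:R) * x).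
  rewrite [cst _](_ : _ = cst 2^-1 * (m.+2%:R * m.+1%:R)) ?mulrA //.
  rewrite -!(rmorph_nat cst) -!rmorphM; congr (cst _).
  by rewrite [in LHS]nE -[m.+2%:R]natr1 addrK; ring.
have dI a : der a (dotT scaleT scaleT) = der a (sigma ^+ m.+2 * B).
  by rewrite Iunit sn raddfD der1 add0r.
apply: vanishingV_slots => [|b|]; rewrite !(tlin, tslots).
- by rewrite !mulr0 addr0; apply: vanishing0.
- rewrite !mxE !mulr0 addr0 dI; apply: vanishingM => //; apply: vanishing_der.
  exact: vX0.
rewrite mulr1 cE.
have -> : lapG (dotT scaleT scaleT) = lapG (sigma ^+ m.+2 * B).
  apply: eq_bigr => a _; apply: eq_bigr => b _; rewrite !dI; congr (_ * (_ - _)).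
  by apply: eq_bigr => c _; rewrite dI.
have -> : forall p q r : A, - (p * q) + p * r = - p * (q - r) by move=> *; ring.
by apply: vanishingM => //; exact: lapS_sigmaX.
Qed.

(** The weight of [B X] is [1 - n], and with [n = m + 2] the second factors are [- (m - i)]; in
    reversed order they give another factorial and the sign. *)
Let prod_weights : \prod_(i < m) (i.+1%:R * (n%:R + 2 * (1 - n%:R) + i%:R)) =
  (-1) ^+ m * (m`! ^ 2)%:R :> R.
Proof.
have P : \prod_(i < m) (i.+1%:R : R) = (m`!)%:R.
  rewrite -natr_prod; congr (_%:R).
  by elim: (m) => [|k IH]; rewrite ?big_ord0 // big_ord_recr /= IH factS mulnC.
rewrite big_split /= P expnS expn1 natrM mulrCA; congr (_ * _).
rewrite -[in RHS]P -[X in (-1) ^+ X * _]card_ord -prodrN.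
rewrite (reindex_inj rev_ord_inj); apply: eq_bigr => i _ /=.
rewrite nE natrB // -[m.+2]addn2 natrD; ring.
Qed.

Theorem holographic_bracket : vanV 1
  (tpow sigma nabT h Chr schJ rho Iinv 0 m.+1 N
   + (-1) ^+ m *: ipow sigma nabT h Chr schJ rho (-1) m (Knab *: tmk 0 0 1)
   - (cst ((n`! * m`!)%:R / 2) * B) *: tmk 0 0 1).
Proof.
pose tp := tpow sigma nabT h Chr schJ rho Iinv 0 m.+1.
pose ip := ipow sigma nabT h Chr schJ rho.
have nO : forall k a V, vanV k.+1 V -> vanV k (nabT a V) by exact: vanishing_nabT.
have hsym a b : h a b = h b a by exact: hS.
have nD := nabTD; have nZ := nabTZ.
have rhoE' : n%:R * rho = - (lapG sigma + schJ * sigma) := rhoE.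
have IK : Iinv * Isq sigma h rho = 1 by rewrite Isq_dotT.
have T1 : vanV 1 (tp N - tp scaleT).
  apply: tpow_tangential => //.
  exact: (exists_division Z0 ZD ZM Zsigma m.+2 sinvK Ztan NI).
have T2 : vanV 1 (tp scaleT - (-1) ^+ m.+1 *: ip 0 m.+1 scaleT).
  apply: tpow_ipow => //.
  have -> : Iinv - 1 = sigma ^+ m.+2 * (- Iinv * B).
    rewrite -[in LHS](mulr1 Iinv) -[1 in X in _ - X]IinvK -mulrBr Iunit sn; ring.
  exact: vX0.
(* The innermost [I.D] meets [I] itself. The resulting [Knab] term has sign [(-1) ^+ m.+1] and
   cancels the second term of the bracket. *)
have E0 : ip 0 m.+1 scaleT = ip (-1) m (Knab *: tmk 0 0 1) + ip (-1) m Isq_grad.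
  by rewrite /ip ipowS sub0r idd_scaleT ipowD.
pose k : R := n%:R * (n%:R - 1) / 2.
pose BX : 'rV[A]_(1 + n + 1) := B *: tmk 0 0 1.
have T3 : vanV 1 (ip (-1) m Isq_grad + cst k *: ip (-1) m (sigma ^+ m *: BX)).
  rewrite /ip -ipowZcst // -ipowD //; apply: vanishing_ipow => //.
  exact: Isq_grad_leading.
have T4 : vanV 1 (ip (-1) m (sigma ^+ m *: BX)
    - cst ((-1) ^+ m * (m`! ^ 2)%:R) *: BX).
  rewrite -prod_weights (_ : -1 = (1 - n%:R) + m%:R); last first.
    by rewrite nE -[m.+2]addn2 natrD; ring.
  apply: ipow_sigmaX => //; rewrite Isq_dotT Iunit addrC addKr sn exprS -mulrA mulrC.
  exact: ZM.
set P := ip (-1) m (Knab *: _) in E0 *.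
set Q := ip (-1) m Isq_grad in E0 T3 *.
set S' := ip (-1) m (sigma ^+ m *: BX) in T3 T4 *.
(* [n (n - 1)] completes one of the two factorials [m!] to [n!]. *)
have kE : cst ((n`! * m`!)%:R / 2) = cst k * (m`! ^ 2)%:R :> A.
  rewrite -(rmorph_nat cst) -rmorphM; congr (cst _); rewrite /k.
  rewrite [in n`!]nE !factS !natrM [in RHS]nE -[m.+2%:R]natr1 addrK.
  by ring.
have sgn : (-1) ^+ m * (-1) ^+ m = 1 :> A by rewrite -expr2 -exprM mulnC exprM sqrrN !expr1n.
have c4 : cst ((-1) ^+ m * (m`! ^ 2)%:R) = (-1) ^+ m * (m`! ^ 2)%:R :> A.
  by rewrite rmorphM rmorphXn rmorphN1 rmorph_nat.
rewrite c4 in T4; rewrite -/(tp N) -/P kE.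
have -> : tp N + (-1) ^+ m *: P - (cst k * (m`! ^ 2)%:R * B) *: tmk 0 0 1 =
    (tp N - tp scaleT) + (tp scaleT - (-1) ^+ m.+1 *: ip 0 m.+1 scaleT)
    + (- (-1) ^+ m) *: (Q + cst k *: S')
    + (cst k * (-1) ^+ m) *: (S' - ((-1) ^+ m * (m`! ^ 2)%:R) *: BX).
  rewrite E0 /BX; move: (tp N) (tp scaleT) (tmk 0 0 1) P Q S' {T3 T4 E0} => X Y W P Q S'.
  apply/rowP => i; rewrite !mxE exprS.
  move: (P 0 i) (Q 0 i) (S' 0 i) (W 0 i) (cst k) ((m`! ^ 2)%:R : A) => p q s u t f.
  move: ((-1) ^+ m) sgn => e ee.
  transitivity (X 0 i + e * p - t * (e * e) * f * B * u); first by rewrite ee; ring.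
  by ring.
apply: vanishingVD => //; last by apply: vanishingVZ.
apply: vanishingVD => //; last by apply: vanishingVZ.
exact: vanishingVD.
Qed.

End Holographic.

End ScaleTractor.
End Tractors.

(** * Smooth functions on open sets *)

Lemma dist_midpoint (R : realFieldType) (p q p' q' e : R) :
  p' = q' -> `|p - p'| < e / 2 -> `|q - q'| < e / 2 -> `|p - q| <= e.
Proof.
move=> <- pp qp; rewrite [e]splitr; apply: (le_trans (ler_distD p' p q)).
by apply: lerD; rewrite ltW // distrC.
Qed.

(** * Mean values along lines and symmetry of second derivatives *)

Section Lines.
Variables (R : realType) (V : normedModType R).
Implicit Types (f : V -> R) (x v : V).

Lemma derive_line (W : normedModType R) (F : V -> W) x v (t : R) :
  'D_1 (fun s : R => F (s *: v + x)) t = 'D_v F (t *: v + x).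
Proof.
suff E : (fun h : R => h^-1 *: (((fun s => F (s *: v + x)) \o shift t) (h *: 1)
    - F (t *: v + x))) =
  (fun h => h^-1 *: ((F \o shift (t *: v + x)) (h *: v) - F (t *: v + x))).
  by rewrite /derive E.
by apply/funext => h /=; rewrite [h *: 1]mulr1 scalerDl addrA.
Qed.

Lemma is_derive_line f x v (t : R) : derivable f (t *: v + x) v ->
  is_derive t (1 : R) (fun s : R => f (s *: v + x)) ('D_v f (t *: v + x)).
Proof.
have E : (fun h : R => h^-1 *: (((fun s => f (s *: v + x)) \o shift t) (h *: 1)
    - f (t *: v + x))) =
  (fun h => h^-1 *: ((f \o shift (t *: v + x)) (h *: v) - f (t *: v + x))).
  by apply/funext => h /=; rewrite [h *: 1]mulr1 scalerDl addrA.
by move=> df; apply: DeriveDef; [rewrite /derivable E|rewrite /derive E].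
Qed.

Lemma mvt_segment0 (phi dphi : R -> R) (t : R) :
  (forall s : R, `|s| <= `|t| -> is_derive s (1 : R) phi (dphi s)) ->
  exists2 c, `|c| <= `|t| & phi t - phi 0 = t * dphi c.
Proof.
move=> H; have [t0|t0] := leP (0 : R) t.
  have I s : s \in `[0, t] -> `|s| <= `|t|.
    by rewrite in_itv /= => /andP[s0 st]; rewrite !ger0_norm.
  have [||c /I ct E] := @MVT_segment _ phi dphi 0 t t0.
  - by move=> s /subset_itv_oo_cc /I; exact: H.
  - by apply: derivable_within_continuous => s /I /H; case.
  by exists c => //; rewrite E subr0 mulrC.
have I s : s \in `[t, 0] -> `|s| <= `|t|.
  by rewrite in_itv /= => /andP[s0 st]; rewrite !ler0_norm ?lerN2 // ltW.
have [||c /I ct E] := @MVT_segment _ phi dphi t 0 (ltW t0).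
- by move=> s /subset_itv_oo_cc /I; exact: H.
- by apply: derivable_within_continuous => s /I /H; case.
by exists c => //; rewrite -opprB E sub0r mulrN opprK mulrC.
Qed.

Lemma mvt_line f x v (t : R) :
  (forall s, `|s| <= `|t| -> derivable f (s *: v + x) v) ->
  exists2 c, `|c| <= `|t| & f (t *: v + x) - f x = t * 'D_v f (c *: v + x).
Proof.
move=> df; have [|c ct E] := @mvt_segment0 (fun s => f (s *: v + x))
  (fun s => 'D_v f (s *: v + x)) t.
  by move=> s st; apply/is_derive_line/df.
by exists c => //; rewrite -E scale0r add0r.
Qed.

Lemma is_derive_comp1 (phi : R -> R) (dphi : R) f x v :
  derivable f x v -> is_derive (f x) (1 : R) phi dphi ->
  is_derive x v (phi \o f) (dphi * 'D_v f x).
Proof.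
move=> df dphiP; pose psi (s : R) : R := f (s *: v + x).
have psi0 : psi 0 = f x by rewrite /psi scale0r add0r.
have dpsi : is_derive (0 : R) (1 : R) psi ('D_v f x).
  have x0 : 0 *: v + x = x by rewrite scale0r add0r.
  by rewrite -[X in 'D_v f X]x0; apply: is_derive_line; rewrite x0.
have [c1 c2] : is_derive (0 : R) (1 : R) (phi \o psi) (dphi * 'D_v f x).
  by apply: is_derive1_comp; rewrite psi0.
apply: DeriveDef; first exact/derivable1P.
have := derive_line (phi \o f) x v 0; rewrite scale0r add0r => <-; exact: c2.
Qed.

(** By the mean value theorem in either order, the second difference over a small parallelogram is
    [t ^+ 2] times a value of either mixed derivative at a nearby point; continuity of both forces
    equality. *)
Lemma derivative_symmetry f x u v (U : set V) : open U -> U x ->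
  (forall y, U y -> derivable f y u /\ derivable f y v) ->
  (forall y, U y -> derivable ('D_u f) y v /\ derivable ('D_v f) y u) ->
  {for x, continuous ('D_v ('D_u f))} -> {for x, continuous ('D_u ('D_v f))} ->
  'D_v ('D_u f) x = 'D_u ('D_v f) x.
Proof.
move=> oU Ux d1 d2 c1 c2.
apply/eqP; rewrite -subr_eq0 -normr_le0; apply/ler_addgt0Pl => _/posnumP[e].
rewrite addr0.
have e2 : 0 < e%:num / 2 by [].
have n1 : nbhs x U by exact: open_nbhs_nbhs.
have n2 := (@cvgrPdist_lt _ _ _ _ (nbhs_filter x) _ _).1 c1 _ e2.
have n3 := (@cvgrPdist_lt _ _ _ _ (nbhs_filter x) _ _).1 c2 _ e2.
have n4 := @filterI _ _ (nbhs_filter x) _ _ n1 (@filterI _ _ (nbhs_filter x) _ _ n2 n3).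
have [_ /posnumP[r] rP] := (nbhs_ballP x _).1 n4.
(* This keeps the parallelogram spanned by [t *: u] and [t *: v] inside the ball; the summand 1
   makes the denominator positive even for zero vectors. *)
pose t := r%:num / (`|u| + `|v| + 1).
have q0 : 0 < `|u| + `|v| + 1 by rewrite ltr_wpDl ?addr_ge0.
have t0 : 0 < t by rewrite divr_gt0.
have tr w w' c c' : `|w| + `|w'| = `|u| + `|v| -> `|c| <= `|t| -> `|c'| <= `|t| ->
    ball x r%:num (c' *: w' + (c *: w + x)).
  move=> ww ct c't; rewrite -ball_normE /= addrA opprD addrCA subrr addr0 normrN.
  rewrite (le_lt_trans (ler_normD _ _)) // !normrZ.
  have : `|c'| * `|w'| + `|c| * `|w| <= t * (`|u| + `|v|).
    rewrite -ww mulrDr addrC (gtr0_norm t0) in ct c't *.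
    by rewrite lerD // ler_wpM2r.
  move/le_lt_trans; apply; rewrite /t mulrAC ltr_pdivrMr // ltr_pM2l // ltrDl.
  exact: ltr01.
pose D := f (t *: u + (t *: v + x)) - f (t *: u + x) - (f (t *: v + x) - f x).
have tt : `|t| <= `|t| by [].
have z0 : `|0 : R| <= `|t| by rewrite normr0.
have key w w' : `|w| + `|w'| = `|u| + `|v| ->
    (forall y, U y -> derivable f y w) -> (forall y, U y -> derivable ('D_w f) y w') ->
    exists2 y, ball x r%:num y &
    f (t *: w + (t *: w' + x)) - f (t *: w + x) - (f (t *: w' + x) - f x) =
     t * (t * 'D_w' ('D_w f) y).
  move=> ww dw dw'.
  have ww' : `|w'| + `|w| = `|u| + `|v| by rewrite addrC.
  have [|c ct E] := @mvt_segment0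
    (fun s => f (s *: w + (t *: w' + x)) - f (s *: w + x))
    (fun s => 'D_w f (s *: w + (t *: w' + x)) - 'D_w f (s *: w + x)) t.
    move=> s st; apply: is_deriveB.
      by apply/is_derive_line/dw; case: (rP _ (tr _ _ _ _ ww' tt st)).
    apply/is_derive_line/dw; case: (rP _ (tr _ _ _ _ ww st z0)).
    by rewrite scale0r add0r.
  have [|c' ct' E'] := @mvt_line ('D_w f) (c *: w + x) w' t.
    by move=> s st; apply/dw'; case: (rP _ (tr _ _ _ _ ww ct st)).
  exists (c' *: w' + (c *: w + x)); first exact: tr.
  rewrite -E' [t *: w' + (c *: w + x)]addrCA -E !scale0r !add0r.
  by [].
have [y1 /rP[_ [y1P _]] E1] := key u v erefl (fun y Uy => (d1 y Uy).1) (fun y Uy => (d2 y Uy).1).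
have [y2 /rP[_ [_ y2P]] E2] :=
  key v u (addrC _ _) (fun y Uy => (d1 y Uy).2) (fun y Uy => (d2 y Uy).2).
have canc (p q : R) : t * (t * p) = t * (t * q) -> p = q.
  by move=> /(mulfI (lt0r_neq0 t0)) /(mulfI (lt0r_neq0 t0)).
have E : 'D_v ('D_u f) y1 = 'D_u ('D_v f) y2.
  apply: canc; apply: (etrans (esym E1)); apply: (etrans _ E2).
  by rewrite (addrCA (t *: u)) opprB addrAC addrA [in RHS]opprB addrA; ring.
exact: dist_midpoint E y1P y2P.
Qed.

End Lines.

Section Ck.
Variables (R : realType) (n : nat).
Implicit Types (f g : 'rV[R]_n -> R) (a b : 'I_n) (x : 'rV[R]_n) (U : set 'rV[R]_n).

(** Recursion on the order permits induction for products and powers, whose derivatives are built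
    from functions of one order less; with lists of derivatives as in [smooth_on] the induction does
    not close. *)
Fixpoint Ck k U f : Prop :=
  (forall x, U x -> {for x, continuous f}) /\
  if k is k'.+1 then forall a,
    (forall x, U x -> derivable f x (delta_mx 0 a)) /\ Ck k' U (pd f a)
  else True.

Lemma iterated_pd_rcons s a f :
  iterated_pd (rcons s a) f = iterated_pd s (pd f a).
Proof. by rewrite /iterated_pd foldr_rcons. Qed.

Lemma smooth_pd U f a : smooth_on U f -> smooth_on U (pd f a).
Proof. by move=> sf s x Ux; rewrite -iterated_pd_rcons; exact: sf. Qed.

Lemma smooth_continuous U f x : smooth_on U f -> U x -> {for x, continuous f}.
Proof. by move=> /(_ [::] x) sf /sf[]. Qed.

Lemma smooth_derivable U f x a :
  smooth_on U f -> U x -> derivable f x (delta_mx 0 a).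
Proof. by move=> /(_ [::] x) sf /sf[]. Qed.

Lemma smooth_CkP U f : smooth_on U f <-> forall k, Ck k U f.
Proof.
split=> [sf k|].
  elim: k f sf => [|k IH] f sf; first by split=> // x; exact: smooth_continuous.
  split=> [x|a]; first exact: smooth_continuous.
  by split=> [x|]; [exact: smooth_derivable|exact/IH/smooth_pd].
(* The last entry of the list is the derivative taken first, which is the one that [Ck] peels
   off. *)
move=> Cf s; elim/last_ind: s f Cf => [|s a IH] f Cf x Ux.
  have [c /(_ _) d] := Cf 1%N; split=> [|a]; first exact: c.
  by have [+ _] := d a; exact.
rewrite iterated_pd_rcons; apply: IH => // k.
by have [_ /(_ a)[]] := Cf k.+1.
Qed.

Lemma CkS k U f : Ck k.+1 U f -> Ck k U f.
Proof.
elim: k f => [|k IH] f [c d]; first by split.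
by split=> // a; have [da ca] := d a; split=> //; apply: IH.
Qed.

Lemma near_open U x (P : 'rV[R]_n -> Prop) :
  open U -> U x -> (forall y, U y -> P y) -> \forall y \near x, P y.
Proof.
move=> oU Ux H; apply: (@filterS _ _ (nbhs_filter x) U) => //.
exact: open_nbhs_nbhs.
Qed.

Lemma pd_eq U f g a x : open U -> (forall y, U y -> f y = g y) -> U x ->
  pd f a x = pd g a x.
Proof. by move=> oU fg Ux; apply/near_eq_derive/(near_open oU Ux fg). Qed.

Lemma derivable_eq U f g x v : open U -> (forall y, U y -> f y = g y) -> U x ->
  derivable f x v -> derivable g x v.
Proof. by move=> oU fg Ux; apply/near_eq_derivable/(near_open oU Ux fg). Qed.

Lemma continuous_eq U f g x : open U -> (forall y, U y -> f y = g y) -> U x ->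
  {for x, continuous f} -> {for x, continuous g}.
Proof.
move=> oU fg Ux; rewrite /prop_for /continuous_at -(fg x Ux); apply: cvg_trans.
by apply: (@near_eq_cvg _ _ _ (nbhs_filter x)); exact: (near_open oU Ux fg).
Qed.

Lemma Ck_eq k U f g : open U -> (forall y, U y -> f y = g y) -> Ck k U f -> Ck k U g.
Proof.
move=> oU; elim: k f g => [|k IH] f g fg [c d].
  by split=> // x Ux; apply: continuous_eq fg Ux (c x Ux).
split=> [x Ux|a]; first exact: continuous_eq fg Ux (c x Ux).
have [da ca] := d a; split=> [x Ux|]; first exact: derivable_eq fg Ux (da x Ux).
by apply: IH ca => x Ux; apply: pd_eq fg Ux.
Qed.

Lemma smooth_eq U f g : open U -> (forall y, U y -> f y = g y) ->
  smooth_on U f -> smooth_on U g.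
Proof. by move=> oU fg /smooth_CkP Cf; apply/smooth_CkP => k; apply: Ck_eq fg _. Qed.

Lemma smooth_sub U W f : U `<=` W -> smooth_on W f -> smooth_on U f.
Proof. by move=> UW sf s x /UW; exact: sf. Qed.

Lemma Ck_cst k U (r : R) : open U -> Ck k U (fun=> r).
Proof.
move=> oU; elim: k r => [|k IH] r; first by split=> // x _; exact: cst_continuous.
split=> [x _|a]; first exact: cst_continuous.
split=> [x _|]; first exact: derivable_cst.
by apply: (Ck_eq oU _ (IH 0)) => x _; rewrite /pd derive_cst.
Qed.

Lemma pdD f g a x : derivable f x (delta_mx 0 a) -> derivable g x (delta_mx 0 a) ->
  pd (fun y => f y + g y) a x = pd f a x + pd g a x.
Proof. by move=> df dg; rewrite /pd -deriveD. Qed.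

Lemma pdM f g a x : derivable f x (delta_mx 0 a) -> derivable g x (delta_mx 0 a) ->
  pd (fun y => f y * g y) a x = pd f a x * g x + f x * pd g a x.
Proof.
move=> df dg; rewrite /pd; have -> := deriveM df dg.
by rewrite addrC [g x *: _]mulrC.
Qed.

Lemma Ck_add k U f g : open U -> Ck k U f -> Ck k U g -> Ck k U (fun y => f y + g y).
Proof.
move=> oU; elim: k f g => [|k IH] f g [cf df] [cg dg].
  by split=> // x Ux; apply: continuousD; [exact: cf|exact: cg].
split=> [x Ux|a]; first by apply: continuousD; [exact: cf|exact: cg].
have [df1 df2] := df a; have [dg1 dg2] := dg a.
split=> [x Ux|]; first by apply: derivableD; [exact: df1|exact: dg1].
apply: (Ck_eq oU _ (IH _ _ df2 dg2)) => x Ux; rewrite pdD //; [exact: df1|exact: dg1].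
Qed.

Lemma Ck_mul k U f g : open U -> Ck k U f -> Ck k U g -> Ck k U (fun y => f y * g y).
Proof.
move=> oU; elim: k f g => [|k IH] f g Cf Cg.
  have [cf _] := Cf; have [cg _] := Cg.
  by split=> // x Ux; apply: continuousM; [exact: cf|exact: cg].
have [cf df] := Cf; have [cg dg] := Cg.
split=> [x Ux|a]; first by apply: continuousM; [exact: cf|exact: cg].
have [df1 df2] := df a; have [dg1 dg2] := dg a.
split=> [x Ux|]; first by apply: derivableM; [exact: df1|exact: dg1].
have H := Ck_add oU (IH _ _ df2 (CkS Cg)) (IH _ _ (CkS Cf) dg2).
apply: (Ck_eq oU _ H) => x Ux; rewrite pdM //; [exact: df1|exact: dg1].
Qed.

Lemma is_derive_powR f a x (p : R) : 0 < f x -> derivable f x (delta_mx 0 a) ->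
  is_derive x (delta_mx 0 a) (fun y => f y `^ p)
    (p * f x `^ (p - 1) * 'D_(delta_mx 0 a) f x).
Proof. by move=> f0 df; apply: is_derive_comp1 df (is_derive1_powR p f0). Qed.

Lemma Ck_powR k U f (p : R) : open U -> (forall y, U y -> 0 < f y) ->
  Ck k U f -> Ck k U (fun y => f y `^ p).
Proof.
move=> oU f0; elim: k p f f0 => [|k IH] p f f0 Cf; have [cf df] := Cf.
  split=> // x Ux; apply: (@continuous_comp _ _ _ f (fun t => t `^ p)); first exact: cf.
  have [d _] := is_derive1_powR p (f0 x Ux).
  exact/differentiable_continuous/derivable1_diffP.
split=> [x Ux|a].
  apply: (@continuous_comp _ _ _ f (fun t => t `^ p)); first exact: cf.
  have [d _] := is_derive1_powR p (f0 x Ux).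
  exact/differentiable_continuous/derivable1_diffP.
have [df1 df2] := df a.
have D x (Ux : U x) := is_derive_powR p (f0 x Ux) (df1 x Ux).
split=> [x Ux|]; first by have [] := D x Ux.
have H := Ck_mul oU (Ck_mul oU (Ck_cst k p oU) (IH (p - 1) f f0 (CkS Cf))) df2.
by apply: (Ck_eq oU _ H) => x Ux; have [_ <-] := D x Ux.
Qed.

Lemma smooth_cst U (r : R) : open U -> smooth_on U (fun=> r).
Proof. by move=> oU; apply/smooth_CkP => k; exact: Ck_cst. Qed.

Lemma smooth_add U f g : open U -> smooth_on U f -> smooth_on U g ->
  smooth_on U (fun y => f y + g y).
Proof.
move=> oU /smooth_CkP sf /smooth_CkP sg; apply/smooth_CkP => k; exact: Ck_add.
Qed.

Lemma smooth_mul U f g : open U -> smooth_on U f -> smooth_on U g ->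
  smooth_on U (fun y => f y * g y).
Proof.
move=> oU /smooth_CkP sf /smooth_CkP sg; apply/smooth_CkP => k; exact: Ck_mul.
Qed.

Lemma smooth_powR U f (p : R) : open U -> (forall y, U y -> 0 < f y) ->
  smooth_on U f -> smooth_on U (fun y => f y `^ p).
Proof. by move=> oU f0 /smooth_CkP sf; apply/smooth_CkP => k; exact: Ck_powR. Qed.

(** Reciprocals pass through real powers, so that one chain rule serves inverses, square roots and
    density factors; the functions inverted later are all positive. *)
Lemma smooth_inv U f : open U -> (forall y, U y -> 0 < f y) ->
  smooth_on U f -> smooth_on U (fun y => (f y)^-1).
Proof.
move=> oU f0 sf; apply: (smooth_eq oU _ (smooth_powR (-1) oU f0 sf)) => y Uy.
by rewrite powR_inv1 // ltW // f0.
Qed.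

Lemma smooth_pdC U f a b x : open U -> smooth_on U f -> U x ->
  pd (pd f b) a x = pd (pd f a) b x.
Proof.
move=> oU sf Ux.
have D1 y : U y -> derivable f y (delta_mx 0 b) /\ derivable f y (delta_mx 0 a).
  by move=> Uy; split; apply: smooth_derivable sf Uy.
have D2 y : U y -> derivable (pd f b) y (delta_mx 0 a) /\
    derivable (pd f a) y (delta_mx 0 b).
  move=> Uy; split; first exact: (smooth_derivable (smooth_pd b sf) Uy).
  exact: (smooth_derivable (smooth_pd a sf) Uy).
have c1 := smooth_continuous (smooth_pd a (smooth_pd b sf)) Ux.
have c2 := smooth_continuous (smooth_pd b (smooth_pd a sf)) Ux.
exact: (derivative_symmetry oU Ux D1 D2 c1 c2).
Qed.

End Ck.

(** * The differential ring of smooth functions on an open set *)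

Section SmoothRing.
Variables (R : realType) (n : nat).

(** Nonemptiness is what separates 1 from 0 in the ring of smooth functions. *)
Record domain := Domain {
  dset :> set 'rV[R]_n; domain_open : open dset; domain_nonempty : dset !=set0 }.
Arguments domain_open : clear implicits.

Variable W : domain.

(* Smooth functions on [W], extended by zero so that Leibniz equality is
   equality on [W]. *)
Definition smooth0 : {pred 'rV[R]_n -> R} :=
  [pred f | `[< smooth_on W f /\ forall x, ~ dset W x -> f x = 0 >]].

Record sfun := SFun { sfun_val :> 'rV[R]_n -> R; _ : sfun_val \in smooth0 }.
HB.instance Definition _ := [isSub for sfun_val].
HB.instance Definition _ := [Choice of sfun by <:].

Lemma sfun_smooth (f : sfun) : smooth_on W f.
Proof. by case: f => f /= /asboolP[]. Qed.

Lemma sfun_out (f : sfun) x : ~ dset W x -> f x = 0.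
Proof. by case: f => f /= /asboolP[_]; exact. Qed.

Lemma smooth0_zmod : zmod_closed smooth0.
Proof.
have oW := domain_open W; split.
  by apply/asboolP; split=> //; apply: (smooth_cst 0 oW).
move=> f g /asboolP[sf zf] /asboolP[sg zg]; apply/asboolP; split.
  have H := smooth_add oW sf (smooth_mul oW (smooth_cst (-1) oW) sg).
  by apply: (smooth_eq oW _ H) => x _; rewrite mulN1r.
by move=> x Wx; rewrite /GRing.add /GRing.opp /= zf // zg // subr0.
Qed.
HB.instance Definition _ := GRing.isZmodClosed.Build _ smooth0 smooth0_zmod.
HB.instance Definition _ := [SubChoice_isSubZmodule of sfun by <:].

Lemma sfunP (f g : sfun) : (forall x, dset W x -> f x = g x) -> f = g.
Proof.
move=> fg; apply: val_inj; apply/funext => x /=.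
by have [/fg|nWx] := pselect (dset W x); rewrite // !sfun_out.
Qed.

Definition restrict (f : 'rV[R]_n -> R) x : R := if `[< dset W x >] then f x else 0.

Lemma restrictE f x : dset W x -> restrict f x = f x.
Proof. by move=> Wx; rewrite /restrict asboolT. Qed.

Lemma restrict_smooth0 f : smooth_on W f -> restrict f \in smooth0.
Proof.
move=> sf; apply/asboolP; split; last by move=> x nWx; rewrite /restrict asboolF.
by apply: (smooth_eq (domain_open W) _ sf) => x Wx; rewrite restrictE.
Qed.
Definition mksfun f (sf : smooth_on W f) := SFun (restrict_smooth0 sf).

Lemma mksfunE f (sf : smooth_on W f) x : dset W x -> mksfun sf x = f x.
Proof. exact: restrictE. Qed.

Definition sfun1 := mksfun (smooth_cst 1 (domain_open W)).
Definition sfun_mul (f g : sfun) : sfun :=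
  mksfun (smooth_mul (domain_open W) (sfun_smooth f) (sfun_smooth g)).

Lemma sfun_addE (f g : sfun) x : (f + g) x = f x + g x. Proof. by []. Qed.
Lemma sfun_oppE (f : sfun) x : (- f) x = - f x. Proof. by []. Qed.
Lemma sfun0E x : (0 : sfun) x = 0. Proof. by []. Qed.

Let mulE (f g : sfun) x : dset W x -> sfun_mul f g x = f x * g x.
Proof. exact: mksfunE. Qed.

Fact sfun_mulA : associative sfun_mul.
Proof. by move=> f g h; apply: sfunP => x Wx; rewrite !mulE // mulrA. Qed.
Fact sfun_mulC : commutative sfun_mul.
Proof. by move=> f g; apply: sfunP => x Wx; rewrite !mulE // mulrC. Qed.
Fact sfun_mul1 : left_id sfun1 sfun_mul.
Proof. by move=> f; apply: sfunP => x Wx; rewrite mulE // mksfunE // mul1r. Qed.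
Fact sfun_mulD : left_distributive sfun_mul +%R.
Proof.
by move=> f g h; apply: sfunP => x Wx; rewrite sfun_addE !mulE // sfun_addE mulrDl.
Qed.
Fact sfun1_neq0 : sfun1 != 0.
Proof.
apply/eqP => /(congr1 (fun f : sfun => f)) E; have [x Wx] := domain_nonempty W.
move: (congr1 (fun f : sfun => f x) E); rewrite mksfunE // sfun0E.
by move/eqP; rewrite oner_eq0.
Qed.
HB.instance Definition _ := GRing.Zmodule_isComNzRing.Build sfun
  sfun_mulA sfun_mulC sfun_mul1 sfun_mulD sfun1_neq0.

Lemma sfun_mulE (f g : sfun) x : dset W x -> (f * g) x = f x * g x.
Proof. exact: mulE. Qed.
Lemma sfun1E x : dset W x -> (1 : sfun) x = 1.
Proof. exact: mksfunE. Qed.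

Definition sfun_cst (r : R) : sfun := mksfun (smooth_cst r (domain_open W)).
Lemma sfun_cstE r x : dset W x -> sfun_cst r x = r. Proof. exact: mksfunE. Qed.

Fact sfun_cst_zmod : zmod_morphism sfun_cst.
Proof.
move=> r s; apply: sfunP => x Wx.
by rewrite sfun_addE sfun_oppE !sfun_cstE.
Qed.
HB.instance Definition _ := GRing.isZmodMorphism.Build R sfun sfun_cst sfun_cst_zmod.
Fact sfun_cst_monoid : monoid_morphism sfun_cst.
Proof.
split=> [|r s]; apply: sfunP => x Wx; first by rewrite sfun1E // sfun_cstE.
by rewrite sfun_mulE // !sfun_cstE.
Qed.
HB.instance Definition _ := GRing.isMonoidMorphism.Build R sfun sfun_cst sfun_cst_monoid.

Definition sfun_pd (a : 'I_n) (f : sfun) : sfun := mksfun (smooth_pd a (sfun_smooth f)).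
Lemma sfun_pdE a f x : dset W x -> sfun_pd a f x = pd f a x. Proof. exact: mksfunE. Qed.

Let sfun_derivable (f : sfun) a x : dset W x -> derivable f x (delta_mx 0 a).
Proof. exact/smooth_derivable/sfun_smooth. Qed.

Fact sfun_pd_zmod a : zmod_morphism (sfun_pd a).
Proof.
move=> f g; apply: sfunP => x Wx; rewrite sfun_addE sfun_oppE !sfun_pdE // /pd.
by rewrite -deriveB //; exact: sfun_derivable.
Qed.
HB.instance Definition _ a := GRing.isZmodMorphism.Build sfun sfun (sfun_pd a) (sfun_pd_zmod a).

Lemma sfun_pdM a (f g : sfun) :
  sfun_pd a (f * g) = sfun_pd a f * g + f * sfun_pd a g.
Proof.
apply: sfunP => x Wx; rewrite sfun_addE !sfun_mulE // !sfun_pdE //.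
rewrite -pdM; [|exact: sfun_derivable..].
by apply: (pd_eq _ (domain_open W)) => // y Wy; rewrite sfun_mulE.
Qed.

Lemma sfun_pdC a b (f : sfun) : sfun_pd a (sfun_pd b f) = sfun_pd b (sfun_pd a f).
Proof.
apply: sfunP => x Wx; have oW := domain_open W.
have E a' b' : sfun_pd a' (sfun_pd b' f) x = pd (pd f b') a' x.
  by rewrite sfun_pdE //; apply: pd_eq Wx => // y; exact: sfun_pdE.
by rewrite !E; exact: smooth_pdC oW (sfun_smooth f) Wx.
Qed.

Lemma sfun_pd_cst a r : sfun_pd a (sfun_cst r) = 0.
Proof.
apply: sfunP => x Wx; rewrite sfun_pdE // sfun0E.
have -> : pd (sfun_cst r) a x = pd (fun=> r) a x.
  by have oW := domain_open W; apply: pd_eq Wx => // y; exact: sfun_cstE.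
by rewrite /pd derive_cst.
Qed.

Definition sring : diff_ring R n := @DiffRing R n sfun sfun_cst sfun_pd
  sfun_pdM sfun_pdC sfun_pd_cst.

End SmoothRing.
Arguments domain_open {R n} d.
Arguments sring : simpl never.

Lemma sum_mul_le (R : realFieldType) n (u v : 'I_n -> R) (e M : R) :
  0 <= e -> 0 <= M -> (forall i, `|v i| <= e / n.+1%:R) -> (forall i, `|u i| <= M) ->
  `|\sum_i u i * v i| <= e * M.
Proof.
move=> e0 M0 ve uM; apply: (le_trans (ler_norm_sum _ _ _)).
have B i : `|u i * v i| <= M * (e / n.+1%:R).
  by rewrite normrM ler_pM.
apply: (le_trans (ler_sum _ (fun i _ => B i))).
rewrite sumr_const card_ord -mulrnAr mulrC ler_wpM2r // -mulr_natr -mulrA.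
by rewrite ler_piMr // mulrC ler_pdivrMr // mul1r ler_nat.
Qed.

Section Differentiability.
Variables (R : realType) (n : nat).
Implicit Types (f : 'rV[R]_n -> R) (x h : 'rV[R]_n).

(** The truncations are the corners of a staircase from 0 to [h] with edges parallel to the axes,
    along which the mean value theorem involves partial derivatives only. *)
Definition trunc k h : 'rV[R]_n := \row_j (if (j < k)%N then h 0 j else 0).

Lemma truncS (k : 'I_n) h : trunc k.+1 h = h 0 k *: delta_mx 0 k + trunc k h.
Proof.
apply/rowP => j; rewrite !mxE eqxx /= ltnS.
have [->|jk] := eqVneq j k; first by rewrite leqnn ltnn mulr1 addr0.
by rewrite leq_eqVlt val_eqE (negbTE jk) mulr0 add0r.
Qed.

Lemma ball_rowP x (r : R) y : 0 < r ->
  ball x r y <-> forall j, `|x 0 j - y 0 j| < r.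
Proof.
move=> r0; split=> [[_ H] j|H]; first by have := H 0 j; rewrite -ball_normE.
by split=> // i j; rewrite (ord1 i) -ball_normE; exact: H.
Qed.

Lemma row_norm_ge h j : `|h 0 j| <= `|h|.
Proof.
rewrite [leRHS]/Num.Def.normr /= mx_normrE.
by apply: (@le_trans _ _ (`|h (0, j).1 (0, j).2|)) => //; exact: le_bigmax.
Qed.

Lemma increment_partials f x (r : R) h : 0 < r ->
  (forall y a, ball x r y -> derivable f y (delta_mx 0 a)) ->
  ball 0 r h ->
  exists2 y : 'I_n -> 'rV[R]_n, forall k, ball x r (y k) &
    f (h + x) - f x = \sum_k h 0 k * pd f k (y k).
Proof.
move=> r0 df /(ball_rowP 0 h r0) hr.
have hr' j : `|h 0 j| < r by have := hr j; rewrite mxE sub0r normrN.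
have B (k : 'I_n) (c : R) : `|c| <= `|h 0 k| ->
    ball x r (c *: delta_mx 0 k + (trunc k h + x)).
  move=> ck; apply/ball_rowP => // j; rewrite !mxE eqxx /=.
  rewrite addrA opprD addrCA subrr addr0 normrN.
  have [->|jk] := eqVneq j k.
    by rewrite ltnn mulr1 addr0 (le_lt_trans ck).
  by rewrite mulr0 add0r; case: ifP => _; rewrite ?normr0.
have step (k : 'I_n) : exists y, ball x r y /\
    f (trunc k.+1 h + x) - f (trunc k h + x) = h 0 k * pd f k y.
  have [|c ck E] := @mvt_line _ _ f (trunc k h + x) (delta_mx 0 k) (h 0 k).
    by move=> s /B; exact: df.
  exists (c *: delta_mx 0 k + (trunc k h + x)); split; first exact: B.
  by rewrite truncS -addrA.
have [y yP] := fin_all_exists step.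
exists y => [k|]; first by case: (yP k).
under eq_bigr => k _ do rewrite -(yP k).2.
rewrite -(big_mkord xpredT (fun k => f (trunc k.+1 h + x) - f (trunc k h + x))).
rewrite telescope_sumr //; congr (f (_ + x) - f _).
  by apply/rowP => j; rewrite mxE ltn_ord.
by rewrite -[LHS]add0r; congr (_ + _); apply/rowP => j; rewrite !mxE.
Qed.

(** [smooth_on] speaks of partial derivatives, whereas the chain rule along the embedding needs a
    total derivative. Continuity of the partials bounds the error on each edge of the staircase. *)
Lemma smooth_differentiable (U : set 'rV[R]_n) f x : open U -> smooth_on U f -> U x ->
  differentiable f x.
Proof.
move=> oU sf Ux.
have L_lin : linear (fun h : 'rV[R]_n => \sum_k h 0 k * pd f k x : R).
  move=> c u v; rewrite scaler_sumr -big_split; apply: eq_bigr => k _ /=.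
  by rewrite !mxE [c *: _]mulrA mulrDl.
pose LM := GRing.isLinear.Build _ _ _ _ _ L_lin.
pose L : {linear 'rV[R]_n -> R} := HB.pack (fun h : 'rV[R]_n => \sum_k h 0 k * pd f k x : R) LM.
have Lc : continuous L.
  move=> h; have -> : (L : _ -> R) = \sum_k (fun h : 'rV[R]_n => h 0 k * pd f k x : R).
    by apply/funext => u; rewrite fct_sumE.
  apply/differentiable_continuous/differentiable_sum => k.
  by apply: differentiableM; [exact: differentiable_coord|exact: differentiable_cst].
have key (e : R) : 0 < e -> \forall h \near (0 : 'rV[R]_n),
    `|f (h + x) - (f x + L h)| <= e * `|h|.
  move=> e0.
  have n1 : nbhs x U by exact: open_nbhs_nbhs.
  have e1 : 0 < e / n.+1%:R by rewrite divr_gt0.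
  have n2 : \forall y \near nbhs x, forall k, `|pd f k x - pd f k y| < e / n.+1%:R.
    apply: filter_forall => k.
    have c1 := smooth_continuous (smooth_pd k sf) Ux.
    exact: ((@cvgrPdist_lt _ _ _ _ (nbhs_filter x) _ _).1 c1 _ e1).
  have [_ /posnumP[r] rP] := (nbhs_ballP x _).1 (@filterI _ _ (nbhs_filter x) _ _ n1 n2).
  have r0 : 0 < r%:num by [].
  apply/nbhs_ballP; exists r%:num => //= h hr.
  have [|y yr D] := @increment_partials f x r%:num h r0 _ hr.
    by move=> y a /rP[Uy _]; exact: (smooth_derivable sf Uy).
  have -> : f (h + x) - (f x + L h) =
      \sum_k h 0 k * (pd f k (y k) - pd f k x).
    under eq_bigr do rewrite mulrBr.
    by rewrite sumrB -D opprD addrA.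
  apply: sum_mul_le => [||k|k]; [exact: ltW|exact: normr_ge0| |exact: row_norm_ge].
  by have [_ H] := rP _ (yr k); rewrite distrC ltW.
have D : 'd f x = L :> ('rV[R]_n -> R).
  by apply: diff_unique Lc _; apply/eqaddoP => e; exact: key.
by apply/diff_locallyP; rewrite D; split=> //; apply/eqaddoP => e; exact: key.
Qed.

End Differentiability.

Section Jacobian.
Variables (R : realType) (m n : nat).

Lemma smooth_map_differentiable (V : set 'rV[R]_m) (F : 'rV[R]_m -> 'rV[R]_n) y :
  open V -> (forall k, smooth_on V (fun z => F z 0 k)) -> V y -> differentiable F y.
Proof.
move=> oV sF Vy.
have -> : F = \sum_k (fun z => F z 0 k *: (delta_mx 0 k : 'rV[R]_n)).
  by apply/funext => z; rewrite fct_sumE -row_sum_delta.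
apply: differentiable_sum => k; apply: differentiableZl.
exact: smooth_differentiable oV (sF k) Vy.
Qed.

Lemma pd_comp (f : 'rV[R]_n -> R) (F : 'rV[R]_m -> 'rV[R]_n) y a :
  differentiable f (F y) -> differentiable F y ->
  pd (f \o F) a y = \sum_k jacobian F y a k * pd f k (F y).
Proof.
move=> df dF; have dc := differentiable_comp dF df.
have E : 'd F y (delta_mx 0 a) = \sum_k jacobian F y a k *: (delta_mx 0 k : 'rV[R]_n).
  rewrite -deriveE // deriveEjacobian // -rowE [LHS]row_sum_delta.
  by apply: eq_bigr => k _; rewrite mxE.
rewrite /pd deriveE // diff_comp //= E linear_sum; apply: eq_bigr => k _.
by rewrite linearZ deriveE.
Qed.

End Jacobian.

(** * Evaluation of tractor calculus at points *)

Section Evaluation.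
Variables (R : realType) (n : nat) (W : domain R n).
Local Notation A := (sring W).
Variables (x : 'rV[R]_n) (Wx : dset W x).

Definition eval of dset W x := fun f : A => sfun_val f x : R.

Fact eval_zmod : zmod_morphism (eval Wx). Proof. by []. Qed.
HB.instance Definition _ := GRing.isZmodMorphism.Build A R (eval Wx) eval_zmod.
Fact eval_monoid : monoid_morphism (eval Wx).
Proof. by split; [exact: sfun1E Wx|move=> f g; exact: sfun_mulE Wx]. Qed.
HB.instance Definition _ := GRing.isMonoidMorphism.Build A R (eval Wx) eval_monoid.

Definition ev : {rmorphism A -> R} := eval Wx.

Lemma evE (f : A) : ev f = sfun_val f x. Proof. by []. Qed.
Lemma ev_cst (r : R) : ev (cst r) = r. Proof. exact: sfun_cstE Wx. Qed.
Lemma ev_der a (f : A) : ev (der a f) = pd (sfun_val f) a x.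
Proof. exact: sfun_pdE Wx. Qed.
End Evaluation.
Arguments ev : simpl never.

Section Representation.
Variables (R : realType) (n : nat) (W : domain R n).
Local Notation A := (sring W).
Implicit Types (x : 'rV[R]_n) (a b c : 'I_n).

(** Agreement is asked on [W] only, as the values of chart functions elsewhere are arbitrary;
    openness of [W] makes the relation stable under differentiation. *)
Definition rep (f : 'rV[R]_n -> R) (a : A) := forall x (Wx : dset W x), f x = ev Wx a.
Definition repV p q (V : 'rV[R]_n -> 'M[R]_(p, q)) (v : 'M[A]_(p, q)) :=
  forall x (Wx : dset W x), V x = map_mx (ev Wx) v.

Lemma rep_mk f (sf : smooth_on W f) : rep f (mksfun sf).
Proof. by move=> x Wx; rewrite -(mksfunE sf Wx). Qed.

Lemma rep_inj f (a b : A) : rep f a -> rep f b -> a = b.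
Proof. by move=> fa fb; apply: sfunP => x Wx; have := fa x Wx; rewrite (fb x Wx). Qed.

Lemma rep_pd f (a : A) (i : 'I_n) : rep f a -> rep (fun x => pd f i x) (der i a).
Proof.
move=> fa x Wx; rewrite ev_der; have oW := domain_open W.
by apply: pd_eq Wx => // y Wy; exact: fa.
Qed.

Lemma repVE p q V (v : 'M[A]_(p, q)) i j : repV V v -> rep (fun x => V x i j) (v i j).
Proof. by move=> Vv x Wx; rewrite (Vv x Wx) mxE. Qed.

Lemma ttop_ev x (Wx : dset W x) (v : 'rV[A]_(1 + n + 1)) :
  ttop (map_mx (ev Wx) v) = ev Wx (ts v).
Proof. by rewrite /ttop /ts !mxE. Qed.
Lemma tmid_ev x (Wx : dset W x) (v : 'rV[A]_(1 + n + 1)) b :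
  tmid (map_mx (ev Wx) v) 0 b = ev Wx (tm v b).
Proof. by rewrite /tmid /tm !mxE. Qed.
Lemma tbot_ev x (Wx : dset W x) (v : 'rV[A]_(1 + n + 1)) :
  tbot (map_mx (ev Wx) v) = ev Wx (tb v).
Proof. by rewrite /tbot /tb !mxE. Qed.
Lemma mktr_ev x (Wx : dset W x) (s : A) (mu : 'rV[A]_n) (r : A) :
  map_mx (ev Wx) (tmk s mu r) = mktr (ev Wx s) (map_mx (ev Wx) mu) (ev Wx r).
Proof. by rewrite /mktr /tmk !map_row_mx !map_scalar_mx. Qed.

Lemma ttop_mktr s (mu : 'rV[R]_n) r : ttop (mktr s mu r) = s.
Proof. exact: ts_mk. Qed.
Lemma tmid_mktr s (mu : 'rV[R]_n) r : tmid (mktr s mu r) = mu.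
Proof. by apply/rowP => i; exact: tm_mk. Qed.
Lemma tbot_mktr s (mu : 'rV[R]_n) r : tbot (mktr s mu r) = r.
Proof. exact: tb_mk. Qed.
Definition mktrK := (ttop_mktr, tmid_mktr, tbot_mktr).

Section Geometry.
Variables (G : 'rV[R]_n -> 'M[R]_n) (g h : 'M[A]_n).
Hypotheses (Gg : repV G g) (g_sym : g^T = g) (hg : h *m g = 1%:M).
Local Notation ChrA := (Chr g h).

Lemma rep_ginv : repV (ginv G) h.
Proof.
move=> x Wx; have E : map_mx (ev Wx) h *m G x = 1%:M.
  by rewrite (Gg Wx) -map_mxM hg map_scalar_mx rmorph1.
have U : G x \in unitmx by have [] := mulmx1_unit E.
by rewrite /ginv -[LHS]mul1mx -E mulmxK.
Qed.

Lemma rep_christoffel c a b : rep (christoffel G c a b) (ChrA c a b).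
Proof.
move=> x Wx; rewrite /christoffel /Chr rmorphM ev_cst rmorph_sum.
congr (_ * _); apply: eq_bigr => l _.
have Gp i j k : pd (fun y => G y i j) k x = ev Wx (der k (g i j)).
  exact/(rep_pd k)/repVE.
by rewrite (rep_ginv Wx) mxE rmorphM rmorphB rmorphD !Gp.
Qed.

Lemma rep_ricci x (Wx : dset W x) a b : ricci G x a b = ev Wx (ric g h a b).
Proof.
rewrite /ricci /ric !(rmorphB, rmorphD, rmorph_sum).
have P c i j k : pd (christoffel G c i j) k x = ev Wx (der k (ChrA c i j)).
  exact/(rep_pd k)/rep_christoffel.
congr (_ - _ + _ - _).
- by apply: eq_bigr => k _; rewrite P.
- by apply: eq_bigr => k _; rewrite P.
- apply: eq_bigr => k _; rewrite rmorph_sum; apply: eq_bigr => l _.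
  by rewrite rmorphM !(rep_christoffel _ _ _ Wx).
- apply: eq_bigr => k _; rewrite rmorph_sum; apply: eq_bigr => l _.
  by rewrite rmorphM !(rep_christoffel _ _ _ Wx).
Qed.

Lemma rep_schoutenJ : rep (schoutenJ G) (schJ g h).
Proof.
move=> x Wx; rewrite /schoutenJ /schJ rmorphM ev_cst mulrC; congr (_ * _).
rewrite /scalar_curvature /Sc rmorph_sum; apply: eq_bigr => a _.
rewrite rmorph_sum; apply: eq_bigr => b _.
by rewrite rmorphM (rep_ricci Wx) (rep_ginv Wx) mxE.
Qed.

Hypothesis n_gt2 : (2 < n)%N.

Lemma rep_schouten x (Wx : dset W x) a b : schouten G x a b = ev Wx (sch g h a b).
Proof.
rewrite /schouten gtn_eqF // /sch rmorphM rmorphB rmorphM ev_cst mulrC.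
by rewrite (rep_ricci Wx) (rep_schoutenJ Wx) (Gg Wx) mxE.
Qed.

Lemma rep_tractor_connection V v a :
  repV V v -> repV (tractor_connection G V a) (nabT g h a v).
Proof.
move=> Vv x Wx; rewrite /tractor_connection /nabT mktr_ev.
have Et : rep (fun y => ttop (V y)) (ts v).
  by move=> y Wy; rewrite (Vv y Wy) ttop_ev.
have Em b : rep (fun y => tmid (V y) 0 b) (tm v b).
  by move=> y Wy; rewrite (Vv y Wy) tmid_ev.
have Eb : rep (fun y => tbot (V y)) (tb v).
  by move=> y Wy; rewrite (Vv y Wy) tbot_ev.
rewrite rmorphB -(rep_pd a Et Wx) -(Em a x Wx).
congr (mktr _ _ _).
  apply/rowP => b; rewrite !mxE 2!rmorphD rmorphB -(rep_pd a (Em b) Wx).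
  rewrite (rmorphM _ (g a b)) (rmorphM _ (sch g h a b)).
  rewrite -(Eb x Wx) -(Et x Wx) -(rep_schouten Wx) (Gg Wx) mxE rmorph_sum.
  congr (_ - _ + _ + _); apply: eq_bigr => c _.
  by rewrite rmorphM -(rep_christoffel _ _ _ Wx) -(Em c x Wx).
rewrite rmorphB -(rep_pd a Eb Wx) rmorph_sum; congr (_ - _).
apply: eq_bigr => b _; rewrite rmorph_sum; apply: eq_bigr => c _.
by rewrite rmorphM (rmorphM _ (sch g h a b)) -(rep_schouten Wx) (rep_ginv Wx) mxE -(Em c x Wx).
Qed.

Section Bundle.
Variables (p : nat) (nab : connection R n p) (nabA : 'I_n -> 'rV[A]_p -> 'rV[A]_p).
Hypothesis rep_nab : forall V v a, repV V v -> repV (nab V a) (nabA a v).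

Lemma rep_laplacian V v : repV V v -> repV (laplacian G nab V) (lapV nabA h ChrA v).
Proof.
move=> Vv x Wx; rewrite /laplacian /lapV map_mx_sum; apply: eq_bigr => a _.
rewrite map_mx_sum; apply: eq_bigr => b _.
rewrite map_mxZ map_mxB map_mx_sum (rep_ginv Wx) mxE.
rewrite (rep_nab a (rep_nab b Vv) Wx); congr (_ *: (_ - _)).
apply: eq_bigr => c _; rewrite map_mxZ.
by rewrite (rep_christoffel _ _ _ Wx) (rep_nab c Vv Wx).
Qed.

End Bundle.

Lemma mktr_metric x (s : R) mu r :
  mktr s mu r *m tractor_metric G x = mktr r (mu *m ginv G x) s.
Proof.
rewrite /mktr /tractor_metric mul_row_block mul_row_block mul_mx_row mul_row_col.
by rewrite !mulmx1 !mulmx0 !addr0 !add0r add_row_mx add0r addr0.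
Qed.

Lemma mktr_slots (V : 'rV[R]_(1 + n + 1)) : V = mktr (ttop V) (tmid V) (tbot V).
Proof.
rewrite /mktr /ttop /tmid /tbot -!mx11_scalar !hsubmxK.
by [].
Qed.

Lemma tdotE x (U V : 'rV[R]_(1 + n + 1)) : tdot G x U V =
  ttop U * tbot V + tbot U * ttop V + (tmid U *m ginv G x *m (tmid V)^T) 0 0.
Proof.
rewrite /tdot {1}(mktr_slots U) mktr_metric {1}(mktr_slots V) /mktr.
rewrite !tr_row_mx !mul_row_col !tr_scalar_mx -!scalar_mxM !mxE eqxx /=.
by rewrite !mulr1n addrC addrA [in RHS]addrC; ring.
Qed.

Lemma rep_tdot U V u v : repV U u -> repV V v ->
  rep (fun x => tdot G x (U x) (V x)) (dotT h u v).
Proof.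
move=> Uu Vv x Wx; rewrite tdotE (Uu x Wx) (Vv x Wx) /dotT !rmorphD !rmorphM.
rewrite !ttop_ev !tbot_ev (rep_ginv Wx); congr (_ + _).
rewrite mxE exchange_big /= rmorph_sum; apply: eq_bigr => b _.
rewrite mxE mulr_suml rmorph_sum; apply: eq_bigr => a _.
by rewrite [_^T b 0]mxE !tmid_ev mxE !rmorphM (mulrC (ev Wx (h a b))).
Qed.

Section ScaleTractor.
Variables (sg : 'rV[R]_n -> R) (sigma : A).
Hypothesis sgr : rep sg sigma.

Definition rhoA : A := cst n%:R^-1 * - (lapS h ChrA sigma + schJ g h * sigma).

Lemma rhoAE : n%:R * rhoA = - (lapS h ChrA sigma + schJ g h * sigma).
Proof.
rewrite /rhoA mulrA -(rmorph_nat cst) -rmorphM mulfV ?rmorph1 ?mul1r //.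
by rewrite pnatr_eq0; case: n n_gt2.
Qed.

Local Notation sg1 := (fun y => (sg y)%:M : 'rV[R]_1).

Lemma rep_laplacianS x (Wx : dset W x) :
  laplacian G (@density_connection R n) sg1 x 0 0 = ev Wx (lapS h ChrA sigma).
Proof.
have E a : rep (fun y => density_connection sg1 a y 0 0) (der a sigma).
  move=> y Wy; rewrite mxE -(rep_pd a sgr Wy); congr (pd _ a y).
  by apply/funext => z; rewrite mxE.
have E2 a b : rep (fun y => density_connection (density_connection sg1 b) a y 0 0)
    (der a (der b sigma)).
  by move=> y Wy; rewrite mxE -(rep_pd a (E b) Wy).
rewrite /laplacian /lapS summxE rmorph_sum; apply: eq_bigr => a _.
rewrite summxE rmorph_sum; apply: eq_bigr => b _.
rewrite rmorphM rmorphB rmorph_sum -(E2 a b x Wx) (rep_ginv Wx) !mxE summxE.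
congr (_ * (_ - _)); apply: eq_bigr => c _.
by rewrite rmorphM -(E c x Wx) -(rep_christoffel _ _ _ Wx) mxE.
Qed.

Lemma rep_scale_tractor : repV (scale_tractor G sg) (scaleT sigma rhoA).
Proof.
move=> x Wx; have n0 : (n%:R : R) != 0 by rewrite pnatr_eq0; case: n n_gt2.
rewrite /scale_tractor /hatD /thomasD mktr_ev mulr1 addrK mulr1.
rewrite -[mktr _ _ _]trmxK; congr (_^T).
rewrite /mktr !tr_row_mx !tr_scalar_mx !scale_col_mx; congr (col_mx (col_mx _ _) _).
- rewrite scalerA mulVf // scale1r; apply/matrixP => i j.
  by rewrite (sgr Wx).
- apply/matrixP => i j; rewrite !mxE mulrA mulVf // mul1r -(rep_pd i sgr Wx).
  by rewrite (ord1 j); congr (pd _ i x); apply/funext => z; rewrite mxE.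
rewrite /rhoA rmorphM ev_cst rmorphN rmorphD (rmorphM _ (schJ g h)) -(rep_laplacianS Wx).
rewrite -(rep_schoutenJ Wx) -(sgr Wx); apply/matrixP => i j.
by rewrite (ord1 i) (ord1 j) !mxE eqxx !mulr1n mulr1; ring.
Qed.

Section Operators.
Variables (I : 'rV[R]_n -> 'rV[R]_(1 + n + 1)).
Hypothesis Ir : repV I (scaleT sigma rhoA).
Variables (p : nat) (nab : connection R n p) (nabA : 'I_n -> 'rV[A]_p -> 'rV[A]_p).
Hypothesis rep_nab : forall V v a, repV V v -> repV (nab V a) (nabA a v).
Local Notation iddA := (idd sigma nabA h ChrA (schJ g h) rhoA).

Lemma rep_IdotD w V v : repV V v -> repV (IdotD G I nab w V) (iddA w v).
Proof.
move=> Vv x Wx; rewrite /IdotD (Ir Wx) mktr_ev mktr_metric /thomasD /mktr.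
rewrite !mul_row_col !mul_scalar_mx.
rewrite /idd map_mxB !map_mxD !map_mxZ map_mxD map_mxZ.
rewrite (rmorphM _ (schJ g h)) (rmorphM _ (cst (wt n w * w))) !ev_cst.
rewrite -(rep_laplacian rep_nab Vv Wx) -(Vv x Wx) -(rep_schoutenJ Wx) scalerN.
rewrite scalerA (mulrC (ev Wx rhoA)) -!/(wt n w); congr (_ + _ - _).
have -> : \matrix_a (wt n w *: nab V a x) = wt n w *: \matrix_a nab V a x.
  by apply/matrixP => a j; rewrite !mxE.
rewrite -scalemxAr; congr (_ *: _); apply/rowP => j.
have -> : map_mx (ev Wx) (gradV nabA h sigma v) 0 j =
    \sum_a \sum_b ev Wx (h a b) * ev Wx (der a sigma) * nab V b x 0 j.
  rewrite /gradV mxE summxE rmorph_sum; apply: eq_bigr => a _.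
  rewrite summxE rmorph_sum; apply: eq_bigr => b _.
  by rewrite (rep_nab b Vv Wx) !mxE !rmorphM.
rewrite mxE exchange_big /=; apply: eq_bigr => b _.
rewrite [X in _ * X]mxE mxE mulr_suml; apply: eq_bigr => a _.
by rewrite !mxE (rep_ginv Wx) mxE (mulrC (ev Wx (h a b))).
Qed.

Lemma rep_IdotD_pow w k V v : repV V v ->
  repV (IdotD_pow G I nab w k V) (ipow sigma nabA h ChrA (schJ g h) rhoA w k v).
Proof. by move=> Vv; elim: k => //= k IH; exact: rep_IdotD. Qed.

Variable Iinv : A.
Hypothesis IinvK : Iinv * dotT h (scaleT sigma rhoA) (scaleT sigma rhoA) = 1.

Lemma rep_tangential_pow w k V v : repV V v ->
  repV (tangential_pow G I nab w k V)
    (tpow sigma nabA h ChrA (schJ g h) rhoA Iinv w k v).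
Proof.
move=> Vv; elim: k => //= k IH x Wx; rewrite map_mxZ rmorphN.
rewrite (rep_IdotD _ IH Wx); congr (- _ *: _).
rewrite (rep_tdot Ir Ir Wx).
have := congr1 (ev Wx) IinvK; rewrite rmorphM rmorph1 => E.
set t := ev Wx (dotT _ _ _) in E *.
have t0 : t != 0 by apply: contra_eq_neq E => ->; rewrite mulr0 eq_sym oner_eq0.
by rewrite -[LHS]mul1r -E mulfK.
Qed.

End Operators.

(** The top row of [P] is zero at weight 0, and lowering an index exchanges top and bottom rows; the
    second-order row [pb] therefore only meets zero rows. *)
Lemma rep_Kext : rep (Kext G sg) (Knab g h sigma rhoA).
Proof.
move=> x Wx; rewrite /Kext; set P := ambient_P G sg x.
pose TM := tractor_metric G x; pose Ia := scaleT sigma rhoA.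
pose c0 : R := n%:R + 2 * 0 - 2; have n2 : c0 != 0.
  by rewrite /c0 mulr0 addr0 subr_eq0 eqr_nat; case: n n_gt2 => [|[|[|]]].
pose pm : 'M[R]_(n, 1 + n + 1) := \matrix_a map_mx (ev Wx) (nabT g h a Ia).
have [pb PE] : exists pb : 'rV[R]_(1 + n + 1), P = col_mx (col_mx 0 pm) pb.
  rewrite /P /ambient_P /hatD /thomasD !scale_col_mx -/c0; eexists; congr (col_mx (col_mx _ _) _).
    by rewrite mulr0 scale0r scaler0.
  apply/matrixP => a j; rewrite [RHS]mxE -(rep_tractor_connection a rep_scale_tractor Wx).
  by rewrite mxE [X in _ * X]mxE [X in _ * X]mxE mulrA mulVf ?mul1r.
have -> : \sum_a \sum_b (TM *m P *m TM) a b * P a b =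
    \sum_a tdot G x (row a (TM *m P)) (row a P).
  apply: eq_bigr => a _; rewrite /tdot -row_mul mxE; apply: eq_bigr => b _.
  by rewrite !mxE.
have -> : TM *m P = col_mx (col_mx pb (ginv G x *m pm)) 0.
  rewrite /TM /tractor_metric PE mul_block_col mul_block_col mul_col_mx mul_row_col.
  by rewrite !mul1mx !mul0mx !addr0 !add0r add_col_mx add0r addr0.
have t0 U : tdot G x U 0 = 0 by rewrite /tdot trmx0 mulmx0 mxE.
have t0' U : tdot G x 0 U = 0 by rewrite /tdot !mul0mx mxE.
rewrite PE big_split_ord big_split_ord !big_ord1 /=.
rewrite !(rowKu, rowKd) !row0 t0 t0' addr0 add0r.
rewrite /Knab rmorph_sum; apply: eq_bigr => a _; rewrite !(rowKu, rowKd).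
have rowpm b : row b pm = tractor_connection G (scale_tractor G sg) b x.
  by rewrite rowK (rep_tractor_connection b rep_scale_tractor Wx).
rewrite row_mul mulmx_sum_row /tdot !mulmx_suml summxE (rmorph_sum (ev Wx)).
apply: eq_bigr => b _; rewrite -!scalemxAl mxE rmorphM !rowpm mxE.
rewrite (rep_ginv Wx) mxE (dotTC g_sym hg); congr (_ * _).
exact: (rep_tdot (rep_tractor_connection b rep_scale_tractor)
  (rep_tractor_connection a rep_scale_tractor) Wx).
Qed.

End ScaleTractor.
End Geometry.
End Representation.

(** * Linear algebra and the intrinsic contraction *)

Definition posdef (R : realFieldType) n (g : 'M[R]_n) :=
  forall v : 'rV[R]_n, v != 0 -> 0 < (v *m g *m v^T) 0 0.

Lemma posdef_unitmx (R : realFieldType) n (g : 'M[R]_n) : posdef g -> g \in unitmx.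
Proof.
move=> gp; rewrite -row_free_unit -kermx_eq0; apply/rowV0P => v /sub_kermxP vg.
apply/eqP; apply: contraT => /gp; by rewrite vg mul0mx mxE ltxx.
Qed.

Lemma posdef1 (R : realFieldType) n : posdef (1%:M : 'M[R]_n).
Proof.
move=> v v0; rewrite mulmx1 mxE.
have nn i : 0 <= v 0 i * v^T i 0 by rewrite mxE -expr2 sqr_ge0.
rewrite lt0r sumr_ge0 // andbT; apply: contraNneq v0 => /eqP.
rewrite psumr_eq0 // => /allP v0; apply/eqP/rowP => i; rewrite [RHS]mxE.
by have := v0 i (mem_index_enum _); rewrite mxE -expr2 sqrf_eq0 => /eqP.
Qed.

(* The determinant does not vanish on the segment from [1] to [g], so the
   intermediate value theorem for polynomials applies. *)
Lemma posdef_det_gt0 (R : rcfType) n (g : 'M[R]_n) : posdef g -> 0 < \det g.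
Proof.
move=> gp; rewrite lt0r -unitfE -unitmxE posdef_unitmx //= leNgt; apply/negP => d0.
pose p : {poly R} := \det (map_mx polyC 1%:M + 'X *: map_mx polyC (g - 1%:M)).
have pE t : p.[t] = \det (1%:M + t *: (g - 1%:M)).
  rewrite -horner_evalE -det_map_mx; congr (\det _); apply/matrixP => i j.
  by rewrite !mxE /= horner_evalE !hornerE.
have [t] : exists2 t, t \in `[0, 1] & root p t.
  have [||t t01 rt] := @poly_ivt _ (- p) 0 1 => //.
    by rewrite !hornerN !pE scale0r addr0 det1 scale1r addrC subrK oppr_le0 ler01 oppr_ge0 ltW.
  by exists t => //; rewrite -rootN.
rewrite in_itv /= => /andP[t0 t1] /rootP; rewrite pE => pt.
have gt : posdef (1%:M + t *: (g - 1%:M)).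
  move=> v v0; have -> : 1%:M + t *: (g - 1%:M) = (1 - t) *: 1%:M + t *: g.
    by rewrite scalerBr scalerBl scale1r addrA addrAC.
  rewrite mulmxDr mulmxDl -!scalemxAr -!scalemxAl !(mxE, addmxE).
  have := gp v v0; have := @posdef1 _ _ v v0; rewrite !mxE => p1 pg.
  have [->|tn0] := eqVneq t 0; first by rewrite subr0 mul1r mul0r addr0.
  have tp : 0 < t by rewrite lt0r tn0.
  by apply: ltr_wpDl; [apply: mulr_ge0; [rewrite subr_ge0|exact: ltW]|exact: mulr_gt0].
by have := posdef_unitmx gt; rewrite unitmxE pt unitr0.
Qed.

Lemma posdef_pullback (R : realFieldType) m n (J : 'M[R]_(m, n)) (g : 'M[R]_n) :
  row_free J -> posdef g -> posdef (J *m g *m J^T).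
Proof.
move=> Jf gp v v0; rewrite !mulmxA -mulmxA -trmx_mul; apply: gp.
by apply: contraNneq v0 => vJ; rewrite -(mulmx_free_eq0 v Jf) vJ.
Qed.

(** The kernel of [J^T] has dimension [n - m = 1]. *)
Lemma conormal_proportional (F : fieldType) m n (J : 'M[F]_(m, n)) (u v : 'rV[F]_n) :
  n = m.+1 -> row_free J -> J *m u^T = 0 -> J *m v^T = 0 -> u != 0 ->
  exists l, v = l *: u.
Proof.
move=> nE Jf Ju Jv u0.
have K (w : 'rV_n) : J *m w^T = 0 -> (w <= kermx J^T)%MS.
  by move=> Jw; apply/sub_kermxP; rewrite -[LHS]trmxK trmx_mul trmxK Jw trmx0.
have rk : \rank (kermx J^T) = 1.
  by rewrite mxrank_ker mxrank_tr (eqP Jf) nE subSnn.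
have ku : (kermx J^T <= u)%MS.
  have := mxrank_leqif_eq (K u Ju); rewrite rk rank_rV u0 => -[_ /esym].
  by rewrite eqxx => /eqmxP ->.
by apply/sub_rVP; exact: submx_trans (K v Jv) ku.
Qed.

(** * The intrinsic Thomas operator on multiples of [X] *)

Section Intrinsic.
Variables (R : realType) (m : nat) (G : 'rV[R]_m -> 'M[R]_m) (D : set 'rV[R]_m).
Variables (V : 'rV[R]_m -> 'rV[R]_(1 + m + 1)) (b : 'rV[R]_m -> R) (y : 'rV[R]_m).
Hypotheses (oD : open D) (Dy : D y) (VE : forall z, D z -> V z = mktr 0 0 (b z)).
Hypotheses (Gs : (G y)^T = G y) (Gu : G y \in unitmx).

Let pd0 (f : 'rV[R]_m -> R) (r : R) a z : (forall w, D w -> f w = r) -> D z -> pd f a z = 0.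
Proof.
move=> fE Dz; have E : pd (fun=> r) a z = 0 by rewrite /pd derive_cst.
rewrite -E; by apply: pd_eq Dz => // w Dw; exact: fE.
Qed.

Let nabV a z : D z -> tractor_connection G V a z = mktr 0 (b z *: row a (G z)) (pd b a z).
Proof.
move=> Dz; rewrite /tractor_connection VE // ttop_mktr tmid_mktr tbot_mktr.
congr (mktr _ _ _).
- by rewrite (pd0 (r := 0)) // => [|w Dw]; rewrite ?mxE ?subrr ?VE ?ttop_mktr.
- apply/rowP => c; rewrite !mxE (pd0 (r := 0)) // => [|w Dw].
    rewrite big1 => [|e _]; last by rewrite mxE mulr0.
    by rewrite mulr0 subrr add0r addr0 mulrC.
  by rewrite VE // tmid_mktr mxE.
rewrite big1 ?subr0 => [|e _]; last by rewrite big1 // => c _; rewrite mxE mulr0.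
by apply: pd_eq Dz => // w Dw; rewrite VE // tbot_mktr.
Qed.

Let sum_ginv : \sum_a \sum_c ginv G y a c * G y a c = m%:R.
Proof.
transitivity (\tr (ginv G y *m G y)); last by rewrite mulVmx // mxtrace1.
apply: eq_bigr => a _; rewrite mxE; apply: eq_bigr => c _.
by rewrite -{1}Gs mxE.
Qed.

(** One derivative moves [b] into the middle slot as [b] times the metric, a second one moves it to
    the top slot with a minus sign; the trace of the metric gives [m]. *)
Let lapV_top : ttop (laplacian G (tractor_connection G) V y) = - (m%:R * b y).
Proof.
have E (U : 'rV[R]_(1 + m + 1)) : ttop U = U 0 (lshift 1 (lshift m 0)).
  by rewrite /ttop !mxE.
rewrite E /laplacian summxE -sum_ginv mulr_suml -sumrN; apply: eq_bigr => a _.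
rewrite summxE mulr_suml -sumrN; apply: eq_bigr => c _.
rewrite mxE -mulrA -mulrN -E; congr (_ * _).
rewrite E mxE [X in _ + X]mxE summxE big1 ?subr0 => [|e _]; last first.
  by rewrite mxE -E nabV // ttop_mktr mulr0.
have -> : tractor_connection G (tractor_connection G V c) a y
    (0 : 'I_1) (lshift 1 (lshift m 0)) =
    pd (fun w => ttop (tractor_connection G V c w)) a y
    - tmid (tractor_connection G V c y) 0 a by rewrite -E [LHS]ttop_mktr.
rewrite nabV // tmid_mktr.
rewrite (pd0 (r := 0)) // => [|w Dw]; last by rewrite nabV // ttop_mktr.
by rewrite !mxE sub0r -{1}Gs mxE mulrC.
Qed.

(** With [cw = m + 2 w - 2], the slots of [D] contribute [cw * w], [cw * m] and [m] times [b y]. For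
    [w = - m] the first two cancel. *)
Lemma intrinsic_contraction w : w + m%:R = 0 ->
  thomasD_contraction G w V y = m%:R * b y.
Proof.
move=> wm; rewrite /thomasD_contraction.
pose nab : connection R m (1 + m + 1) := tractor_connection G; pose cw : R := m%:R + 2 * w - 2.
have tb_e (U : 'rV[R]_(1 + m + 1)) : U 0 (rshift (1 + m) 0) = tbot U.
  by rewrite /tbot !mxE.
have ts_e (U : 'rV[R]_(1 + m + 1)) : U 0 (lshift 1 (lshift m 0)) = ttop U.
  by rewrite /ttop !mxE.
have tm_e (U : 'rV[R]_(1 + m + 1)) a : U 0 (lshift 1 (rshift 1 a)) = tmid U 0 a.
  by rewrite /tmid !mxE.
have E1 : tractor_metric G y (lshift 1 (lshift m 0)) (rshift (1 + m) 0) = 1.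
  by rewrite /tractor_metric block_mxEur col_mxEu mxE eqxx.
have E2 : tractor_metric G y (rshift (1 + m) 0) (lshift 1 (lshift m 0)) = 1.
  by rewrite /tractor_metric block_mxEdl row_mxEl mxE eqxx.
have E3 a c : tractor_metric G y (lshift 1 (rshift 1 a)) (lshift 1 (rshift 1 c)) = ginv G y a c.
  by rewrite /tractor_metric block_mxEul block_mxEdr.
have Z1 c : tractor_metric G y (lshift 1 (lshift m 0)) (lshift 1 c) = 0.
  rewrite /tractor_metric block_mxEul; case: (split_ordP c) => {}c ->.
    by rewrite block_mxEul mxE.
  by rewrite block_mxEur mxE.
have Z2 a : tractor_metric G y (lshift 1 (rshift 1 a)) (lshift 1 (lshift m 0)) = 0.
  by rewrite /tractor_metric block_mxEul block_mxEdl mxE.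
have Z3 a : tractor_metric G y (lshift 1 (rshift 1 a)) (rshift (1 + m) 0) = 0.
  by rewrite /tractor_metric block_mxEur col_mxEd mxE.
have Z4 a : tractor_metric G y (rshift (1 + m) 0) (lshift 1 (rshift 1 a)) = 0.
  by rewrite /tractor_metric block_mxEdl row_mxEr mxE.
have Z5 : tractor_metric G y (rshift (1 + m) 0) (rshift (1 + m) 0) = 0.
  by rewrite /tractor_metric block_mxEdr mxE.
rewrite big_split_ord big_split_ord !big_ord1 /=.
have -> : \sum_c tractor_metric G y (lshift 1 (lshift m 0)) c *
    thomasD G nab w V y (lshift 1 (lshift m 0)) c = cw * w * b y.
  rewrite big_split_ord big_ord1 /= big1 ?add0r => [|c _]; last by rewrite Z1 mul0r.
  by rewrite E1 mul1r /thomasD col_mxEu col_mxEu mxE tb_e VE // tbot_mktr.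
have -> : \sum_a \sum_c tractor_metric G y (lshift 1 (rshift 1 a)) c *
    thomasD G nab w V y (lshift 1 (rshift 1 a)) c = cw * m%:R * b y.
  rewrite -sum_ginv mulr_sumr mulr_suml; apply: eq_bigr => a _.
  rewrite big_split_ord big_split_ord !big_ord1 /= Z2 Z3 !mul0r addr0 add0r.
  rewrite mulr_sumr mulr_suml; apply: eq_bigr => c _.
  rewrite E3 /thomasD col_mxEu col_mxEd mxE mxE tm_e /nab nabV // tmid_mktr !mxE.
  by rewrite -/cw; ring.
have -> : \sum_c tractor_metric G y (rshift (1 + m) 0) c *
    thomasD G nab w V y (rshift (1 + m) 0) c = m%:R * b y.
  rewrite big_split_ord big_split_ord !big_ord1 /= Z5 mul0r addr0 E2 mul1r.
  rewrite big1 ?addr0 => [|a _]; last by rewrite Z4 mul0r.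
  rewrite /thomasD col_mxEd mxE mxE ts_e lapV_top mxE ts_e VE // ttop_mktr mulr0 addr0.
  by rewrite opprK.
have -> : w = - m%:R by apply/eqP; rewrite -addr_eq0 wm.
by ring.
Qed.

End Intrinsic.

(** * The hypersurface in a chart *)

Section RepSmooth.
Variables (R : realType) (n : nat) (W : domain R n).
Local Notation A := (sring W).

Lemma rep_smooth f (a : A) : rep f a -> smooth_on W f.
Proof.
move=> fa; have oW := domain_open W.
by apply: (smooth_eq oW _ (sfun_smooth a)) => x Wx; rewrite (fa x Wx).
Qed.

Lemma rep_inv f (a : A) : rep f a -> (forall x, dset W x -> 0 < f x) ->
  exists b : A, b * a = 1.
Proof.
move=> fa f0; have oW := domain_open W.
exists (mksfun (smooth_inv oW f0 (rep_smooth fa))); apply: sfunP => x Wx.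
rewrite sfun_mulE // sfun1E // mksfunE // -[sfun_val a x](fa x Wx) mulVf //.
by rewrite gt_eqF // f0.
Qed.

(** The inverse is the adjugate times the reciprocal of the determinant, so a single reciprocal, of
    a positive function, has to be smooth. *)
Lemma rep_metric (G : 'rV[R]_n -> 'M[R]_n) :
  (forall a b, smooth_on W (fun x => G x a b)) ->
  (forall x, dset W x -> (G x)^T = G x) -> (forall x, dset W x -> posdef (G x)) ->
  exists g h : 'M[A]_n, [/\ repV G g, g^T = g & h *m g = 1%:M].
Proof.
move=> sG Gs Gp; pose g : 'M[A]_n := \matrix_(a, b) mksfun (sG a b).
have Gg : repV G g.
  by move=> x Wx; apply/matrixP => a b; rewrite !mxE evE mksfunE.
have dg : rep (fun x => \det (G x)) (\det g).
  by move=> x Wx; rewrite (Gg x Wx) det_map_mx.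
have [|d dE] := rep_inv dg; first by move=> x Wx; exact: posdef_det_gt0 (Gp x Wx).
exists g, (d *: \adj g); split=> //.
  apply/matrixP => a b; apply: sfunP => x Wx.
  have /matrixP/(_ a b) := Gs x Wx; rewrite (Gg x Wx) !mxE; exact.
by rewrite -scalemxAl mul_adj_mx scale_scalar_mx dE.
Qed.

End RepSmooth.

Section LocalHypersurface.
Variables (R : realType) (n : nat) (W : domain R n).
Local Notation A := (sring W).
Variables (G : 'rV[R]_n -> 'M[R]_n) (g h : 'M[A]_n).
Hypotheses (Gg : repV G g) (g_sym : g^T = g) (hg : h *m g = 1%:M) (n_gt2 : (2 < n)%N).
Variables (sg : 'rV[R]_n -> R) (sigma : A).
Hypothesis sgr : rep sg sigma.
Local Notation rho := (rhoA g h sigma).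
Local Notation I := (scale_tractor G sg).

Definition conormal_sq x := (grad sg x *m ginv G x *m (grad sg x)^T) 0 0.
Let nu c : A := \sum_b h b c * der b sigma.

Let pd_sg a x (Wx : dset W x) : pd sg a x = ev Wx (der a sigma).
Proof. exact: (rep_pd a sgr Wx). Qed.

Let nuE x (Wx : dset W x) c : (grad sg x *m ginv G x) 0 c = ev Wx (nu c).
Proof.
rewrite mxE /nu rmorph_sum; apply: eq_bigr => b _.
by rewrite mxE (pd_sg b Wx) (rep_ginv Gg hg Wx) mxE rmorphM mulrC.
Qed.

Lemma rep_conormal_sq : rep conormal_sq (dnu nu sigma).
Proof.
move=> x Wx; rewrite /conormal_sq mxE /dnu rmorph_sum; apply: eq_bigr => c _.
by rewrite (nuE Wx) [_^T _ _]mxE mxE (pd_sg c Wx) rmorphM.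
Qed.

Lemma rep_Isq : rep (fun x => tdot G x (I x) (I x))
  (dotT h (scaleT sigma rho) (scaleT sigma rho)).
Proof. by apply: rep_tdot; do ?exact: rep_scale_tractor. Qed.

Lemma dnu_Isq : dnu nu sigma =
  dotT h (scaleT sigma rho) (scaleT sigma rho) - sigma * (2 * rho).
Proof.
rewrite -Isq_dotT /Isq addrAC (_ : 2 * sigma * rho - sigma * (2 * rho) = 0) ?add0r; last by ring.
by rewrite exchange_big; apply: eq_bigr => b _; rewrite mulr_suml.
Qed.

Variable B : A.
Hypothesis Iunit : dotT h (scaleT sigma rho) (scaleT sigma rho) = 1 + sigma ^+ n * B.
Hypothesis q_gt0 : forall x, dset W x -> 0 < conormal_sq x.

Section AtPoint.
Variables (x : 'rV[R]_n) (Wx : dset W x).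
Hypothesis x0 : sg x = 0.

Let ev_sigma : ev Wx sigma = 0. Proof. by rewrite -(sgr Wx). Qed.

Let n0 : n = n.-2.+2. Proof. by case: n n_gt2 => [|[|[|]]]. Qed.

Let ev_nu_sigma : ev Wx (dnu nu sigma) = 1.
Proof.
rewrite dnu_Isq Iunit rmorphB rmorphD (rmorphM _ sigma) rmorph1
  (rmorphM _ (sigma ^+ n)) rmorphXn ev_sigma.
by rewrite expr0n mul0r (negbTE (lt0n_neq0 (ltn_trans _ n_gt2))) // mul0r addr0 subr0.
Qed.

Let r y := (Num.sqrt (conormal_sq y))^-1.

Let r_smooth : smooth_on W r.
Proof.
have oW := domain_open W.
have s := smooth_powR 2^-1 oW q_gt0 (rep_smooth rep_conormal_sq).
apply: (smooth_eq oW _ (smooth_inv oW _ s)) => y Wy; last exact/powR_gt0/q_gt0.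
by rewrite /r powR12_sqrt // ltW // q_gt0.
Qed.

Let r_x : r x = 1.
Proof. by rewrite /r (rep_conormal_sq Wx) ev_nu_sigma sqrtr1 invr1. Qed.

Let ucE y b : unit_conormal G sg y 0 b = r y * pd sg b y.
Proof. by rewrite /unit_conormal mxE [X in _ * X]mxE. Qed.

Let uc_x : unit_conormal G sg x = grad sg x.
Proof. by apply/rowP => b; rewrite ucE r_x mul1r mxE. Qed.

Let pd_uc a b : pd (fun y => unit_conormal G sg y 0 b) a x =
  pd r a x * pd sg b x + ev Wx (der a (der b sigma)).
Proof.
have -> : (fun y => unit_conormal G sg y 0 b) = (fun y => r y * pd sg b y).
  by apply/funext => y; rewrite ucE.
rewrite pdM; [|exact: smooth_derivable r_smooth Wx|]; last first.
  exact: smooth_derivable (smooth_pd b (rep_smooth sgr)) Wx.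
by rewrite r_x mul1r -(rep_pd a (rep_pd b sgr) Wx).
Qed.

Let ev_Hess a b : ev Wx (Hess g h sigma a b) = ev Wx (der a (der b sigma))
  - \sum_c christoffel G c a b x * pd sg c x.
Proof.
rewrite /Hess rmorphB rmorph_sum; congr (_ - _); apply: eq_bigr => c _.
by rewrite rmorphM -(rep_christoffel Gg hg c a b Wx) pd_sg.
Qed.

(** At a zero of [sg] the function [1 + sigma ^+ n * B] has zero first derivatives, because [n] is
    at least 2; the normal derivative given by [dnu_dotT] must then be zero. *)
Let nn_Hess : ev Wx (\sum_a \sum_b nu a * nu b * Hess g h sigma a b) = - ev Wx rho.
Proof.
have [y yE] := dnu_dotT g_sym hg sigma rho.
have D a : ev Wx (der a (1 + sigma ^+ n * B)) = 0.
  rewrite raddfD der1 add0r (_ : sigma ^+ n = sigma ^+ n.-2.+2); last by congr (_ ^+ _).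
  by rewrite der_sigmaX rmorphD !rmorphM !rmorphXn ev_sigma !expr0n !mul0r addr0.
have L : ev Wx (dnu nu (1 + sigma ^+ n * B)) = 0.
  by rewrite /dnu rmorph_sum big1 // => a _; rewrite rmorphM D mulr0.
rewrite Iunit in yE; have := etrans (esym L) (congr1 (ev Wx) yE).
rewrite rmorphD (rmorphM _ sigma) ev_sigma mul0r addr0 (rmorphM _ 2) rmorphD.
rewrite (rmorphM _ rho) ev_nu_sigma mulr1 rmorph_nat => /esym/eqP; rewrite -/nu.
by rewrite mulf_eq0 pnatr_eq0 /= addr_eq0 => /eqP.
Qed.

(** [n - 1] times the mean curvature is the Laplacian of [sigma] minus its normal-normal Hessian,
    hence [- n rho + rho] where [sigma] is zero. *)
Lemma mean_curvatureE : mean_curvature G sg x = - ev Wx rho.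
Proof.
rewrite /mean_curvature uc_x.
have n1 : n%:R - 1 != 0 :> R.
  by rewrite subr_eq0 pnatr_eq1; case: n n_gt2 => [|[|]].
have -> : \sum_a \sum_b (ginv G x a b - (grad sg x *m ginv G x) 0 a * (grad sg x *m ginv G x) 0 b)
    * (pd (fun y => unit_conormal G sg y 0 b) a x
       - \sum_c christoffel G c a b x * grad sg x 0 c) =
    \sum_a \sum_b (ev Wx (h a b) - ev Wx (nu a) * ev Wx (nu b)) * ev Wx (Hess g h sigma a b)
    + \sum_a pd r a x * (\sum_b ev Wx (h a b) * ev Wx (der b sigma)
      - ev Wx (nu a) * \sum_b ev Wx (nu b) * ev Wx (der b sigma)).
  rewrite -big_split; apply: eq_bigr => a _; rewrite mulr_sumr -sumrB mulr_sumr.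
  rewrite -big_split; apply: eq_bigr => b _.
  rewrite pd_uc ev_Hess (pd_sg b Wx) !(nuE Wx) (rep_ginv Gg hg Wx) mxE.
  rewrite (eq_bigr (fun c => christoffel G c a b x * pd sg c x)); last first.
    by move=> c _; rewrite [grad _ _ _ _]mxE.
  by rewrite -[RHS]/(_ + _); ring.
(* The derivative of the normalizing factor [r] multiplies the conormal, which the tangential
   projection annihilates. *)
rewrite [\sum_a pd r a x * _]big1 ?addr0; last first.
  move=> a _; have -> : \sum_b ev Wx (nu b) * ev Wx (der b sigma) = 1.
    by rewrite -ev_nu_sigma /dnu rmorph_sum; apply: eq_bigr => b _; rewrite rmorphM.
  have -> : \sum_b ev Wx (h a b) * ev Wx (der b sigma) = ev Wx (nu a).
    rewrite /nu rmorph_sum; apply: eq_bigr => b _.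
    by rewrite rmorphM (hE g_sym hg a b).
  by rewrite mulr1 subrr mulr0.
have -> : \sum_a \sum_b (ev Wx (h a b) - ev Wx (nu a) * ev Wx (nu b)) * ev Wx (Hess g h sigma a b)
    = ev Wx (lapS h (Chr g h) sigma)
      - ev Wx (\sum_a \sum_b nu a * nu b * Hess g h sigma a b).
  rewrite /lapS [X in _ = X - _]rmorph_sum [X in _ = _ - X]rmorph_sum -sumrB.
  apply: eq_bigr => a _.
  rewrite [X in _ = X - _]rmorph_sum [X in _ = _ - X]rmorph_sum -sumrB.
  apply: eq_bigr => b _.
  rewrite (rmorphM _ (h a b)) (rmorphM _ (nu a * nu b)) (rmorphM _ (nu a)).
  by rewrite -/(Hess g h sigma a b); move: (ev Wx (Hess _ _ _ _ _)) => t; ring.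
rewrite nn_Hess opprK.
have -> : ev Wx (lapS h (Chr g h) sigma) = - (n%:R * ev Wx rho).
  have := congr1 (ev Wx) (rhoAE g h n_gt2 sigma).
  rewrite rmorphM rmorphN rmorphD (rmorphM _ (schJ g h)) ev_sigma mulr0 addr0 rmorph_nat => ->.
  by rewrite opprK.
apply: (mulfI n1); rewrite mulrA mulfV // mul1r; ring.
Qed.

Lemma normal_tractorE : normal_tractor G sg x = I x.
Proof.
rewrite (rep_scale_tractor Gg hg n_gt2 sgr Wx) mktr_ev /normal_tractor.
rewrite mean_curvatureE opprK ev_sigma uc_x; congr mktr.
by apply/rowP => a; rewrite !mxE pd_sg.
Qed.

End AtPoint.

Section HolographicSection.
Hypothesis Isq_gt0 : forall x, dset W x -> 0 < tdot G x (I x) (I x).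
Hypothesis pd_zero : forall (f : A),
  (forall x (Wx : dset W x), sg x = 0 -> ev Wx f = 0) ->
  forall x, dset W x -> sg x = 0 -> exists l, forall a, pd (sfun_val f) a x = l * pd sg a x.
Variables (N : 'rV[R]_n -> 'rV[R]_(1 + n + 1)) (N' : 'rV[A]_(1 + n + 1)).
Hypothesis NN' : repV N N'.
Hypothesis N_ext : forall x, dset W x -> sg x = 0 -> N x = normal_tractor G sg x.

Lemma holographic_sectionE x (Wx : dset W x) : sg x = 0 ->
  holographic_section G sg N x = mktr 0 0 ((n`! * (n.-2)`!)%:R / 2 * ev Wx B).
Proof.
move=> x0.
pose Z (f : A) := forall x (Wx : dset W x), sg x = 0 -> ev Wx f = 0.
have [sinv sinvK] := rep_inv rep_conormal_sq q_gt0.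
have [Iinv IinvK] := rep_inv rep_Isq Isq_gt0.
have Z0 : Z 0 by move=> y Wy _; rewrite rmorph0.
have ZD u v : Z u -> Z v -> Z (u + v).
  by move=> Zu Zv y Wy y0; rewrite rmorphD Zu // Zv // addr0.
have ZM u v : Z v -> Z (u * v) by move=> Zv y Wy y0; rewrite rmorphM Zv // mulr0.
have Zsigma : Z sigma by move=> y Wy y0; rewrite -(sgr Wy).
have nE : n = n.-2.+2 by case: n n_gt2 => [|[|[|]]].
(* For [f] in [Z] the gradient is a multiple [l] of that of [sigma], and the two terms of [dtan]
   then coincide. *)
have Ztan a f : Z f -> Z (dtan sigma nu a f).
  move=> Zf y Wy y0; have [l lP] := pd_zero Zf Wy y0.
  have E c : ev Wy (der c f) = l * ev Wy (der c sigma).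
    by rewrite ev_der lP (pd_sg c Wy).
  rewrite /dtan rmorphB !rmorphM E.
  have -> : ev Wy (dnu nu f) = l * ev Wy (dnu nu sigma).
    rewrite /dnu [LHS]rmorph_sum [X in _ = _ * X]rmorph_sum mulr_sumr; apply: eq_bigr => c _.
    by rewrite (rmorphM _ (nu c)) [X in _ = _ * X](rmorphM _ (nu c)) E mulrCA.
  by ring.
have NI i : Z ((N' - scaleT sigma rho) 0 i).
  move=> y Wy y0; have E := rep_scale_tractor Gg hg n_gt2 sgr Wy.
  have := NN' Wy; rewrite N_ext // normal_tractorE // E => /rowP/(_ i).
  by rewrite !mxE rmorphB => ->; rewrite subrr.
have H := holographic_bracket g_sym hg n_gt2 (rhoAE g h n_gt2 sigma) Z0 ZD ZM nE Zsigma Iunit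
  IinvK sinvK Ztan NI.
have Ir := rep_scale_tractor Gg hg n_gt2 sgr.
have rn V v a := @rep_tractor_connection _ _ _ _ _ _ Gg hg n_gt2 V v a.
have T1 := rep_tangential_pow Gg hg Ir rn IinvK 0 n.-2.+1 NN'.
have KX : repV (fun y => Kext G sg y *: canonical_X R n) (Knab g h sigma rho *: tmk 0 0 1).
  move=> y Wy; rewrite map_mxZ (rep_Kext Gg g_sym hg n_gt2 sgr Wy) mktr_ev rmorph0 rmorph1.
  by rewrite map_mx0.
have T2 := rep_IdotD_pow Gg hg Ir rn (-1) n.-2 KX.
have E : tangential_pow G I (tractor_connection G) 0 n.-1 N x
     + (-1) ^+ (n - 2) *: IdotD_pow G I (tractor_connection G) (-1) (n - 2)
         (fun y => Kext G sg y *: canonical_X R n) x =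
  mktr 0 0 ((n`! * (n.-2)`!)%:R / 2 * ev Wx B).
  rewrite subn2 [n.-1](_ : _ = n.-2.+1); last by case: n n_gt2 => [|[|]].
  rewrite (T1 x Wx) (T2 x Wx).
  have -> : mktr 0 0 ((n`! * (n.-2)`!)%:R / 2 * ev Wx B) =
      map_mx (ev Wx) ((cst ((n`! * (n.-2)`!)%:R / 2) * B) *: (tmk 0 0 1 : 'rV[A]_(1 + n + 1))).
    rewrite map_mxZ mktr_ev rmorph0 rmorph1 map_mx0 rmorphM ev_cst.
    by rewrite /mktr !scale_row_mx !scale_scalar_mx scaler0 mulr0 mulr1.
  apply/rowP => i; have [/(_ x Wx x0) + _] := H i.
  by rewrite !mxE rmorphB rmorphD !rmorphM rmorphXn rmorphN1 => /subr0_eq.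
(* The top slot of the normal tractor is zero, so it is orthogonal to multiples of [X], and these
   are unchanged by the projection. *)
rewrite /holographic_section E /normal_projection.
rewrite tdotE !mktrK.
by rewrite mul0r mulr0 trmx0 mulmx0 mxE !addr0 scale0r subr0.
Qed.

End HolographicSection.

End LocalHypersurface.

Lemma open_preimage_on (X Y : topologicalType) (V : set X) (f : X -> Y) (W : set Y) :
  open V -> (forall x, V x -> {for x, continuous f}) -> open W ->
  open [set x | V x /\ W (f x)].
Proof.
move=> oV cf oW; rewrite openE => x [Vx Wfx].
have n1 : nbhs x V by exact: open_nbhs_nbhs.
have n2 : nbhs x (f @^-1` W) by apply: (cf x Vx); exact: open_nbhs_nbhs.
exact: (@filterI _ _ (nbhs_filter x) _ _ n1 n2).
Qed.

Lemma posdef_inv (R : realFieldType) n (g : 'M[R]_n) :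
  g^T = g -> posdef g -> posdef (invmx g).
Proof.
move=> gs gp v v0; have gu := posdef_unitmx gp.
have := gp (v *m invmx g); rewrite mulmxKV // trmx_mul trmx_inv gs mulmxA; apply.
by apply: contraNneq v0 => E; rewrite -(mulmxKV gu v) E mul0mx.
Qed.

Section Proportional.
Variables (R : realType) (m n : nat) (V : set 'rV[R]_m) (W : set 'rV[R]_n).
Variables (F : 'rV[R]_m -> 'rV[R]_n) (y : 'rV[R]_m).
Hypotheses (oV : open V) (oW : open W) (Vy : V y) (WFy : W (F y)).
Hypothesis sF : forall k, smooth_on V (fun z => F z 0 k).

Lemma annihilates_tangent (f : 'rV[R]_n -> R) : smooth_on W f ->
  (forall z, V z -> W (F z) -> f (F z) = 0) ->
  jacobian F y *m (grad f (F y))^T = 0.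
Proof.
move=> sf f0.
have dF z : V z -> differentiable F z by exact: smooth_map_differentiable oV sF.
have oD : open [set z | V z /\ W (F z)].
  by apply: open_preimage_on => // z Vz; exact/differentiable_continuous/dF.
have df := smooth_differentiable oW sf WFy.
apply/colP => a; rewrite [LHS]mxE [RHS]mxE.
transitivity (pd (f \o F) a y); last first.
  have E : pd (fun=> 0 : R) a y = 0 by rewrite /pd derive_cst.
  have Dy : [set z | V z /\ W (F z)] y by split.
  rewrite -E; apply: pd_eq Dy => // z [Vz Wz]; exact: f0.
by rewrite (pd_comp _ df (dF y Vy)); apply: eq_bigr => k _; rewrite [X in _ * X]mxE [X in _ * X]mxE.
Qed.

(** Gradients of functions that vanish on the hypersurface annihilate its tangent space, and the
    nonzero gradient of [s] spans the line of such covectors. *)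
Lemma pd_proportional (f s : 'rV[R]_n -> R) : n = m.+1 -> row_free (jacobian F y) ->
  smooth_on W f -> smooth_on W s ->
  (forall z, V z -> W (F z) -> f (F z) = 0) ->
  (forall z, V z -> W (F z) -> s (F z) = 0) -> grad s (F y) != 0 ->
  exists l, forall a, pd f a (F y) = l * pd s a (F y).
Proof.
move=> nE Jf sf ss f0 s0 gs.
have [l lE] := conormal_proportional nE Jf (annihilates_tangent ss s0)
  (annihilates_tangent sf f0) gs.
by exists l => a; move/rowP/(_ a): lE; rewrite !mxE.
Qed.

End Proportional.

Section ManifoldCharts.
Variables (R : realType).

Lemma open_chart_preimage (T : topologicalType) n (c : chart R T n) (U : set T) :
  open U -> open [set x | ccod c x /\ U (cinv c x)].
Proof.
by move=> oU; apply: open_preimage_on oU; [exact: open_ccod|exact: cinv_continuous].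
Qed.

Lemma open_local_dom m n (S : manifold R m) (M : manifold R n) (f : S -> M) j i :
  continuous f -> open (local_dom f j i).
Proof.
move=> cf; apply: (@open_preimage_on _ _ _ (f \o cinv (atlas S j))).
- exact: open_ccod.
- move=> y cy; apply: continuous_comp; [exact: cinv_continuous|exact: cf].
- exact: open_cdom.
Qed.

End ManifoldCharts.

(** * The holographic formula *)

Theorem theorem7p7 (R : realType) (d : nat) (hd : (3 <= d)%N)
  (M : manifold R d) (M_oriented : oriented M) (c : conformal_class M)
  (S : manifold R d.-1) (iota : S -> M) (iota_emb : smooth_embedding iota)
  (sigma : density M 1) (sigma_def : defining_density iota c sigma)
  (B : density M (- d%:R)) (sigma_unit : conformal_unit c sigma B)
  (U : set M) (U_open : open U) (U_nbhd : range iota `<=` U)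
  (N : tractor_field c U 0) (N_ext : extends_normal_tractor iota sigma N) :
  forall (g : metric M), c g ->
  forall (s : S) (j : midx S) (i : midx M),
    cdom (atlas S j) s -> cdom (atlas M i) (iota s) ->
    let F := local_map iota j i in
    let G := gmat g i in
    let sigma_g := in_scale g sigma i in
    in_scale g B i (cmap (atlas M i) (iota s)) =
      2 / (d`! * (d.-1)`!)%:R *
      thomasD_contraction (pullback_metric G F) (1 - d%:R)
        (to_intrinsic G F sigma_g
           (holographic_section G sigma_g (tcomp N g i)))
        (cmap (atlas S j) s).
Proof.
move=> g cg s j i js is_ F G sg.
have [[[iota_c iota_s] iota_imm] _ _] := iota_emb.
have [zeros grads] := sigma_def.
pose x0 := cmap (atlas M i) (iota s); pose y0 := cmap (atlas S j) s.
have Fy0 : F y0 = x0 by rewrite /F /local_map /y0 cmapK.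
pose O := [set x | ccod (atlas M i) x /\ U (cinv (atlas M i) x)].
have oO : open O by exact: open_chart_preimage.
have Ox0 : O x0.
  by split; [exact: cmap_cod|rewrite cmapK //; apply: U_nbhd; exists s].
have OC : O `<=` ccod (atlas M i) by move=> x [].
have Gs x : O x -> (G x)^T = G x by move=> /OC; exact: gmat_sym.
have Gp x : O x -> posdef (G x) by move=> /OC; exact: gmat_pos.
have Gsm a b : smooth_on O (fun x => G x a b).
  by apply: smooth_sub OC _; exact: gmat_smooth.
(* The domain is found in two stages: over [O] the squared gradient and [I.I] are shown to be
   smooth, and [W1] is the open part where both are positive, so that their reciprocals exist in its
   ring. *)
pose W0 : domain R d := Domain oO (ex_intro _ x0 Ox0).
have [g0 [h0 [Gg0 g0_sym hg0]]] := @rep_metric R d W0 G Gsm Gs Gp.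
have det_sm : smooth_on O (fun x => \det (G x)).
  apply: (@rep_smooth R d W0 _ (\det g0)) => x Wx.
  by rewrite (Gg0 x Wx) det_map_mx.
have det_gt0 x : O x -> 0 < \det (G x) by move=> Ox; exact/posdef_det_gt0/Gp.
have scale_sm w (f : density M w) : smooth_on O (in_scale g f i).
  apply: smooth_mul => //; last exact: smooth_powR.
  by apply: smooth_sub OC _; exact: dens_smooth.
have sg_sm : smooth_on O sg by exact: scale_sm.
have sg0 x : ccod (atlas M i) x -> (sg x = 0 <-> range iota (cinv (atlas M i) x)).
  move=> Cx; rewrite -zeros // /sg /in_scale; split=> [/eqP|->]; last by rewrite mul0r.
  have dx : 0 < \det (G x) by apply: posdef_det_gt0; exact: gmat_pos.
  by rewrite mulf_eq0 [X in _ || X]gt_eqF ?orbF ?powR_gt0 // => /eqP.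
have unit x : O x -> tdot G x (scale_tractor G sg x) (scale_tractor G sg x) =
    1 + sg x ^+ d * in_scale g B i x.
  by move=> /OC Cx; exact: sigma_unit.
pose q := conormal_sq G sg.
pose I2 x := tdot G x (scale_tractor G sg x) (scale_tractor G sg x).
have q_sm : smooth_on O q.
  exact: rep_smooth (rep_conormal_sq Gg0 hg0 (rep_mk (W := W0) sg_sm)).
have I2_sm : smooth_on O I2.
  exact: rep_smooth (rep_Isq Gg0 hg0 hd (rep_mk (W := W0) sg_sm)).
have oP : open [set r : R | 0 < r] by exact: open_gt.
pose W' := [set x | O x /\ [set r : R | 0 < r] (q x)].
have oW' : open W'.
  by apply: open_preimage_on oP => // x Ox; exact: smooth_continuous q_sm Ox.
pose W1 := [set x | W' x /\ [set r : R | 0 < r] (I2 x)].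
have oW1 : open W1.
  by apply: open_preimage_on oP => // x [Ox _]; exact: smooth_continuous I2_sm Ox.
(* The shrinking loses no zero of [sg] in the chart: there the gradient is nonzero and [I.I] is
   1. *)
have W1P x : ccod (atlas M i) x -> sg x = 0 -> W1 x.
  move=> Cx sx; have rx : range iota (cinv (atlas M i) x) by apply/sg0.
  have Ox : O x by split=> //; exact: U_nbhd.
  split; last by rewrite /= /I2 unit // sx expr0n gtn_eqF ?mul0r ?addr0 ?ltr01 // (ltn_trans _ hd).
  split=> //=; apply: (posdef_inv (Gs x Ox) (Gp x Ox)).
  exact: grads cg Cx rx.
have sgx0 : sg x0 = 0.
  by apply/sg0; [exact: cmap_cod|rewrite cmapK //; exists s].
have W1x0 : W1 x0 by apply: W1P => //; exact: cmap_cod.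
pose W : domain R d := Domain oW1 (ex_intro _ x0 W1x0).
have WO : W1 `<=` O by move=> x [[]].
have WC x : W1 x -> ccod (atlas M i) x by move=> /WO /OC.
have [gA [hA [Gg gA_sym hgA]]] : exists g h : 'M[sring W]_d,
    [/\ repV G g, g^T = g & h *m g = 1%:M].
  apply: rep_metric => [a b|x /WO|x /WO]; [exact: smooth_sub WO (Gsm a b)|exact: Gs|exact: Gp].
pose sgA : sring W := mksfun (smooth_sub WO sg_sm : smooth_on W sg).
have sgr : rep sg sgA by exact: rep_mk.
have B_sm : smooth_on W (in_scale g B i) by apply: (smooth_sub WO); exact: scale_sm.
pose BA : sring W := mksfun B_sm.
have N_sm A : smooth_on W (fun x => tcomp N g i x 0 A).
  by apply: (smooth_sub WO); exact: tcomp_smooth.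
pose NA : 'rV[sring W]_(1 + d + 1) := \row_A mksfun (N_sm A).
have NN : repV (tcomp N g i) NA.
  by move=> x Wx; apply/rowP => A; rewrite !mxE evE mksfunE.
have Iunit : dotT hA (scaleT sgA (rhoA gA hA sgA)) (scaleT sgA (rhoA gA hA sgA)) =
    1 + sgA ^+ d * BA.
  apply: rep_inj (rep_Isq Gg hgA hd sgr) _ => x Wx.
  rewrite unit; last exact/WO.
  by rewrite rmorphD rmorph1 rmorphM rmorphXn -(sgr x Wx) -(rep_mk B_sm Wx).
have q_gt0 x : dset W x -> 0 < conormal_sq G sg x by case=> -[].
have I2_gt0 x : dset W x -> 0 < I2 x by case.
have dE : d = d.-1.+1 by case: (d) hd.
have tangent (f : sring W) :
    (forall x (Wx : dset W x), sg x = 0 -> ev Wx f = 0) ->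
    forall x, dset W x -> sg x = 0 ->
      exists l, forall a, pd (sfun_val f) a x = l * pd sg a x.
  move=> f0 x Wx sx.
  have [s' _ s'x] : range iota (cinv (atlas M i) x) by apply/sg0 => //; exact: WC.
  (* The preimage of [x] may lie outside the chart [j], so the embedding is read in a chart around
     that preimage. *)
  have [j' j's] := atlas_cover s'.
  pose y' := cmap (atlas S j') s'; pose F' := local_map iota j' i.
  have Cx : ccod (atlas M i) x by exact: WC.
  have Fy' : F' y' = x by rewrite /F' /local_map /y' cmapK // s'x cinvK.
  have oV : open (local_dom iota j' i) by exact: open_local_dom.
  have Vy' : local_dom iota j' i y'.
    by split; [exact: cmap_cod|rewrite cmapK // s'x; exact: cinv_dom].
  have sgF z : local_dom iota j' i z -> sg (F' z) = 0.
    move=> [Cz Dz]; apply/sg0; first exact: cmap_cod.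
    by rewrite /F' /local_map cmapK //; exists (cinv (atlas S j') z).
  have WFy' : W1 (F' y') by rewrite Fy'.
  rewrite -Fy'; apply: (pd_proportional oV oW1 Vy' WFy' (iota_s j' i) dE).
  - exact: iota_imm.
  - exact: (sfun_smooth f).
  - exact: (smooth_sub WO sg_sm).
  - by move=> z Vz Wz; apply: (f0 _ Wz); exact: sgF.
  - by move=> z Vz _; exact: sgF.
  - by rewrite Fy'; apply: grads cg Cx _; exists s'.
have N_normal x : dset W x -> sg x = 0 -> tcomp N g i x = normal_tractor G sg x.
  by move=> Wx sx; apply: N_ext => //; [exact: WC|apply/sg0 => //; exact: WC].
have hol x (Wx : dset W x) := holographic_sectionE Gg gA_sym hgA hd sgr Iunit q_gt0
  I2_gt0 tangent NN N_normal Wx.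
have oV : open (local_dom iota j i) by exact: open_local_dom.
have dF z : local_dom iota j i z -> differentiable F z.
  exact: smooth_map_differentiable oV (iota_s j i).
have Vy0 : local_dom iota j i y0 by split; [exact: cmap_cod|rewrite cmapK].
(* The section is differentiated along the hypersurface, so its value is needed on a whole
   neighbourhood of [y0]. *)
have oD : open [set z | local_dom iota j i z /\ W1 (F z)].
  by apply: open_preimage_on => // z Vz; exact/differentiable_continuous/dF.
pose k : R := (d`! * (d.-2)`!)%:R / 2.
have VE z : [set z | local_dom iota j i z /\ W1 (F z)] z ->
    to_intrinsic G F sg (holographic_section G sg (tcomp N g i)) z =
    mktr 0 0 (k * in_scale g B i (F z)).
  move=> [[Cz Dz] Wz]; have sz : sg (F z) = 0.
    apply/sg0; first exact: cmap_cod.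
    by rewrite /F /local_map cmapK //; exists (cinv (atlas S j) z).
  rewrite /to_intrinsic (hol _ Wz sz) !mktrK !mulr0 scale0r subr0 mul0mx addr0.
  by rewrite -(rep_mk B_sm Wz).
have Gpb : posdef (pullback_metric G F y0).
  apply: posdef_pullback; first exact: iota_imm.
  by rewrite Fy0; exact: Gp.
rewrite (@intrinsic_contraction R d.-1 _ _ _ (fun z => k * in_scale g B i (F z)) y0 oD _ VE).
- rewrite Fy0 -/x0 /k.
  (* The factor [d - 1] of the intrinsic contraction completes [(d - 2)!] in [k] to [(d - 1)!], and
     the prefactor cancels. *)
  have d1 : (d.-1)`! = (d.-1 * (d.-2)`!)%N by case: (d) hd => [|[|]].
  have f0 t : (t`!%:R : R) != 0 by rewrite pnatr_eq0 -lt0n fact_gt0.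
  have dn : (d.-1%:R : R) != 0 by rewrite pnatr_eq0; case: (d) hd => [|[|]].
  rewrite d1 !natrM; field; rewrite ?f0 ?dn //.
- by split; [exact: Vy0|rewrite Fy0; exact: W1x0].
- by rewrite /pullback_metric !trmx_mul trmxK Fy0 Gs // mulmxA.
- exact: posdef_unitmx.
- by rewrite [in 1 - _]dE -[d.-1.+1%:R]natr1; ring.
Qed.
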